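(* Let $\mathcal{L}$ be a real line arrangement in $\mathbb{CP}^2$ with $t$ non-collinear multiple points $P_1,\dots,P_t$, and let $k_i+1$ be the multiplicity of $P_i$ for $1\le i\le t$. Let $\mathbb{C}^2\subset\mathbb{CP}^2$ be the complement of a line at infinity not belonging to $\mathcal{L}$ and such that all intersection points of lines of $\mathcal{L}$ lie in $\mathbb{C}^2$. Then $$\pi_1(\mathbb{C}^2-\mathcal{L})\cong\Big(\bigoplus_{i=1}^t\mathbb{F}^{k_i}\Big)\oplus\mathbb{Z}^t .$$
   Context: A real line arrangement is a finite union of distinct projective lines in $\mathbb{CP}^2$, each of which can be defined by a linear equation with real coefficients; $\mathcal{L}$ denotes both the set of lines and their union. A simple point is a point where exactly two lines of the arrangement meet; a multiple point is a point where more than two lines meet; the multiplicity of a point is the number of lines of the arrangement passing through it. An arrangement with $t$ non-collinear multiple points is an arrangement with exactly $t$ multiple points in which no line of the arrangement contains two multiple points, and which can be divided into $t$ subsets of lines such that all the lines in each subset intersect in a single multiple point (so every line passes through exactly one multiple point, and lines from different subsets meet in simple points only). $\mathbb{F}^k$ denotes the free group on $k$ generators, and $\oplus$ denotes the direct product of groups. *)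

(* Defs.v *)
From HB Require Import structures.
From mathcomp Require Import all_boot all_order all_algebra finmap.
From mathcomp Require Import all_classical all_reals all_analysis.
From mathcomp Require Import homotopy complex ring lra.

Set Implicit Arguments.
Unset Strict Implicit.
Unset Printing Implicit Defensive.

Import Order.TTheory GRing.Theory Num.Theory.
Import numFieldNormedType.Exports.

Local Open Scope classical_set_scope.
Local Open Scope quotient_scope.
Local Open Scope ring_scope.

Section UnitInterval.
Context (R : realType).

Definition unit_interval : Type := set_type (`[0, 1]%classic : set R).

HB.instance Definition _ := Topological.copy unit_interval
  (set_type (`[0, 1]%classic : set R)).

Definition ival (t : unit_interval) : R := set_val t.

Lemma clamp_subproof (t : R) : Num.max 0 (Num.min t 1) \in (`[0, 1]%classic : set R).
Proof.
by apply/mem_set; rewrite /= in_itv /= le_max lexx /= ge_max ler01 ge_min lexx orbT.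
Qed.

Definition clamp (t : R) : unit_interval := exist (fun s : R => s \in `[0, 1]%classic) _ (clamp_subproof t).

Lemma ival_ge0 t : 0 <= ival t.
Proof. by have /= := set_valP t; rewrite in_itv => /andP[]. Qed.

Lemma ival_le1 t : ival t <= 1.
Proof. by have /= := set_valP t; rewrite in_itv => /andP[]. Qed.

Lemma ival_clamp t : 0 <= t <= 1 -> ival (clamp t) = t.
Proof.
by move=> /andP[t0 t1]; rewrite /ival set_valE /= (min_idPl t1) (max_idPr t0).
Qed.

Lemma ival_inj : injective ival.
Proof. by move=> s t /val_inj. Qed.

Lemma clampK t : clamp (ival t) = t.
Proof. by apply: ival_inj; rewrite ival_clamp // ival_ge0 ival_le1. Qed.

Lemma ival_continuous : continuous ival.
Proof. exact: initial_continuous. Qed.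

Lemma clamp_continuous : continuous clamp.
Proof.
apply: (@continuous_comp_initial _ _ _ (@set_val R `[0, 1]%classic)).
apply: max_fun_continuous; first exact: cst_continuous.
apply: min_fun_continuous; first by move=> x; exact: cvg_id.
exact: cst_continuous.
Qed.

Lemma clamp01 : clamp 0 != clamp 1.
Proof.
apply/eqP => /(congr1 ival); rewrite !ival_clamp ?lexx ?ler01 //.
by move/eqP; rewrite eq_sym oner_eq0.
Qed.

HB.instance Definition _ :=
  @isBiPointed.Build unit_interval (clamp 0) (clamp 1) clamp01.

End UnitInterval.
Arguments ival {R}.
Arguments clamp {R}.

Section Pasting.
Context {R : realType} {X Y : topologicalType}.

Lemma pasting (h : X -> R) (c : R) (u v : X -> Y) :
  continuous h -> continuous u -> continuous v ->
  (forall x, h x = c -> u x = v x) ->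
  continuous (fun x => if h x <= c then u x else v x).
Proof.
move=> ch cu cv huv.
set w := fun x => _.
have clA : closed [set x | h x <= c].
  have -> : [set x | h x <= c] = h @^-1` [set r | r <= c] by [].
  by apply: closed_comp (@closed_le _ c) => x _; exact: ch.
have clB : closed [set x | c <= h x].
  have -> : [set x | c <= h x] = h @^-1` [set r | c <= r] by [].
  by apply: closed_comp (@closed_ge _ c) => x _; exact: ch.
apply/continuous_subspace_setT.
have -> : [set: X] = [set x | h x <= c] `|` [set x | c <= h x].
  by apply/seteqP; split=> x // _; case: (leP (h x) c) => [|/ltW]; [left|right].
apply: withinU_continuous => //.
- apply: (@subspace_eq_continuous _ _ _ u); last exact: continuous_subspaceT.
  by move=> x; rewrite inE /from_subspace /w /= => ->.
- apply: (@subspace_eq_continuous _ _ _ v); last exact: continuous_subspaceT.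
  move=> x; rewrite inE /from_subspace /w /= => hx; case: ifP => // hx'.
  by rewrite huv //; apply/eqP; rewrite eq_le hx hx'.
Qed.

End Pasting.

Lemma continuous_pair (X Y Z : topologicalType) (f : X -> Y) (g : X -> Z) :
  continuous f -> continuous g -> continuous (fun x => (f x, g x)).
Proof. by move=> cf cg x; apply: cvg_pair; [exact: cf|exact: cg]. Qed.

Section FundamentalGroup.
Context {R : realType} {T : topologicalType}.
Local Notation I := (unit_interval R).
Implicit Types x : T.

Definition homotopic x (f g : {path I from x to x in T}) : Prop :=
  exists H : I * I -> T,
    [/\ continuous H,
        forall t, H (t, zero) = f t /\ H (t, one) = g t
      & forall s, H (zero, s) = x /\ H (one, s) = x].

Lemma ival0 : ival (zero : I) = 0.
Proof. by rewrite /zero /= ival_clamp // lexx ler01. Qed.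

Lemma ival1 : ival (one : I) = 1.
Proof. by rewrite /one /= ival_clamp // lexx ler01. Qed.

Lemma clamp_le0 (t : R) : t <= 0 -> clamp t = zero.
Proof.
move=> t0; apply: ival_inj; rewrite ival0 /ival set_valE /=.
by rewrite (min_idPl (le_trans t0 ler01)) (max_idPl t0).
Qed.

Lemma clamp_ge1 (t : R) : 1 <= t -> clamp t = one.
Proof.
move=> t1; apply: ival_inj; rewrite ival1 /ival set_valE /=.
by rewrite (min_idPr t1) (max_idPr ler01).
Qed.

Lemma half_lt1 : 2^-1 < 1 :> R.
Proof. by lra. Qed.

Lemma clamp_comp_continuous (X : topologicalType) (h : X -> R) :
  continuous h -> continuous (fun z => clamp (h z)).
Proof.
by move=> ch z; apply: continuous_comp; [exact: ch|exact: clamp_continuous].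
Qed.

Lemma path_comp_continuous (X : topologicalType) x y
    (f : {path I from x to y in T}) (h : X -> I) :
  continuous h -> continuous (fun z => f (h z)).
Proof.
by move=> ch z; apply: continuous_comp; [exact: ch|exact: cts_fun].
Qed.

Lemma fst_continuous (X Y : topologicalType) : continuous (@fst X Y).
Proof. by move=> z; exact: cvg_fst. Qed.

Lemma snd_continuous (X Y : topologicalType) : continuous (@snd X Y).
Proof. by move=> z; exact: cvg_snd. Qed.

Lemma ival_comp_continuous (X : topologicalType) (h : X -> I) :
  continuous h -> continuous (fun z => ival (h z)).
Proof.
by move=> ch z; apply: continuous_comp; [exact: ch|exact: ival_continuous].
Qed.

Lemma affine_continuous (X : topologicalType) (h : X -> R) (a b : R) :
  continuous h -> continuous (fun z => a * h z + b).
Proof.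
move=> ch z; apply: cvgD; last exact: cvg_cst.
by apply: cvgM; [exact: cvg_cst|exact: ch].
Qed.

Lemma sub_continuous (X : topologicalType) (h k : X -> R) :
  continuous h -> continuous k -> continuous (fun z => h z - k z).
Proof. by move=> ch ck z; apply: cvgB; [exact: ch|exact: ck]. Qed.

Lemma mul_continuous (X : topologicalType) (h k : X -> R) :
  continuous h -> continuous k -> continuous (fun z => h z * k z).
Proof. by move=> ch ck z; apply: cvgM; [exact: ch|exact: ck]. Qed.

Section Reparam.
Context (x : T).
Implicit Types f g h : {path I from x to x in T}.

Lemma homotopic_reparam f (p q : R -> R) g h :
  continuous p -> continuous q -> p 0 = q 0 -> p 1 = q 1 ->
  (forall t, g t = f (clamp (p (ival t)))) ->
  (forall t, h t = f (clamp (q (ival t)))) -> homotopic g h.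
Proof.
move=> cp cq pq0 pq1 gE hE.
pose K (z : I * I) := (1 - ival z.2) * p (ival z.1) + ival z.2 * q (ival z.1).
exists (fun z => f (clamp (K z))); split.
- apply: path_comp_continuous; apply: clamp_comp_continuous => z.
  have c1 := ival_comp_continuous (@fst_continuous I I).
  have c2 := ival_comp_continuous (@snd_continuous I I).
  have cr (r : R -> R) : continuous r -> continuous (fun y : I * I => r (ival y.1)).
    by move=> c y; apply: continuous_comp; [exact: c1|exact: c].
  apply: cvgD; apply: cvgM.
  + by apply: cvgB; [exact: cvg_cst|exact: c2].
  + exact: cr.
  + exact: c2.
  + exact: cr.
- move=> t; rewrite /K /= ival0 ival1.
  by rewrite subr0 mul1r mul0r addr0 subrr mul0r mul1r add0r gE hE.
- have e (s r : R) : (1 - s) * r + s * r = r by rewrite -mulrDl subrK mul1r.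
  move=> s; rewrite /K /= ival0 ival1 -pq0 -pq1 !e.
  have := gE zero; have := gE one; rewrite ival0 ival1 => <- <-.
  by rewrite path_zero path_one.
Qed.

Lemma homotopic_refl f : homotopic f f.
Proof.
apply: (@homotopic_reparam f id id) => //.
1,2: by move=> z; exact: cvg_id.
all: by move=> t; rewrite clampK.
Qed.

Lemma homotopic_sym f g : homotopic f g -> homotopic g f.
Proof.
case=> H [cH Hfg Hx]; exists (fun z => H (z.1, clamp (- 1 * ival z.2 + 1))).
split.
- move=> z; apply: (@continuous_comp _ _ _ _ H); last exact: cH.
  move: z; apply: continuous_pair; first exact: fst_continuous.
  apply: clamp_comp_continuous; apply: affine_continuous.
  exact: ival_comp_continuous (@snd_continuous _ _).
- move=> t /=; rewrite ival0 ival1 clamp_ge1 ?mulr0 ?add0r //.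
  by rewrite clamp_le0 ?mulr1 ?addNr //; case: (Hfg t).
- by move=> s /=; exact: Hx.
Qed.

Lemma homotopic_trans f g h : homotopic f g -> homotopic g h -> homotopic f h.
Proof.
case=> H [cH Hfg Hx] [K [cK Kgh Kx]].
exists (fun z => if ival z.2 <= 2^-1 then H (z.1, clamp (2 * ival z.2 + 0))
                 else K (z.1, clamp (2 * ival z.2 + - 1))).
have c2 := ival_comp_continuous (@snd_continuous I I).
have half : 2 * 2^-1 = 1 :> R by rewrite divff // pnatr_eq0.
split.
- apply: pasting => //.
  + move=> z; apply: (@continuous_comp _ _ _ _ H); last exact: cH.
    move: z; apply: continuous_pair; first exact: fst_continuous.
    by apply: clamp_comp_continuous; exact: affine_continuous.
  + move=> z; apply: (@continuous_comp _ _ _ _ K); last exact: cK.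
    move: z; apply: continuous_pair; first exact: fst_continuous.
    by apply: clamp_comp_continuous; exact: affine_continuous.
  + move=> [t s] /= ->; rewrite half clamp_ge1 ?addr0 // clamp_le0 ?subrr //.
    by rewrite (Hfg t).2 (Kgh t).1.
- move=> t /=; rewrite ival0 ival1 invr_ge0 ler0n mulr0 addr0 clamp_le0 //.
  rewrite (Hfg t).1; split=> //.
  by rewrite leNgt half_lt1 /= clamp_ge1; [exact: (Kgh t).2|lra].
- by move=> s /=; case: ifP => _; [exact: Hx|exact: Kx].
Qed.

Definition const_loop : {path I from x to x in T} := cst x.

Definition rev_fun f (t : I) : T := f (clamp (1 - ival t)).

Lemma rev_continuous f : continuous (rev_fun f).
Proof.
rewrite /rev_fun; apply: (path_comp_continuous (f := f)).
apply: clamp_comp_continuous; apply: sub_continuous.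
- exact: cst_continuous.
- exact: ival_continuous.
Qed.

Lemma rev_zero f : rev_fun f zero = x.
Proof. by rewrite /rev_fun ival0 clamp_ge1 ?subr0 // path_one. Qed.

Lemma rev_one f : rev_fun f one = x.
Proof. by rewrite /rev_fun ival1 clamp_le0 ?subrr // path_zero. Qed.

Definition rev_loop f : {path I from x to x in T} :=
  mk_path (@rev_continuous f) (rev_zero f) (rev_one f).

Definition cat_fun f g (t : I) : T :=
  if ival t <= 2^-1 then f (clamp (2 * ival t)) else g (clamp (2 * ival t - 1)).

Lemma cat_continuous f g : continuous (cat_fun f g).
Proof.
have c := @ival_continuous R.
apply: pasting => //.
- apply: (path_comp_continuous (f := f)); apply: clamp_comp_continuous.
  by apply: mul_continuous; [exact: cst_continuous|exact: c].
- apply: (path_comp_continuous (f := g)); apply: clamp_comp_continuous.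
  apply: sub_continuous; last exact: cst_continuous.
  by apply: mul_continuous; [exact: cst_continuous|exact: c].
- move=> t ->; rewrite divff ?pnatr_eq0 // clamp_ge1 // clamp_le0 ?subrr //.
  by rewrite path_zero path_one.
Qed.

Lemma cat_zero f g : cat_fun f g zero = x.
Proof.
by rewrite /cat_fun ival0 invr_ge0 ler0n clamp_le0 ?mulr0 // path_zero.
Qed.

Lemma cat_one f g : cat_fun f g one = x.
Proof.
by rewrite /cat_fun ival1 leNgt half_lt1 /= clamp_ge1; [exact: path_one|lra].
Qed.

Definition cat_loop f g : {path I from x to x in T} :=
  mk_path (@cat_continuous f g) (cat_zero f g) (cat_one f g).

Lemma catE f g t : cat_loop f g t =
  if ival t <= 2^-1 then f (clamp (2 * ival t)) else g (clamp (2 * ival t - 1)).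
Proof. by []. Qed.

Lemma cat_homotopic f f' g g' :
  homotopic f f' -> homotopic g g' -> homotopic (cat_loop f g) (cat_loop f' g').
Proof.
case=> H [cH Hff Hx] [K [cK Kgg Kx]].
have c1 := ival_comp_continuous (@fst_continuous I I).
exists (fun z => if ival z.1 <= 2^-1 then H (clamp (2 * ival z.1), z.2)
                 else K (clamp (2 * ival z.1 - 1), z.2)).
split.
- apply: pasting => //.
  + move=> z; apply: (@continuous_comp _ _ _ _ H); last exact: cH.
    move: z; apply: continuous_pair; last exact: snd_continuous.
    apply: clamp_comp_continuous.
    by apply: mul_continuous; [exact: cst_continuous|exact: c1].
  + move=> z; apply: (@continuous_comp _ _ _ _ K); last exact: cK.
    move: z; apply: continuous_pair; last exact: snd_continuous.
    apply: clamp_comp_continuous.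
    apply: sub_continuous; last exact: cst_continuous.
    by apply: mul_continuous; [exact: cst_continuous|exact: c1].
  + move=> [t s] /= ->; rewrite divff ?pnatr_eq0 // clamp_ge1 // clamp_le0 ?subrr //.
    by rewrite (Hx s).2 (Kx s).1.
- move=> t; rewrite /= /mk_path /= /cat_fun.
  by case: ifP => _; [exact: Hff|exact: Kgg].
- move=> s; rewrite /= ival0 ival1 invr_ge0 ler0n mulr0 clamp_le0 // (Hx s).1.
  by rewrite leNgt half_lt1 /= clamp_ge1; [split=> //; exact: (Kx s).2|lra].
Qed.

Lemma rev_homotopic f f' : homotopic f f' -> homotopic (rev_loop f) (rev_loop f').
Proof.
case=> H [cH Hff Hx].
exists (fun z => H (clamp (1 - ival z.1), z.2)); split.
- move=> z; apply: (@continuous_comp _ _ _ _ H); last exact: cH.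
  move: z; apply: continuous_pair; last exact: snd_continuous.
  apply: clamp_comp_continuous; apply: sub_continuous.
    exact: cst_continuous.
  exact: ival_comp_continuous (@fst_continuous _ _).
- by move=> t; exact: Hff.
- move=> s /=; rewrite ival0 ival1 subr0 subrr clamp_ge1 // clamp_le0 //.
  by case: (Hx s).
Qed.

Lemma min_continuousR (h k : R -> R) :
  continuous h -> continuous k -> continuous (fun t => Num.min (h t) (k t)).
Proof. by move=> ch ck; exact: min_fun_continuous. Qed.

Lemma linear_continuousR (a b : R) : continuous (fun t => a * t + b).
Proof. by apply: affine_continuous => t; exact: cvg_id. Qed.

Lemma cat_assoc f g h :
  homotopic (cat_loop f (cat_loop g h)) (cat_loop (cat_loop f g) h).
Proof.
apply: homotopic_sym.
pose p (t : R) := Num.min (2 * t + 0) (Num.min (1 * t + 4^-1) (2^-1 * t + 2^-1)).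
apply: (@homotopic_reparam (cat_loop f (cat_loop g h)) p id).
- apply: min_continuousR; first exact: linear_continuousR.
  by apply: min_continuousR; exact: linear_continuousR.
- by move=> t; exact: cvg_id.
- by rewrite /p; case: (leP (1 * 0 + 4^-1)) => ?; case: leP => ? /=; lra.
- by rewrite /p; case: (leP (1 * 1 + 4^-1)) => ?; case: leP => ? /=; lra.
- move=> t; rewrite !catE.
  have t0 := ival_ge0 t; have t1 := ival_le1 t.
  have [t2|t2] := leP (ival t) 2^-1.
  + rewrite (@ival_clamp _ (2 * ival t)); last by lra.
    have [t4|t4] := leP (2 * ival t) 2^-1.
    * have -> : p (ival t) = 2 * ival t.
        by rewrite /p; case: (leP (1 * _ + 4^-1)) => ?; case: leP => ? /=; lra.
      by rewrite ival_clamp ?t4 //; lra.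
    * have -> : p (ival t) = ival t + 4^-1.
        by rewrite /p; case: (leP (1 * _ + 4^-1)) => ?; case: leP => ? /=; lra.
      rewrite ival_clamp; last by lra.
      rewrite ifF; last by apply/negbTE; rewrite -ltNge; lra.
      rewrite ival_clamp; last by lra.
      rewrite ifT; last by lra.
      by congr (g (clamp _)); lra.
  + have -> : p (ival t) = 2^-1 * ival t + 2^-1.
      by rewrite /p; case: (leP (1 * _ + 4^-1)) => ?; case: leP => ? /=; lra.
    rewrite ival_clamp; last by lra.
    rewrite ifF; last by apply/negbTE; rewrite -ltNge; lra.
    rewrite ival_clamp; last by lra.
    rewrite ifF; last by apply/negbTE; rewrite -ltNge; lra.
    by congr (h (clamp _)); lra.
- by move=> t; rewrite clampK.
Qed.

Lemma id_continuousR : continuous (id : R -> R).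
Proof. by move=> t; exact: cvg_id. Qed.

Lemma cat_const_l f : homotopic (cat_loop const_loop f) f.
Proof.
apply: (@homotopic_reparam f (fun t => Num.max 0 (2 * t + -1)) id).
- apply: max_fun_continuous; first exact: cst_continuous.
  exact: linear_continuousR.
- exact: id_continuousR.
- by case: leP => ? /=; lra.
- by case: leP => ? /=; lra.
- move=> t; rewrite catE; case: ifPn => [t2|].
    by rewrite max_l; [rewrite (clamp_le0 (lexx 0)) path_zero|lra].
  by rewrite -ltNge => t2; rewrite max_r //; lra.
- by move=> t; rewrite clampK.
Qed.

Lemma cat_const_r f : homotopic (cat_loop f const_loop) f.
Proof.
apply: (@homotopic_reparam f (fun t => Num.min (2 * t + 0) 1) id).
- apply: min_continuousR; first exact: linear_continuousR.
  exact: cst_continuous.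
- exact: id_continuousR.
- by case: leP => ? /=; lra.
- by case: leP => ? /=; lra.
- move=> t; rewrite catE; case: ifPn => [t2|].
    by rewrite min_l ?addr0 //; lra.
  rewrite -ltNge => t2; rewrite min_r; last by lra.
  by rewrite (clamp_ge1 (lexx 1)) path_one.
- by move=> t; rewrite clampK.
Qed.

Lemma cat_rev_r f : homotopic (cat_loop f (rev_loop f)) const_loop.
Proof.
apply: (@homotopic_reparam f (fun t => Num.min (2 * t + 0) (- 2 * t + 2))
         (fun=> 0)).
- by apply: min_continuousR; exact: linear_continuousR.
- exact: cst_continuous.
- by case: leP => ? /=; lra.
- by case: leP => ? /=; lra.
- move=> t; have t0 := ival_ge0 t; have t1 := ival_le1 t.
  rewrite catE; case: ifPn => [t2|].
    by rewrite min_l ?addr0 //; lra.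
  rewrite -ltNge => t2; rewrite min_r; last by lra.
  rewrite /= /mk_path /= /rev_fun ival_clamp; last by lra.
  by congr (f (clamp _)); lra.
- by move=> t; rewrite clamp_le0 // path_zero.
Qed.

Lemma cat_rev_l f : homotopic (cat_loop (rev_loop f) f) const_loop.
Proof.
apply: homotopic_trans (cat_rev_r (rev_loop f)).
apply: cat_homotopic; first exact: homotopic_refl.
apply: (@homotopic_reparam f id id) => //; try exact: id_continuousR.
  by move=> t; rewrite clampK.
move=> t; rewrite /= /mk_path /= /rev_fun /= /mk_path /rev_fun ival_clamp.
  by congr (f (clamp _)); lra.
by have := ival_ge0 t; have := ival_le1 t; lra.
Qed.

End Reparam.

Section Quotient.
Context (x : T).

Definition homotopicb (f g : {path I from x to x in T}) : bool :=
  `[< homotopic f g >].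

Lemma homotopicb_refl : reflexive homotopicb.
Proof. by move=> f; apply/asboolP; exact: homotopic_refl. Qed.

Lemma homotopicb_sym : symmetric homotopicb.
Proof. by move=> f g; apply/asboolP/asboolP; exact: homotopic_sym. Qed.

Lemma homotopicb_trans : transitive homotopicb.
Proof.
move=> g f h /asboolP fg /asboolP gh; apply/asboolP.
exact: homotopic_trans fg gh.
Qed.

Definition homotopy_equiv :=
  EquivRel homotopicb homotopicb_refl homotopicb_sym homotopicb_trans.

End Quotient.
End FundamentalGroup.

Definition pi1 (R : realType) (T : topologicalType) (x : T) : Type :=
  {eq_quot @homotopy_equiv R T x}.

Section Pi1Group.
Context (R : realType) (T : topologicalType) (x : T).
Local Notation pi1 := (@pi1 R T x).

HB.instance Definition _ := Choice.on pi1.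
HB.instance Definition _ := EqQuotient.on pi1.

Definition pi1_one : pi1 := \pi_pi1 (const_loop x).
Definition pi1_mul (a b : pi1) : pi1 := \pi_pi1 (cat_loop (repr a) (repr b)).
Definition pi1_inv (a : pi1) : pi1 := \pi_pi1 (rev_loop (repr a)).

Lemma pi1_eqP (f g : {path unit_interval R from x to x in T}) :
  \pi_pi1 f = \pi_pi1 g <-> homotopic f g.
Proof. by split=> [/eqmodP/asboolP|fg] //; apply/eqmodP/asboolP. Qed.

Lemma repr_pi1 f : homotopic (repr (\pi_pi1 f)) f.
Proof. by apply/pi1_eqP; rewrite reprK. Qed.

Lemma pi1_mulA : associative pi1_mul.
Proof.
move=> a b c; apply/pi1_eqP.
apply: homotopic_trans
  (cat_homotopic (homotopic_refl _) (repr_pi1 _)) _.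
apply: homotopic_trans (cat_assoc _ _ _) _.
exact: cat_homotopic (homotopic_sym (repr_pi1 _)) (homotopic_refl _).
Qed.

Lemma pi1_mul1 : left_id pi1_one pi1_mul.
Proof.
move=> a; rewrite -[RHS]reprK; apply/pi1_eqP.
apply: homotopic_trans (cat_homotopic (repr_pi1 _) (homotopic_refl _)) _.
exact: cat_const_l.
Qed.

Lemma pi1_mulr1 : right_id pi1_one pi1_mul.
Proof.
move=> a; rewrite -[RHS]reprK; apply/pi1_eqP.
apply: homotopic_trans (cat_homotopic (homotopic_refl _) (repr_pi1 _)) _.
exact: cat_const_r.
Qed.

Lemma pi1_mulV : left_inverse pi1_one pi1_inv pi1_mul.
Proof.
move=> a; apply/pi1_eqP.
apply: homotopic_trans (cat_homotopic (repr_pi1 _) (homotopic_refl _)) _.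
exact: cat_rev_l.
Qed.

Lemma pi1_mulrV : right_inverse pi1_one pi1_inv pi1_mul.
Proof.
move=> a; apply/pi1_eqP.
apply: homotopic_trans (cat_homotopic (homotopic_refl _) (repr_pi1 _)) _.
exact: cat_rev_r.
Qed.

HB.instance Definition _ := isGroup.Build pi1
  pi1_mulA pi1_mul1 pi1_mulr1 pi1_mulV pi1_mulrV.

End Pi1Group.

Section FreeGroup.
Context (k : nat).

(* The letter (i, true) stands for the generator x_i, (i, false) for x_i^-1. *)
Definition letter : Type := ('I_k * bool)%type.
Definition letter_inv (a : letter) : letter := (a.1, ~~ a.2).
Definition reduced (w : seq letter) : bool :=
  sorted (fun a b => b != letter_inv a) w.

HB.instance Definition _ := Finite.on letter.
Implicit Types (a b : letter) (u v w : seq letter).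

Definition red_cons a w : seq letter :=
  if w is b :: w' then if b == letter_inv a then w' else a :: w else [:: a].

Definition word_mul u v : seq letter := foldr red_cons v u.
Definition word_inv u : seq letter := rev (map letter_inv u).

Lemma letter_invK : involutive letter_inv.
Proof. by case=> i b; rewrite /letter_inv /= negbK. Qed.

Lemma reduced_behead a w : reduced (a :: w) -> reduced w.
Proof. exact: path_sorted. Qed.

Lemma red_cons_reduced a w : reduced w -> reduced (red_cons a w).
Proof.
case: w => [|b w] //= rw; case: eqVneq => [_|ba]; first exact: path_sorted rw.
by rewrite /reduced /= ba.
Qed.

Lemma red_consK a w : reduced w -> red_cons (letter_inv a) (red_cons a w) = w.
Proof.
case: w => [|b w] /=; first by rewrite letter_invK eqxx.
case: (eqVneq b) => [->|ba] /=; last by rewrite letter_invK eqxx.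
by case: w => [|c w] //=; rewrite letter_invK => /andP[/negbTE ->].
Qed.

Lemma word_mul_reduced u v : reduced v -> reduced (word_mul u v).
Proof. by move=> rv; elim: u => //= a u; exact: red_cons_reduced. Qed.

Lemma word_mul_cons a v w : reduced w ->
  word_mul (red_cons a v) w = red_cons a (word_mul v w).
Proof.
case: v => [|b v] //= rw; case: eqVneq => [->|//].
by rewrite -{1}[a]letter_invK red_consK // word_mul_reduced.
Qed.

Lemma word_mulA u v w : reduced w ->
  word_mul u (word_mul v w) = word_mul (word_mul u v) w.
Proof. by move=> rw; elim: u => //= a u ->; rewrite word_mul_cons. Qed.

Lemma word_mul1 u : reduced u -> word_mul u [::] = u.
Proof.
elim: u => //= a u IH ru; rewrite IH; last exact: reduced_behead ru.
by move: ru; case: u {IH} => //= b u; rewrite /reduced /= => /andP[/negbTE ->].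
Qed.

Lemma word_inv_reduced u : reduced u -> reduced (word_inv u).
Proof.
rewrite /reduced /word_inv rev_sorted sorted_map; apply: sub_sorted => a b /=.
by apply: contraNN => /eqP/(can_inj letter_invK) ->; rewrite letter_invK.
Qed.

Lemma word_invK : involutive word_inv.
Proof. by move=> u; rewrite /word_inv map_rev revK (mapK letter_invK). Qed.

Lemma word_mulV u : word_mul (word_inv u) u = [::].
Proof.
elim: u => //= a u IH; rewrite /word_inv /= rev_cons /word_mul foldr_rcons /=.
by rewrite letter_invK eqxx.
Qed.

Definition free_group : Type := {w : seq letter | reduced w}.
HB.instance Definition _ := Choice.on free_group.

Definition free_one : free_group := exist reduced [::] isT.
Definition free_mul (u v : free_group) : free_group :=
  exist reduced _ (word_mul_reduced (val u) (valP v)).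
Definition free_inv (u : free_group) : free_group :=
  exist reduced _ (word_inv_reduced (valP u)).

Lemma free_mulA : associative free_mul.
Proof. by move=> u v w; apply: val_inj; exact: word_mulA (valP w). Qed.

Lemma free_mul1 : left_id free_one free_mul.
Proof. by move=> u; exact: val_inj. Qed.

Lemma free_mulr1 : right_id free_one free_mul.
Proof. by move=> u; apply: val_inj; exact: word_mul1 (valP u). Qed.

Lemma free_mulV : left_inverse free_one free_inv free_mul.
Proof. by move=> u; apply: val_inj; exact: word_mulV. Qed.

Lemma free_mulrV : right_inverse free_one free_inv free_mul.
Proof.
move=> u; apply: val_inj => /=; rewrite -{1}[val u]word_invK; exact: word_mulV.
Qed.

HB.instance Definition _ := isGroup.Build free_group
  free_mulA free_mul1 free_mulr1 free_mulV free_mulrV.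

End FreeGroup.

Section DirectProduct.
Context (I : finType) (G : I -> groupType).
Local Open Scope group_scope.

Definition direct_prod : Type := forall i, G i.
HB.instance Definition _ := Choice.on direct_prod.
Implicit Types f g h : direct_prod.

Definition dprod_one : direct_prod := fun=> 1.
Definition dprod_mul f g : direct_prod := fun i => f i * g i.
Definition dprod_inv f : direct_prod := fun i => (f i)^-1.

Lemma dprod_mulA : associative dprod_mul.
Proof. by move=> f g h; apply: functional_extensionality_dep => i; exact: mulgA. Qed.

Lemma dprod_mul1 : left_id dprod_one dprod_mul.
Proof. by move=> f; apply: functional_extensionality_dep => i; exact: mul1g. Qed.

Lemma dprod_mulr1 : right_id dprod_one dprod_mul.
Proof. by move=> f; apply: functional_extensionality_dep => i; exact: mulg1. Qed.

Lemma dprod_mulV : left_inverse dprod_one dprod_inv dprod_mul.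
Proof. by move=> f; apply: functional_extensionality_dep => i; exact: mulVg. Qed.

Lemma dprod_mulrV : right_inverse dprod_one dprod_inv dprod_mul.
Proof. by move=> f; apply: functional_extensionality_dep => i; exact: mulgV. Qed.

HB.instance Definition _ := isGroup.Build direct_prod
  dprod_mulA dprod_mul1 dprod_mulr1 dprod_mulV dprod_mulrV.

End DirectProduct.

Definition group_isomorphic (G H : groupType) : Prop :=
  exists f : {multiplicative G -> H}, bijective f.

HB.instance Definition _ (R : realType) := PseudoPointedMetric.copy R[i] R[i]^o.

Section ProjectivePlane.
Context (R : realType).

Definition punctured_C3 : Type := set_type [set v : 'rV[R[i]]_3 | v != 0].
HB.instance Definition _ := Topological.copy punctured_C3
  (set_type [set v : 'rV[R[i]]_3 | v != 0]).

Definition coords (v : punctured_C3) : 'rV[R[i]]_3 := set_val v.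

Definition same_span (v w : punctured_C3) : bool := (coords v == coords w)%MS.

Lemma same_span_refl : reflexive same_span.
Proof. by move=> v; apply/eqmxP. Qed.

Lemma same_span_sym : symmetric same_span.
Proof. by move=> v w; rewrite /same_span andbC. Qed.

Lemma same_span_trans : transitive same_span.
Proof.
by move=> v u w /eqmxP uv /eqmxP vw; apply/eqmxP; exact: eqmx_trans uv vw.
Qed.

Definition same_span_equiv :=
  EquivRel same_span same_span_refl same_span_sym same_span_trans.

Definition CP2 : Type := {eq_quot same_span_equiv}.
HB.instance Definition _ :=
  Topological.copy CP2 (quotient_topology {eq_quot same_span_equiv}).
HB.instance Definition _ := EqQuotient.on CP2.

(* Zero locus of a linear form; independent of the representative (line_pi),
   and a projective line only when a != 0. *)
Definition line (a : 'cV[R[i]]_3) : set CP2 :=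
  [set p | coords (repr p) *m a = 0].

Lemma line_pi a v : line a (\pi_CP2 v) <-> coords v *m a = 0.
Proof.
have /eqmodP/andP[/submxP[c rc] /submxP[d vd]] :
  repr (\pi_CP2 v) = v %[mod CP2] by rewrite reprK.
rewrite /line /=; split=> [r0|v0].
  by rewrite vd -mulmxA r0 mulmx0.
by rewrite rc -mulmxA v0 mulmx0.
Qed.

Definition is_line (l : set CP2) : Prop :=
  exists2 a : 'cV[R[i]]_3, a != 0 & l = line a.

Definition is_real_line (l : set CP2) : Prop :=
  exists2 a : 'cV[R]_3, a != 0 & l = line (map_mx (real_complex R) a).

Section Arrangement.
Context (L : {fset (set CP2)}).

Definition real_line_arrangement : Prop :=
  forall l, l \in L -> is_real_line l.

Definition lines_union : set CP2 := \bigcup_(l in [set` L]) l.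

Definition multiplicity (p : CP2) : nat := #|` [fset l in L | `[< l p >]]%fset|.

Definition multiple_point (p : CP2) : Prop := (2 < multiplicity p)%N.

Definition noncollinear_multiple_points (t : nat) (P : 'I_t -> CP2) : Prop :=
  [/\ injective P,
      forall p, multiple_point p <-> exists i, P i = p,
      forall l p q, l \in L -> multiple_point p -> multiple_point q ->
        l p -> l q -> p = q
    & exists S : 'I_t -> {fset (set CP2)},
        [/\ forall l, l \in L <-> exists i, l \in S i,
            forall i j, i != j -> [disjoint S i & S j]%fset
          & forall i l, l \in S i -> l (P i)]].

End Arrangement.

(* h is the line at infinity, and the result a copy of C^2. *)
Definition affine_plane (h : set CP2) : set CP2 := ~` h.

End ProjectivePlane.

(* Main.v *)
(* Add the pencils one at a time, starting from the complement of h, which is a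
   copy of C^2. Let Z be the complement of h and of the pencils already present,
   and let l_0, ..., l_k be the lines of the next pencil. By pencil_pi1, removing
   k further lines of a pencil multiplies the fundamental group by F^k; use it
   twice.
   - Remove l_0 from Z, as a line of the pencil spanned by h and l_0, whose line
     h is at infinity: this contributes F^1.
   - Remove l_1, ..., l_k, taking l_0 as the line at infinity; then h is just
     another transversal line. This contributes F^k.

   In the chart where one line of the pencil is at infinity, the others are the
   vertical lines over points a_i of the base C = R^2, and the lines previously
   present are graphs w = r_j(m) that are pairwise disjoint off a finite set S of
   base points, with no a_i in S. Let E be the complement of the graphs and Y the
   part of E over the base without the a_i; then pi_1(Y) = pi_1(E) x
   pi_1(R^2 - {a_i}). After a shear of the base, some curve has all the a_i on one
   side and S on the other side. Homotopies of the base that avoid S lift to E by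
   moving points along with the graphs. Hence loops of a fibre commute with the
   image of the base under a section of E that avoids every graph, and a null
   homotopy in E of a loop of a fibre can be pushed across the curve into Y.

   The fundamental group of the plane without k points is computed with two slit
   planes, obtained by removing from each point the ray going up or the ray going
   down; the inverse of the map from the free group is the holonomy of the cocycle
   which records how a short segment crosses the rays. *)

Require Import Defs.
From HB Require Import structures.
From mathcomp Require Import all_boot all_order all_algebra finmap.
From mathcomp Require Import all_classical all_reals all_analysis.
From mathcomp Require Import homotopy complex ring lra zify.

Set Implicit Arguments.
Unset Strict Implicit.
Unset Printing Implicit Defensive.

Import Order.TTheory GRing.Theory Num.Theory.
Import numFieldNormedType.Exports.
Local Open Scope classical_set_scope.
Local Open Scope quotient_scope.
Local Open Scope ring_scope.

(** * Paths, homotopies and the fundamental groupoid *)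

(** They are replaced by a lifting property for homotopies which, point by point, either avoid [S]
    or stand still; a point is carried along with the strand nearest to it. The section counts as
    one more strand, so lifts respect it as well. No presentation of a group is computed: a loop
    pushed off [S] is a loop of the fibre times a loop in the section, and the pair of inclusion and
    projection is injective on such products. A pencil becomes a family of vertical lines only if
    one of its own lines is at infinity. Since [h] misses the vertex of the pencil, a line of the
    pencil has to be given up for this purpose, and removing that line itself requires another
    pencil, with vertex on [h]. Both times, the absence of an [a_i] in [S] says that a line being
    removed meets the old lines in simple crossings only, which comes from the simple points between
    pencils and from the generic position of [h]. *)

Section Paths.
Context {R : realType} {T : topologicalType}.
Local Notation I := (unit_interval R).
Implicit Types (A : set T) (p q r : I -> T) (f : R -> T).

(** Paths are maps into the ambient space with a membership condition, not maps into a subspace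
    type, so the same path can be regarded in several sets without coercions. *)
Definition path_in A x y p : Prop :=
  [/\ continuous p, forall t, A (p t), p zero = x & p one = y].

Definition path_homotopic A p q : Prop :=
  exists H : I * I -> T,
    [/\ continuous H, forall z, A (H z),
        forall t, H (t, zero) = p t /\ H (t, one) = q t
      & forall s, H (zero, s) = p zero /\ H (one, s) = p one].

Definition path_cat p q (t : I) : T :=
  if ival t <= 2^-1 then p (clamp (2 * ival t)) else q (clamp (2 * ival t - 1)).

(** The parameters [a] and [b] come in any order: [subpath f 1 0] is a reversal and [subpath f a a]
    a constant path, so the unit and inverse laws are cases of additivity. *)
Definition subpath (f : R -> T) (a b : R) (t : I) : T := f ((b - a) * ival t + a).

Lemma clamp0 : clamp (0 : R) = zero. Proof. exact: clamp_le0. Qed.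
Lemma clamp1 : clamp (1 : R) = one. Proof. exact: clamp_ge1. Qed.

Lemma continuous_comp2 (X Y Z : topologicalType) (f : X -> Y) (g : Y -> Z) :
  continuous f -> continuous g -> continuous (fun x => g (f x)).
Proof. by move=> cf cg x; apply: continuous_comp; [exact: cf|exact: cg]. Qed.

Lemma path_homotopic_refl A x y p : path_in A x y p -> path_homotopic A p p.
Proof.
case=> cp Ap p0 p1; exists (fun z => p z.1); split=> //.
by apply: (continuous_comp2 (@fst_continuous _ _)).
Qed.

Lemma path_homotopic_sym A p q : path_homotopic A p q -> path_homotopic A q p.
Proof.
case=> H [cH AH Hpq He]; exists (fun z => H (z.1, clamp (1 - ival z.2))); split=> //.
- apply: (@continuous_comp2 _ _ _ _ H) => //; apply: continuous_pair.
    exact: fst_continuous.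
  apply: clamp_comp_continuous; apply: Defs.sub_continuous; first exact: cst_continuous.
  exact: ival_comp_continuous (@snd_continuous _ _).
- move=> t /=; rewrite ival0 ival1 subr0 subrr clamp0 clamp1.
  by have [-> ->] := Hpq t.
- by move=> s /=; rewrite -(Hpq zero).2 -(Hpq one).2 !(He _).1 !(He _).2.
Qed.

Lemma path_homotopic_trans A p q r :
  path_homotopic A p q -> path_homotopic A q r -> path_homotopic A p r.
Proof.
case=> H [cH AH Hpq He] [K [cK AK Kqr Ke]].
exists (fun z => if ival z.2 <= 2^-1 then H (z.1, clamp (2 * ival z.2 + 0))
                 else K (z.1, clamp (2 * ival z.2 + - 1))).
have c2 := ival_comp_continuous (@snd_continuous I I).
have half : 2 * 2^-1 = 1 :> R by rewrite divff // pnatr_eq0.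
split.
- apply: pasting => //.
  + apply: (@continuous_comp2 _ _ _ _ H) => //; apply: continuous_pair.
      exact: fst_continuous.
    by apply: clamp_comp_continuous; exact: affine_continuous.
  + apply: (@continuous_comp2 _ _ _ _ K) => //; apply: continuous_pair.
      exact: fst_continuous.
    by apply: clamp_comp_continuous; exact: affine_continuous.
  + move=> [t s] /= ->; rewrite half clamp_ge1 ?addr0 // clamp_le0 ?subrr //.
    by rewrite (Hpq t).2 (Kqr t).1.
- by move=> z; case: ifP.
- move=> t /=; rewrite ival0 ival1 invr_ge0 ler0n mulr0 addr0 clamp_le0 //.
  rewrite (Hpq t).1; split=> //.
  by rewrite leNgt half_lt1 /= clamp_ge1; [exact: (Kqr t).2|lra].
- move=> s /=; case: ifP => _; first exact: He.
  by rewrite (Ke _).1 (Ke _).2 -(Hpq zero).2 -(Hpq one).2 (He _).1 (He _).2.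
Qed.

Lemma path_cat_in A x y z p q :
  path_in A x y p -> path_in A y z q -> path_in A x z (path_cat p q).
Proof.
case=> cp Ap p0 p1 [cq Aq q0 q1]; have c := @ival_continuous R; split.
- apply: pasting => //.
  + apply: (continuous_comp2 _ cp); apply: clamp_comp_continuous.
    by apply: Defs.mul_continuous; [exact: cst_continuous|exact: c].
  + apply: (continuous_comp2 _ cq); apply: clamp_comp_continuous.
    apply: Defs.sub_continuous; last exact: cst_continuous.
    by apply: Defs.mul_continuous; [exact: cst_continuous|exact: c].
  + move=> t ->; rewrite divff ?pnatr_eq0 // clamp_ge1 // clamp_le0 ?subrr //.
    by rewrite p1 q0.
- by move=> t; rewrite /path_cat; case: ifP.
- by rewrite /path_cat ival0 invr_ge0 ler0n mulr0 clamp0.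
- by rewrite /path_cat ival1 leNgt half_lt1 /= clamp_ge1; [exact: q1|lra].
Qed.

Lemma path_cat_homotopic A p p' q q' : p one = q zero ->
  path_homotopic A p p' -> path_homotopic A q q' ->
  path_homotopic A (path_cat p q) (path_cat p' q').
Proof.
move=> pq [H [cH AH Hp He]] [K [cK AK Kq Ke]].
have c1 := ival_comp_continuous (@fst_continuous I I).
exists (fun z => if ival z.1 <= 2^-1 then H (clamp (2 * ival z.1), z.2)
                 else K (clamp (2 * ival z.1 - 1), z.2)).
split.
- apply: pasting => //.
  + apply: (@continuous_comp2 _ _ _ _ H) => //; apply: continuous_pair; last exact: snd_continuous.
    apply: clamp_comp_continuous.
    by apply: Defs.mul_continuous; [exact: cst_continuous|exact: c1].
  + apply: (@continuous_comp2 _ _ _ _ K) => //; apply: continuous_pair; last exact: snd_continuous.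
    apply: clamp_comp_continuous.
    apply: Defs.sub_continuous; last exact: cst_continuous.
    by apply: Defs.mul_continuous; [exact: cst_continuous|exact: c1].
  + move=> [t s] /= ->; rewrite divff ?pnatr_eq0 // clamp_ge1 // clamp_le0 ?subrr //.
    by rewrite (He s).2 (Ke s).1.
- by move=> z; case: ifP.
- by move=> t; rewrite /path_cat /=; case: ifP => _; [exact: Hp|exact: Kq].
- move=> s; rewrite /path_cat /= ival0 ival1 invr_ge0 ler0n mulr0 clamp_le0 // (He s).1.
  by rewrite leNgt half_lt1 /= clamp_ge1; [split=> //; exact: (Ke s).2|lra].
Qed.

Definition convex_set (V : lmodType R) (C : set V) : Prop :=
  forall u v (t : R), C u -> C v -> 0 <= t <= 1 -> C ((1 - t) *: u + t *: v).

(* Straight-line homotopies in a convex set; all the groupoid laws are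
   instances, the two sides being reparametrizations of one map. *)
Lemma convex_homotopic A (V : normedModType R) (C : set V) (f : V -> T) (u v : I -> V) :
  convex_set C -> continuous f -> (forall c, C c -> A (f c)) ->
  continuous u -> continuous v -> (forall t, C (u t)) -> (forall t, C (v t)) ->
  u zero = v zero -> u one = v one ->
  path_homotopic A (fun t => f (u t)) (fun t => f (v t)).
Proof.
move=> cC cf Cf cu cv Cu Cv uv0 uv1.
have e (s : R) (w : V) : (1 - s) *: w + s *: w = w by rewrite -scalerDl subrK scale1r.
exists (fun z => f ((1 - ival z.2) *: u z.1 + ival z.2 *: v z.1)); split.
- apply: (continuous_comp2 _ cf).
  have c2 := ival_comp_continuous (@snd_continuous I I).
  have c12 : continuous (fun z : I * I => 1 - ival z.2).
    by apply: Defs.sub_continuous; [move=> z; exact: cvg_cst|exact: c2].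
  have cZ (a : I * I -> R) (w : I * I -> V) :
      continuous a -> continuous w -> continuous (fun z => a z *: w z).
    by move=> ca cw z; apply: cvgZ; [exact: ca|exact: cw].
  move=> z; apply: cvgD; apply: cZ => //.
  + exact: (continuous_comp2 (@fst_continuous _ _) cu).
  + exact: (continuous_comp2 (@fst_continuous _ _) cv).
- by move=> z; apply: Cf; apply: cC => //; rewrite ival_ge0 ival_le1.
- by move=> t /=; rewrite ival0 ival1 subr0 subrr !scale0r !scale1r addr0 add0r.
- by move=> s /=; rewrite -uv0 -uv1 !e.
Qed.

Lemma subpath_in A f (a b : R) : continuous f -> (forall t, A (f t)) ->
  path_in A (f a) (f b) (subpath f a b).
Proof.
move=> cf Af; split=> //.
- by apply: (continuous_comp2 _ cf); apply: affine_continuous; exact: ival_continuous.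
- by move=> t; exact: Af.
- by rewrite /subpath ival0 mulr0 add0r.
- by rewrite /subpath ival1 mulr1 subrK.
Qed.

End Paths.

Section Groupoid.
Context {R : realType} {T : topologicalType}.
Local Notation I := (unit_interval R).
Implicit Types (A : set T) (p q r : I -> T) (f : R -> T).

Lemma subpath_cat A f (a b c : R) : continuous f -> (forall t, A (f t)) ->
  path_homotopic A (path_cat (subpath f a b) (subpath f b c)) (subpath f a c).
Proof.
move=> cf Af.
have lin d e : path_in setT d e (subpath (@id R^o) d e).
  by apply: subpath_in => // z; exact: cvg_id.
have [cu _ u0 u1] := path_cat_in (lin a b) (lin b c).
have [cv _ v0 v1] := lin a c.
have -> : path_cat (subpath f a b) (subpath f b c) =
          fun t => f (path_cat (subpath (@id R^o) a b) (subpath (@id R^o) b c) t).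
  by apply/funext => t; rewrite /path_cat; case: ifP.
by apply: (@convex_homotopic R T A R^o setT) => //; rewrite ?u0 ?u1 ?v0 ?v1.
Qed.

Definition path_rev p (t : I) : T := p (clamp (1 - ival t)).

Lemma path_rev_in A x y p : path_in A x y p -> path_in A y x (path_rev p).
Proof.
case=> cp Ap p0 p1; split=> //.
- apply: (continuous_comp2 _ cp); apply: clamp_comp_continuous; apply: Defs.sub_continuous.
    exact: cst_continuous.
  exact: ival_continuous.
- by move=> t; exact: Ap.
- by rewrite /path_rev ival0 subr0 clamp1.
- by rewrite /path_rev ival1 subrr clamp0.
Qed.

Lemma cst_path_in A x : A x -> path_in A x x (fun _ : I => x).
Proof. by move=> Ax; split=> [|t||] //; exact: cst_continuous. Qed.

Lemma path_extension A x y p : path_in A x y p ->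
  [/\ continuous (p \o clamp), forall t, A ((p \o clamp) t) &
      p = subpath (p \o clamp) 0 1].
Proof.
case=> cp Ap p0 p1; split.
- exact: (continuous_comp2 (@clamp_continuous _) cp).
- by move=> t; exact: Ap.
- by apply/funext => t; rewrite /subpath /= subr0 mul1r addr0 clampK.
Qed.

Lemma path_cat_cst_l A x y p : path_in A x y p ->
  path_homotopic A (path_cat (fun _ : I => x) p) p.
Proof.
move=> pA; have [cp Ap pE] := path_extension pA; case: pA => _ _ p0 _.
have -> : (fun=> x) = subpath (p \o clamp) 0 0 :> (I -> T).
  by apply/funext => t; rewrite /subpath /= subrr mul0r add0r clamp0.
by rewrite [X in path_cat _ X]pE [X in path_homotopic _ _ X]pE; exact: subpath_cat.
Qed.

Lemma path_cat_rev A x y p : path_in A x y p ->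
  path_homotopic A (path_cat p (path_rev p)) (fun _ : I => x).
Proof.
move=> pA; have [cp Ap pE] := path_extension pA; case: pA => _ _ p0 _.
have -> : (fun=> x) = subpath (p \o clamp) 0 0 :> (I -> T).
  by apply/funext => t; rewrite /subpath /= subrr mul0r add0r clamp0.
have -> : path_rev p = subpath (p \o clamp) 1 0.
  by apply/funext => t; rewrite /subpath /= sub0r mulN1r addrC.
by rewrite [X in path_cat X _]pE; exact: subpath_cat.
Qed.

Lemma path_cat_assoc A x y z w p q r :
  path_in A x y p -> path_in A y z q -> path_in A z w r ->
  path_homotopic A (path_cat (path_cat p q) r) (path_cat p (path_cat q r)).
Proof.
move=> pA qA rA.
(* The three paths are laid end to end over [0, 3]; both bracketings are then homotopic to
   [subpath f 0 3]. *)
pose f (v : R) := if v <= 1 then p (clamp v)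
                  else if v <= 2 then q (clamp (v - 1)) else r (clamp (v - 2)).
have [cp Ap p0 p1] := pA; have [cq Aq q0 q1] := qA; have [cr Ar r0 r1] := rA.
have csub (g : I -> T) (a : R) : continuous g -> continuous (fun v => g (clamp (v - a))).
  move=> cg; apply: (continuous_comp2 _ cg); apply: clamp_comp_continuous.
  by apply: Defs.sub_continuous => v; [exact: cvg_id|exact: cvg_cst].
have cf : continuous f.
  apply: (@pasting R R^o T id) => //.
  - by move=> v; exact: cvg_id.
  - exact: (continuous_comp2 (@clamp_continuous _) cp).
  - apply: (@pasting R R^o T id) => //.
    + by move=> v; exact: cvg_id.
    + exact: csub.
    + exact: csub.
    + move=> v /= ->; rewrite subrr clamp0 r0 -q1 clamp_ge1 //; lra.
  - by move=> v ->; rewrite ifT ?ler1n // subrr clamp0 clamp1 p1 q0.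
have Af t : A (f t) by rewrite /f; do 2?case: ifP.
have pE : p = subpath f 0 1.
  apply/funext => t; rewrite /subpath subr0 mul1r addr0 /f ival_le1.
  by rewrite clampK.
have qE : q = subpath f 1 2.
  apply/funext => t; have t0 := ival_ge0 t; have t1 := ival_le1 t; rewrite /subpath /f.
  case: ifPn => h1.
    have -> : t = zero by apply: ival_inj; rewrite ival0; lra.
    by rewrite ival0 mulr0 add0r clamp1 p1 q0.
  rewrite ifT; last by lra.
  by rewrite -{1}[t]clampK; congr (q (clamp _)); lra.
have rE : r = subpath f 2 3.
  apply/funext => t; have t0 := ival_ge0 t; have t1 := ival_le1 t; rewrite /subpath /f.
  rewrite ifF; last by apply/negbTE; rewrite -ltNge; lra.
  case: ifPn => h1.
    have -> : t = zero by apply: ival_inj; rewrite ival0; lra.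
    by rewrite ival0 r0 -q1; congr q; rewrite clamp_ge1 //; lra.
  by rewrite -{1}[t]clampK; congr (r (clamp _)); lra.
have sub a b := @subpath_in R T A f a b cf Af.
have e (a b : R) : subpath f a b one = f b by case: (sub a b).
have e0 (a b : R) : subpath f a b zero = f a by case: (sub a b).
rewrite pE qE rE.
apply: (@path_homotopic_trans _ _ _ _ (subpath f 0 3)).
- apply: path_homotopic_trans (subpath_cat 0 2 3 cf Af).
  apply: path_cat_homotopic; last exact: path_homotopic_refl (sub _ _).
    by have [_ _ _ ->] := path_cat_in (sub 0 1) (sub 1 2); rewrite e0.
  exact: subpath_cat.
- apply: path_homotopic_sym; apply: path_homotopic_trans (subpath_cat 0 1 3 cf Af).
  apply: path_cat_homotopic; first 2 last; first exact: subpath_cat.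
    by have [_ _ -> _] := path_cat_in (sub 1 2) (sub 2 3); rewrite e.
  exact: path_homotopic_refl (sub _ _).
Qed.

(** The two ways round the boundary of the square are homotopic by convexity. This turns a homotopy
    with moving ends into an equation between path classes. *)
Lemma square_homotopic A (H : I * I -> T) : continuous H -> (forall z, A (H z)) ->
  path_homotopic A (path_cat (fun t => H (t, zero)) (fun s => H (one, s)))
                   (path_cat (fun s => H (zero, s)) (fun t => H (t, one))).
Proof.
move=> cH AH.
pose f (z : R^o * R^o) := H (clamp z.1, clamp z.2).
have cf : continuous f.
  apply: (@continuous_comp2 _ _ _ _ H) => //; apply: continuous_pair.
    exact: (continuous_comp2 (@fst_continuous _ _) (@clamp_continuous _)).
  exact: (continuous_comp2 (@snd_continuous _ _) (@clamp_continuous _)).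
pose h (c : R) (t : I) : R^o * R^o := (ival t, c).
pose v (c : R) (t : I) : R^o * R^o := (c, ival t).
have hP (c : R) : path_in setT ((0, c) : R^o * R^o) ((1, c) : R^o * R^o) (h c).
  split=> //; rewrite /h ?ival0 ?ival1 //.
  by apply: continuous_pair; [exact: ival_continuous|exact: cst_continuous].
have vP (c : R) : path_in setT ((c, 0) : R^o * R^o) ((c, 1) : R^o * R^o) (v c).
  split=> //; rewrite /v ?ival0 ?ival1 //.
  by apply: continuous_pair; [exact: cst_continuous|exact: ival_continuous].
have [c1 _ a0 a1] := path_cat_in (hP 0) (vP 1).
have [c2 _ b0 b1] := path_cat_in (vP 0) (hP 1).
have -> : path_cat (fun t => H (t, zero)) (fun s => H (one, s)) =
          fun t => f (path_cat (h 0) (v 1) t).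
  by apply/funext => t; rewrite /path_cat; case: ifP => _;
     rewrite /f /= clampK ?clamp0 ?clamp1.
have -> : path_cat (fun s => H (zero, s)) (fun t => H (t, one)) =
          fun t => f (path_cat (v 0) (h 1) t).
  by apply/funext => t; rewrite /path_cat; case: ifP => _;
     rewrite /f /= clampK ?clamp0 ?clamp1.
apply: (@convex_homotopic _ _ _ _ setT) => //; rewrite ?a0 ?a1 ?b0 ?b1 //.
by move=> c _; exact: AH.
Qed.

End Groupoid.

(** * Loops in a subset and their classes in the fundamental group *)

Section LoopClass.
Context {R : realType} {T : topologicalType} (A : set T) (x0 : A).
Local Notation I := (unit_interval R).
Local Notation b := (set_val x0).
Implicit Types (p q r : I -> T).
Local Open Scope group_scope.

Lemma lift_continuous (X : topologicalType) (f : X -> T) (fA : forall z, f z \in A) :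
  continuous f -> continuous (fun z => exist (fun y => y \in A) (f z) (fA z) : set_type A).
Proof. by move=> cf; apply: continuous_comp_initial. Qed.

Section Lift.
Variables (p : I -> T) (pA : path_in A b b p).

Lemma loop_lift_mem t : p t \in A.
Proof. by case: pA => _ Ap _ _; apply/mem_set. Qed.

Definition loop_lift_fun (t : I) : set_type A := exist _ (p t) (loop_lift_mem t).

Lemma loop_lift_continuous : continuous loop_lift_fun.
Proof. by apply: lift_continuous; case: pA. Qed.

Lemma loop_lift0 : loop_lift_fun zero = x0.
Proof. by apply: val_inj; case: pA. Qed.

Lemma loop_lift1 : loop_lift_fun one = x0.
Proof. by apply: val_inj; case: pA. Qed.

Definition loop_lift : {path I from x0 to x0 in set_type A} :=
  mk_path loop_lift_continuous loop_lift0 loop_lift1.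

End Lift.

Lemma homotopic_lift (f g : {path I from x0 to x0 in set_type A}) :
  homotopic f g <-> path_homotopic A (fun t => set_val (f t)) (fun t => set_val (g t)).
Proof.
split.
  case=> H [cH Hfg He]; exists (fun z => set_val (H z)); split.
  - exact: (continuous_comp2 cH (@initial_continuous _ _ _)).
  - by move=> z; exact: set_valP.
  - by move=> t; have [-> ->] := Hfg t.
  - by move=> s; have [-> ->] := He s; rewrite path_zero path_one.
case=> H [cH AH Hfg He].
have HA z : H z \in A by apply/mem_set.
exists (fun z => exist _ (H z) (HA z)); split.
- exact: lift_continuous.
- by move=> t; split; apply: val_inj; have [] := Hfg t.
- by move=> s; split; apply: val_inj; have [] := He s; rewrite path_zero path_one.
Qed.

(** The default 1 makes this a total function on maps, so that equations between classes can be
    rewritten without carrying membership proofs. *)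
Definition loop_class p : pi1 R x0 :=
  if pselect (path_in A b b p) is left pA then \pi_(pi1 R x0) (loop_lift pA) else 1.

Lemma loop_classE p (pA : path_in A b b p) :
  loop_class p = \pi_(pi1 R x0) (loop_lift pA).
Proof.
rewrite /loop_class; case: pselect => // pA'; congr (\pi_ _ (loop_lift _)).
exact: Prop_irrelevance.
Qed.

Lemma loop_class_eqP p q : path_in A b b p -> path_in A b b q ->
  loop_class p = loop_class q <-> path_homotopic A p q.
Proof.
move=> pA qA; rewrite (loop_classE pA) (loop_classE qA) pi1_eqP.
exact: homotopic_lift.
Qed.

Lemma loop_class_surj (g : pi1 R x0) :
  exists2 p, path_in A b b p & loop_class p = g.
Proof.
pose f := repr g.
have fA : path_in A b b (fun t => set_val (f t)).
  split; first exact: (continuous_comp2 (@cts_fun _ _ f) (@initial_continuous _ _ _)).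
  - by move=> t; exact: set_valP.
  - by rewrite path_zero.
  - by rewrite path_one.
exists (fun t => set_val (f t)) => //.
rewrite (loop_classE fA) -[RHS]reprK; apply/pi1_eqP/homotopic_lift.
exact: path_homotopic_refl fA.
Qed.

Lemma loop_class_cat p q : path_in A b b p -> path_in A b b q ->
  loop_class (path_cat p q) = loop_class p * loop_class q.
Proof.
move=> pA qA; have pqA := path_cat_in pA qA.
rewrite (loop_classE pA) (loop_classE qA) (loop_classE pqA).
apply/pi1_eqP; apply: homotopic_trans (cat_homotopic
  (homotopic_sym (repr_pi1 _)) (homotopic_sym (repr_pi1 _))).
apply/homotopic_lift.
have -> : (fun t => set_val (cat_loop (loop_lift pA) (loop_lift qA) t)) = path_cat p q.
  by apply/funext => t; rewrite /= /mk_path /= /cat_fun /path_cat; case: ifP.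
exact: path_homotopic_refl pqA.
Qed.

Lemma loop_class_cst : loop_class (fun=> b) = 1.
Proof.
have bA : path_in A b b (fun _ : I => b) by apply: cst_path_in; exact: set_valP.
rewrite (loop_classE bA); apply/pi1_eqP/homotopic_lift.
exact: path_homotopic_refl bA.
Qed.

End LoopClass.

(** * Classes of paths with arbitrary ends *)

Section PathClass.
Context {R : realType} {T : topologicalType}.
Local Notation I := (unit_interval R).
Implicit Types (A : set T) (p q r : I -> T) (f : R -> T).

Lemma path_revK : involutive (@path_rev R T).
Proof.
move=> p; apply/funext => t; rewrite /path_rev ival_clamp; last first.
  by have := ival_ge0 t; have := ival_le1 t; lra.
by rewrite -{2}[t]clampK; congr (p (clamp _)); lra.
Qed.

Lemma path_rev_cat A x y p : path_in A x y p ->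
  path_homotopic A (path_cat (path_rev p) p) (fun _ : I => y).
Proof. by move=> /path_rev_in/path_cat_rev; rewrite path_revK. Qed.

Lemma path_cat_cst_r A x y p : path_in A x y p ->
  path_homotopic A (path_cat p (fun _ : I => y)) p.
Proof.
move=> pA; have [cp Ap pE] := path_extension pA; case: pA => _ _ _ p1.
have -> : (fun=> y) = subpath (p \o clamp) 1 1 :> (I -> T).
  by apply/funext => t; rewrite /subpath /= subrr mul0r add0r clamp1.
by rewrite [X in path_cat X _]pE [X in path_homotopic _ _ X]pE; exact: subpath_cat.
Qed.

Definition path_connected A : Prop :=
  forall x y, A x -> A y -> exists p, path_in A x y p.

Variables (A : set T) (x0 : A).
Local Notation b := (set_val x0).
Local Open Scope group_scope.

(** The tether of the base point is required to be constant, so that [path_class] agrees with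
    [loop_class] on loops, with no conjugation. *)
Lemma tether_subproof y : exists p,
  ((exists q, path_in A b y q) -> path_in A b y p) /\ (y = b -> p = fun=> b).
Proof.
have [->|yb] := pselect (y = b).
  by exists (fun=> b); split=> // _; apply: cst_path_in; exact: set_valP.
by have [[q qA]|no] := pselect (exists q, path_in A b y q);
  [exists q|exists (fun=> b)].
Qed.

Definition tether y : I -> T := sval (cid (tether_subproof y)).

(* A functor from the fundamental groupoid of A to its fundamental group. *)
Definition path_class p : pi1 R x0 :=
  loop_class x0
    (path_cat (tether (p zero)) (path_cat p (path_rev (tether (p one))))).

Lemma path_class_loop p : path_in A b b p -> path_class p = loop_class x0 p.
Proof.
move=> pA; have [cp Ap p0 p1] := pA; rewrite /path_class p0 p1.
rewrite /tether; case: cid => /= q [_ -> //].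
have bA : path_in A b b (fun _ : I => b) by apply: cst_path_in; exact: set_valP.
have rA := path_rev_in bA.
apply/loop_class_eqP => //; first exact: path_cat_in bA (path_cat_in pA rA).
apply: path_homotopic_trans (path_cat_cst_l (path_cat_in pA rA)) _.
exact: path_cat_cst_r.
Qed.

Lemma path_class_surj (g : pi1 R x0) :
  exists2 p, path_in A b b p & path_class p = g.
Proof.
by have [p pA pg] := loop_class_surj g; exists p; rewrite ?path_class_loop.
Qed.

Lemma path_class_inj p q : path_in A b b p -> path_in A b b q ->
  path_class p = path_class q -> path_homotopic A p q.
Proof. by move=> pA qA; rewrite !path_class_loop // loop_class_eqP. Qed.

Lemma path_class_base : path_class (fun=> b) = 1.
Proof.
rewrite path_class_loop ?loop_class_cst //.
by apply: cst_path_in; exact: set_valP.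
Qed.

Hypothesis Acon : path_connected A.

Lemma tether_in y : A y -> path_in A b y (tether y).
Proof.
move=> Ay; rewrite /tether; case: cid => /= q [qA _]; apply: qA.
exact: Acon (set_valP _) Ay.
Qed.

Lemma path_class_homotopic x y p q : path_in A x y p -> path_in A x y q ->
  path_homotopic A p q -> path_class p = path_class q.
Proof.
move=> pA qA pq; rewrite /path_class.
have [cp Ap p0 p1] := pA; have [cq Aq q0 q1] := qA.
have tx : path_in A b x (tether x) by apply: tether_in; rewrite -p0.
have ty : path_in A b y (tether y) by apply: tether_in; rewrite -p1.
have tr := path_rev_in ty; have [_ _ tr0 tr1] := tr; have [_ _ tx0 tx1] := tx.
rewrite p0 p1 q0 q1; apply/loop_class_eqP; [exact: path_cat_in tx (path_cat_in pA tr)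
  |exact: path_cat_in tx (path_cat_in qA tr)|].
have [_ _ e0 _] := path_cat_in pA tr.
apply: path_cat_homotopic; rewrite ?tx1 ?e0 //; first exact: path_homotopic_refl tx.
by apply: path_cat_homotopic; rewrite ?p1 ?tr0 //; exact: path_homotopic_refl tr.
Qed.

Lemma path_cat_homotopic_l x y z p q r :
  path_in A x y p -> path_in A x y q -> path_in A y z r ->
  path_homotopic A p q -> path_homotopic A (path_cat p r) (path_cat q r).
Proof.
move=> [_ _ p0 p1] qA rA pq; have [_ _ r0 _] := rA.
by apply: path_cat_homotopic; rewrite ?p1 ?r0 //; exact: path_homotopic_refl rA.
Qed.

Lemma path_cat_homotopic_r x y z p q r :
  path_in A x y r -> path_in A y z p -> path_in A y z q ->
  path_homotopic A p q -> path_homotopic A (path_cat r p) (path_cat r q).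
Proof.
move=> rA [_ _ p0 p1] qA pq; have [_ _ r0 r1] := rA.
by apply: path_cat_homotopic; rewrite ?p0 ?r1 //; exact: path_homotopic_refl rA.
Qed.

Lemma path_class_cat x y z p q : path_in A x y p -> path_in A y z q ->
  path_class (path_cat p q) = path_class p * path_class q.
Proof.
move=> pA qA; have [cp Ap p0 p1] := pA; have [cq Aq q0 q1] := qA.
have [_ _ pq0 pq1] := path_cat_in pA qA.
have tx : path_in A b x (tether x) by apply: tether_in; rewrite -p0.
have ty : path_in A b y (tether y) by apply: tether_in; rewrite -p1.
have tz : path_in A b z (tether z) by apply: tether_in; rewrite -q1.
have tyr := path_rev_in ty; have tzr := path_rev_in tz.
have pt := path_cat_in pA tyr; have qt := path_cat_in qA tzr.
rewrite /path_class pq0 pq1 p0 p1 q0 q1 -loop_class_cat;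
  [|exact: path_cat_in tx pt|exact: path_cat_in ty qt].
apply/loop_class_eqP.
- exact: path_cat_in tx (path_cat_in (path_cat_in pA qA) tzr).
- by apply: path_cat_in; [exact: path_cat_in tx pt|exact: path_cat_in ty qt].
apply: path_homotopic_trans (path_homotopic_sym (path_cat_assoc tx pt (path_cat_in ty qt))).
apply: (path_cat_homotopic_r tx).
- exact: path_cat_in (path_cat_in pA qA) tzr.
- exact: path_cat_in pt (path_cat_in ty qt).
apply: path_homotopic_trans (path_cat_assoc pA qA tzr) _.
apply: path_homotopic_trans (path_homotopic_sym (path_cat_assoc pA tyr (path_cat_in ty qt))).
apply: (path_cat_homotopic_r pA qt); first exact: path_cat_in tyr (path_cat_in ty qt).
apply: path_homotopic_trans (path_cat_assoc tyr ty qt).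
apply: path_homotopic_trans (path_homotopic_sym (path_cat_cst_l qt)) _.
apply: (path_cat_homotopic_l _ (path_cat_in tyr ty) qt).
  by apply: cst_path_in; rewrite -p1.
exact: path_homotopic_sym (path_rev_cat ty).
Qed.

Lemma path_class_cst x : A x -> path_class (fun=> x) = 1.
Proof.
move=> Ax; have xA : path_in A x x (fun _ : I => x) by exact: cst_path_in.
apply: (mulgI (path_class (fun=> x))).
rewrite -(path_class_cat xA xA) mulg1; apply: (path_class_homotopic (path_cat_in xA xA) xA).
exact: path_cat_cst_l xA.
Qed.

Lemma path_class_rev x y p : path_in A x y p ->
  path_class (path_rev p) = (path_class p)^-1.
Proof.
move=> pA; have rA := path_rev_in pA; have [_ Ap p0 _] := pA.
apply: (mulgI (path_class p)); rewrite mulgV -(path_class_cat pA rA).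
have Ax : A x by rewrite -p0.
rewrite -(path_class_cst Ax).
apply: (path_class_homotopic (path_cat_in pA rA) (cst_path_in Ax)).
exact: path_cat_rev pA.
Qed.

Lemma path_class_subpath f (a c d : R) : continuous f -> (forall t, A (f t)) ->
  path_class (subpath f a c) * path_class (subpath f c d) = path_class (subpath f a d).
Proof.
move=> cf Af; have s u v := @subpath_in R T A f u v cf Af.
rewrite -(path_class_cat (s _ _) (s _ _)).
exact: path_class_homotopic (path_cat_in (s _ _) (s _ _)) (s _ _) (subpath_cat _ _ _ cf Af).
Qed.

Lemma path_class_square (H : I * I -> T) : continuous H -> (forall z, A (H z)) ->
  path_class (fun t => H (t, zero)) * path_class (fun s => H (one, s)) =
  path_class (fun s => H (zero, s)) * path_class (fun t => H (t, one)).
Proof.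
move=> cH AH.
have h (c : I) : path_in A (H (zero, c)) (H (one, c)) (fun t => H (t, c)).
  split=> //; apply: (@continuous_comp2 _ _ _ _ H) => //.
  by apply: continuous_pair => [t|]; [exact: cvg_id|exact: cst_continuous].
have v (c : I) : path_in A (H (c, zero)) (H (c, one)) (fun t => H (c, t)).
  split=> //; apply: (@continuous_comp2 _ _ _ _ H) => //.
  by apply: continuous_pair => [|t]; [exact: cst_continuous|exact: cvg_id].
rewrite -(path_class_cat (h _) (v _)) -(path_class_cat (v _) (h _)).
apply: (path_class_homotopic (path_cat_in (h _) (v _)) (path_cat_in (v _) (h _))).
exact: square_homotopic.
Qed.

Lemma path_class_convex (V : normedModType R) (C : set V) (f : V -> T) (u v : I -> V) :
  convex_set C -> continuous f -> (forall c, C c -> A (f c)) ->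
  continuous u -> continuous v -> (forall t, C (u t)) -> (forall t, C (v t)) ->
  u zero = v zero -> u one = v one ->
  path_class (fun t => f (u t)) = path_class (fun t => f (v t)).
Proof.
move=> cC cf Cf cu cv Cu Cv uv0 uv1.
have uA : path_in A (f (u zero)) (f (u one)) (fun t => f (u t)).
  by split=> // [|t]; [exact: (continuous_comp2 cu cf)|exact: Cf].
have vA : path_in A (f (u zero)) (f (u one)) (fun t => f (v t)).
  by split=> [|t||]; [exact: (continuous_comp2 cv cf)|exact: Cf|rewrite uv0|rewrite uv1].
by apply: (path_class_homotopic uA vA); exact: (convex_homotopic cC).
Qed.

End PathClass.

(** * Uniform estimates by compactness *)

Section Compactness.
Context {R : realType}.
Local Notation I := (unit_interval R).

Lemma unit_interval_compact : compact [set: I].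
Proof.
have -> : [set: I] = clamp @` `[0, 1].
  apply/seteqP; split=> // t _; exists (ival t); last exact: clampK.
  by rewrite /= in_itv /= ival_ge0 ival_le1.
apply: continuous_compact; last exact: segment_compact.
exact: continuous_subspaceT (@clamp_continuous R).
Qed.

(** Compactness is used as a near-covering property for the filter of right neighbourhoods of 0, so
    no finite subcover and no least radius has to be chosen. *)
Lemma compact_uniform (Z : topologicalType) (K : set Z) (P : R -> Z -> Prop) :
  compact K ->
  (forall z, K z -> exists U : set Z, exists2 e, 0 < e &
     nbhs z U /\ forall e' z', 0 < e' < e -> U z' -> P e' z') ->
  exists2 e, 0 < e & forall z, K z -> P e z.
Proof.
move=> cK h.
have /compact_near_coveringP cov := cK.
have nK : \forall e \near 0^'+, K `<=` P e.
  apply: cov => z Kz; have [U [e e0 [zU UP]]] := h z Kz.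
  exists (U, [set e' | 0 < e' < e]); first split=> //=.
    near=> e'; apply/andP; split; near: e'; [exact: nbhs_right_gt|exact: nbhs_right_lt].
  by move=> [z' e'] /= [Uz' e'e]; exact: UP.
near (0 : R)^'+ => e; exists e => //; last by move=> z Kz; exact: (near nK e).
Unshelve. all: by end_near. Qed.

Lemma nbhs_lt (Z : topologicalType) (f g : Z -> R) z :
  continuous f -> continuous g -> f z < g z -> nbhs z [set y | f y < g y].
Proof.
move=> cf cg fg.
have o : open [set y | 0 < g y - f y].
  apply: (@open_comp _ _ (fun y => g y - f y) [set r | 0 < r]) => [y _|].
    exact: (Defs.sub_continuous cg cf).
  exact: open_gt.
have -> : [set y | f y < g y] = [set y | 0 < g y - f y].
  by apply/seteqP; split=> y /=; rewrite subr_gt0.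
by apply: open_nbhs_nbhs; split=> //=; rewrite subr_gt0.
Qed.

(** Near a point where [d] is positive the premise [d z <= e] fails for small [e]; near any other
    point the bound on [f] persists by continuity. *)
Lemma compact_lt_uniform (Z : topologicalType) (f d : Z -> R) (c : R) :
  compact [set: Z] -> continuous f -> continuous d ->
  (forall z, d z <= 0 -> f z < c) ->
  exists2 e, 0 < e & forall z, d z <= e -> f z < c.
Proof.
move=> cZ cf cd h.
have [|e e0 he] := compact_uniform (P := fun e z => d z <= e -> f z < c) cZ.
  move=> z _; have [dz|dz] := leP (d z) 0.
    exists [set y | f y < c], 1 => //; split=> //.
    by apply: nbhs_lt => //; [exact: cst_continuous|exact: h].
  exists [set y | d z / 2 < d y], (d z / 2); first by rewrite divr_gt0.
  split; first by apply: nbhs_lt => //; [exact: cst_continuous|lra].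
  by move=> e y /andP[_ e1] /= y1 y2; lra.
by exists e => // z; exact: he.
Qed.

Lemma compact_pos_uniform (Z : topologicalType) (K : set Z) (f : Z -> R) :
  compact K -> continuous f -> (forall z, K z -> 0 < f z) ->
  exists2 e, 0 < e & forall z, K z -> e <= f z.
Proof.
move=> cK cf h; apply: compact_uniform => // z Kz.
exists [set y | f z / 2 < f y], (f z / 2); first by have := h _ Kz; lra.
have := h _ Kz => fz; split; first by apply: nbhs_lt => //; [exact: cst_continuous|lra].
by move=> e y /andP[_ e1] /= y1; lra.
Qed.

(** Both times become coordinates of the compact space [(X * I) * I]. Where they agree the
    difference of values vanishes, and [compact_lt_uniform] extends the bound to times that are
    close. *)
Lemma uniform_modulus (X : topologicalType) (W : normedModType R)
    (f : X * I -> W) (c : R) :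
  compact [set: X] -> continuous f -> 0 < c ->
  exists2 e, 0 < e & forall x s t, `|ival s - ival t| <= e ->
    `|f (x, s) - f (x, t)| < c.
Proof.
move=> cX cf c0.
have cZ : compact [set: (X * I) * I].
  rewrite -setXTT; apply: compact_setX; last exact: unit_interval_compact.
  by rewrite -setXTT; apply: compact_setX => //; exact: unit_interval_compact.
have n_cont (Z : topologicalType) (V : normedModType R) (g : Z -> V) :
    continuous g -> continuous (fun z => `|g z|).
  by move=> cg z; apply: cvg_norm; exact: cg.
pose g (z : (X * I) * I) := `|f z.1 - f (z.1.1, z.2)|.
pose d (z : (X * I) * I) := `|ival z.1.2 - ival z.2|.
have c1 := @fst_continuous (X * I)%type I; have c2 := @snd_continuous (X * I)%type I.
have cg : continuous g.
  apply: (n_cont _ W) => z; apply: cvgB; first exact: (continuous_comp2 c1 cf).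
  move: z; apply: (@continuous_comp2 _ _ _ _ f) => //; apply: continuous_pair => //.
  exact: (continuous_comp2 c1 (@fst_continuous _ _)).
have cd : continuous d.
  apply: (n_cont _ R^o); apply: Defs.sub_continuous; apply: ival_comp_continuous => //.
  exact: (continuous_comp2 c1 (@snd_continuous _ _)).
have [|e e0 he] := compact_lt_uniform (c := c) cZ cg cd.
  move=> [[x s] t]; rewrite /d /g /= normr_le0 subr_eq0 => /eqP/ival_inj ->.
  by rewrite subrr normr0.
by exists e => // x s t st; exact: (he ((x, s), t)).
Qed.

End Compactness.

(** * Lifting homotopies along moving points *)

Section HomotopyLifting.
Context {R : realType} {B : topologicalType} {W : normedModType R} {J : finType}.
Variable r : J -> B -> W.
Local Notation I := (unit_interval R).

Definition tent (x : R) : R := Num.max 0 (1 - x).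

(* Moves w along with the strands r j, from their position over m to their
   position over d; fixes everything at distance at least delta from them. *)
Definition transport (delta : R) (m : B) (w : W) (d : B) : W :=
  w + \sum_j tent (`|w - r j m| / delta) *: (r j d - r j m).

Lemma transport_same delta m w : transport delta m w m = w.
Proof. by rewrite /transport big1 ?addr0 // => j _; rewrite subrr scaler0. Qed.

Lemma tent_ge1 x : 1 <= x -> tent x = 0.
Proof. by move=> x1; rewrite /tent max_l // subr_le0. Qed.

Lemma tent_le1 x : x <= 1 -> tent x = 1 - x.
Proof. by move=> x1; rewrite /tent max_r // subr_ge0. Qed.

(** The separation [4 * delta] lets at most one strand [k] act on [w]. If [w] is at distance
    [a * delta] from it, with [a < 1], then [w] moves by [1 - a] times the displacement [v] of that
    strand, and [|v| < delta]. Landing on strand [k] forces [a * delta = a * |v|], hence [a = 0];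
    landing on another strand [l] would put the two strands at distance less than [3 * delta]. *)
Lemma transport_strand (delta : R) m w d l : 0 < delta ->
  (forall i j, i != j -> 4 * delta <= `|r i m - r j m|) ->
  (forall j, `|r j d - r j m| < delta) ->
  transport delta m w d = r l d <-> w = r l m.
Proof.
move=> d0 sep close.
have far j : j != l -> `|w - r l m| < 2 * delta -> delta <= `|w - r j m|.
  move=> jl wl; have := sep _ _ jl.
  have : `|r j m - r l m| <= `|w - r j m| + `|w - r l m|.
    by rewrite distrC; rewrite (le_trans (ler_distD w _ _)) // addrC (distrC (r l m) w).
  lra.
have far0 j : delta <= `|w - r j m| -> tent (`|w - r j m| / delta) *: (r j d - r j m) = 0.
  by move=> wj; rewrite tent_ge1 ?scale0r // ler_pdivlMr // mul1r.
split=> [|wl]; last first.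
  rewrite /transport (bigD1 l) //= big1 => [|j jl]; last first.
    by apply: far0; apply: far => //; rewrite wl subrr normr0; lra.
  by rewrite wl subrr normr0 mul0r tent_le1 // subr0 scale1r addr0 addrC subrK.
rewrite /transport => wE.
have [[k kw]|no] := pselect (exists k, `|w - r k m| < delta); last first.
  have s0 : \sum_j tent (`|w - r j m| / delta) *: (r j d - r j m) = 0.
    apply: big1 => j _; apply: far0; rewrite leNgt; apply/negP => h.
    by apply: no; exists j.
  by move: wE; rewrite s0 addr0 => wE; case: no; exists l; rewrite wE.
have others j : j != k -> tent (`|w - r j m| / delta) *: (r j d - r j m) = 0.
  move=> jk; apply: far0; have := sep _ _ jk.
  have : `|r j m - r k m| <= `|w - r j m| + `|w - r k m|.
    by rewrite distrC; rewrite (le_trans (ler_distD w _ _)) // addrC (distrC (r k m) w).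
  lra.
move: wE; rewrite (bigD1 k) //= big1 => [|j jk]; last exact: others.
rewrite addr0 tent_le1; last by rewrite ler_pdivrMr // mul1r ltW.
set a := _ / _; set v := r k d - r k m => wE.
have a0 : 0 <= a by rewrite divr_ge0 // ltW.
have a1 : a < 1 by rewrite ltr_pdivrMr // mul1r.
have wv : w = r l d - (1 - a) *: v by rewrite -wE addrK.
have [kl|kl] := eqVneq k l.
  have /(congr1 Num.norm) : w - r k m = a *: v.
    rewrite {1}wv -kl addrAC -/v -{1}[v]scale1r -scalerBl; congr (_ *: _); lra.
  rewrite normrZ ger0_norm // /a => nE; apply/eqP; rewrite -subr_eq0 -normr_eq0 -kl.
  apply/eqP; have := close k; rewrite -/v => vd; have n0 := normr_ge0 (w - r k m).
  apply/eqP; rewrite eq_le n0 andbT leNgt; apply/negP => n1.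
  suff : `|w - r k m| < `|w - r k m| by rewrite ltxx.
  rewrite {1}nE mulrAC ltr_pdivrMr // ltr_pM2l //.
have := sep l k; rewrite eq_sym => /(_ kl).
have dv : `|r l d - w| <= `|v|.
  rewrite {1}wv opprB addrC subrK normrZ ger0_norm; last by lra.
  by rewrite ler_piMl // lerBlDr; lra.
have := close l; have := close k; rewrite -/v => vd ld.
have := @ler_distD R W (r l d) (r l m) (r k m); have := @ler_distD R W w (r l d) (r k m).
rewrite (distrC (r l m) (r l d)) => *; clear wE wv; exfalso; lra.
Qed.

Lemma transport_continuous (X : topologicalType) (delta : R) (m d : X -> B) (w : X -> W) :
  (forall j, continuous (r j)) -> continuous m -> continuous w -> continuous d ->
  continuous (fun x => transport delta (m x) (w x) (d x)).
Proof.
move=> cr cm cw cd.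
have crm j : continuous (fun x => r j (m x)) by exact: continuous_comp2 cm (cr j).
have crd j : continuous (fun x => r j (d x)) by exact: continuous_comp2 cd (cr j).
move=> x; apply: cvgD; first exact: cw.
apply: cvg_big => [|j _]; first exact: add_continuous.
apply: cvgZ; last by apply: cvgB; [exact: crd|exact: crm].
have ct : continuous (fun x => tent (`|w x - r j (m x)| / delta)).
  apply: max_fun_continuous; first exact: cst_continuous.
  apply: Defs.sub_continuous; first exact: cst_continuous.
  apply: Defs.mul_continuous; last exact: cst_continuous.
  by move=> y; apply: cvg_norm; apply: cvgB; [exact: cw|exact: crm].
exact: ct.
Qed.

Lemma fin_uniform (K : finType) (P : K -> R -> Prop) :
  (forall k, exists2 e, 0 < e & P k e) ->
  (forall k e e', 0 < e' <= e -> P k e -> P k e') ->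
  exists2 e, 0 < e & forall k, P k e.
Proof.
move=> ex mono.
suff [e e0 he] : exists2 e, 0 < e & forall k, k \in enum K -> P k e.
  by exists e => // k; apply: he; rewrite mem_enum.
elim: (enum K) => [|k s [e e0 he]]; first by exists 1.
have [e' e'0 he'] := ex k; exists (Num.min e e'); first by rewrite lt_min e0.
move=> i; rewrite inE => /orP[/eqP ->|si].
  by apply: mono he'; rewrite lt_min e0 e'0 ge_min lexx orbT.
by apply: mono (he _ si); rewrite lt_min e0 e'0 ge_min lexx.
Qed.

(* The lift keeps off (or on) each strand, and is stationary wherever the
   homotopy is; the strands need only be disjoint where it is not. *)
Lemma homotopy_lifting (X : topologicalType) (K : X * I -> B) (C : set X) (e0 : X -> W) :
  compact [set: X] -> closed C -> continuous K -> continuous e0 ->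
  (forall j, continuous (r j)) ->
  (forall x, ~ C x -> forall t, K (x, t) = K (x, zero)) ->
  (forall x t i j, C x -> i != j -> r i (K (x, t)) != r j (K (x, t))) ->
  exists e : X * I -> W,
    [/\ continuous e, forall x, e (x, zero) = e0 x,
        forall x t j, e (x, t) = r j (K (x, t)) <-> e0 x = r j (K (x, zero))
      & forall x, (forall t, K (x, t) = K (x, zero)) -> forall t, e (x, t) = e0 x].
Proof.
move=> cX clC cK ce0 cr stat disj.
have cZ : compact (C `*` [set: I]).
  apply: compact_setX; last exact: unit_interval_compact.
  exact: subclosed_compact cX _.
have crK j : continuous (fun z => r j (K z)) by exact: continuous_comp2 cK (cr j).
have [delta' d'0 sep'] : exists2 e, 0 < e & forall ij : J * J,
    ij.1 != ij.2 -> forall z, C z.1 -> e <= `|r ij.1 (K z) - r ij.2 (K z)|.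
  apply: fin_uniform => [[i j]|ij e e' /andP[_ ee'] h ne z Cz]; last first.
    exact: le_trans ee' (h ne z Cz).
  have [ij|ij] := eqVneq i j; first by exists 1 => //=; rewrite ij eqxx.
  have [||e e1 he] := @compact_pos_uniform _ _ (C `*` [set: I])
      (fun z => `|r i (K z) - r j (K z)|) cZ.
  - by move=> z; apply: cvg_norm; apply: cvgB; exact: crK.
  - by move=> [x t] [/= Cx _]; rewrite normr_gt0 subr_eq0; exact: disj.
  by exists e => // _ z Cz; exact: he.
(* A quarter of the least distance between two strands over the moving part, to match the 4 in
   [transport_strand]. *)
pose delta := delta' / 4.
have d0 : 0 < delta by rewrite divr_gt0.
have sep x t i j : C x -> i != j -> 4 * delta <= `|r i (K (x, t)) - r j (K (x, t))|.
  move=> Cx ij; have := sep' (i, j) ij (x, t) Cx; rewrite /= /delta; lra.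
have [eta eta0 close] : exists2 e, 0 < e & forall j, forall x s t,
    `|ival s - ival t| <= e -> `|r j (K (x, s)) - r j (K (x, t))| < delta.
  apply: fin_uniform => [j|j e e' /andP[_ ee'] h x s t st]; last first.
    by apply: h; exact: le_trans st ee'.
  by have [e e1 he] := uniform_modulus cX (crK j) d0; exists e.
have [n n0 neta] : exists2 n, (0 < n)%N & n%:R^-1 <= eta :> R.
  exists (Num.trunc eta^-1).+1 => //; rewrite invf_ple ?posrE //.
  by apply: ltW; exact: truncnS_gt.
have nR : 0 < n%:R :> R by rewrite ltr0n.
(* Time stopped at [j / n]. Step [j] moves nothing before that moment, so each [F j] is defined and
   continuous on all of [X * I], with no pasting along time intervals. *)
pose c j (t : I) : I := clamp (Num.min (ival t) (j%:R / n%:R)).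
have cE j t : ival (c j t) = Num.min (ival t) (j%:R / n%:R).
  rewrite /c ival_clamp //; apply/andP; split.
    by rewrite le_min ival_ge0 divr_ge0.
  by rewrite ge_min ival_le1.
have cc j : continuous (c j).
  apply: clamp_comp_continuous; apply: min_fun_continuous; last exact: cst_continuous.
  exact: ival_continuous.
have c0 t : c 0%N t = zero.
  by apply: ival_inj; rewrite cE ival0 mul0r min_r ?ival_ge0.
have cn t : c n t = t.
  by apply: ival_inj; rewrite cE divff ?gt_eqF // min_l ?ival_le1.
have cz j : c j zero = zero.
  by apply: ival_inj; rewrite cE ival0 min_l // divr_ge0.
have cstep j t : `|ival (c j.+1 t) - ival (c j t)| <= eta.
  apply: le_trans neta; rewrite !cE -natr1 mulrDl mul1r.
  have : 0 < n%:R^-1 :> R by rewrite invr_gt0.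
  set u := ival t; set v := j%:R / _; set w := _^-1 => w0.
  have -> : Num.min u v = if u <= v then u else v by rewrite minEle.
  have -> : Num.min u (v + w) = if u <= v + w then u else v + w by rewrite minEle.
  by case: (leP u v) => uv; case: (leP u (v + w)) => uw; rewrite ger0_norm; lra.
pose F := fix F j (z : X * I) := if j is j'.+1 then
    transport delta (K (z.1, c j' z.2)) (F j' z) (K (z.1, c j z.2)) else e0 z.1.
have FS j z : F j.+1 z = transport delta (K (z.1, c j z.2)) (F j z) (K (z.1, c j.+1 z.2)).
  by [].
have cKc j : continuous (fun z : X * I => K (z.1, c j z.2)).
  apply: (@continuous_comp2 _ _ _ _ K) => //; apply: continuous_pair.
    exact: fst_continuous.
  exact: continuous_comp2 (@snd_continuous _ _) (cc j).
have cF j : continuous (F j).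
  elim: j => [|j IH]; first exact: continuous_comp2 (@fst_continuous _ _) ce0.
  exact: transport_continuous.
have Fstat j x t : (forall t, K (x, t) = K (x, zero)) -> F j (x, t) = e0 x.
  by move=> st; elim: j => // j IH; rewrite FS IH /= !st transport_same.
exists (F n); split=> //.
- by move=> x; elim: (n) => // j IH; rewrite FS IH /= !cz transport_same.
- move=> x t l; rewrite -{2}[t]cn; have [Cx|nCx] := pselect (C x); last first.
    by rewrite Fstat ?stat //; exact: stat.
  elim: (n) => [|j IH]; first by rewrite c0.
  rewrite FS -IH; apply: transport_strand => //= [i k ik|i]; first exact: sep.
  exact: close.
- by move=> x st t; exact: Fstat.
Qed.

End HomotopyLifting.

Lemma continuous_cst (X Y : topologicalType) (y : Y) : continuous (fun _ : X => y).
Proof. by move=> x; exact: cvg_cst. Qed.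

Lemma continuousD_fun {R : realType} (X : topologicalType) (V : normedModType R) (f g : X -> V) :
  continuous f -> continuous g -> continuous (fun x => f x + g x).
Proof. by move=> cf cg x; apply: cvgD; [exact: cf|exact: cg]. Qed.

Lemma continuousB_fun {R : realType} (X : topologicalType) (V : normedModType R) (f g : X -> V) :
  continuous f -> continuous g -> continuous (fun x => f x - g x).
Proof. by move=> cf cg x; apply: cvgB; [exact: cf|exact: cg]. Qed.

Lemma continuousZ_fun {R : realType} (X : topologicalType) (V : normedModType R)
    (a : X -> R) (f : X -> V) :
  continuous a -> continuous f -> continuous (fun x => a x *: f x).
Proof. by move=> ca cf x; apply: cvgZ; [exact: ca|exact: cf]. Qed.

Lemma continuous_norm {R : realType} (X : topologicalType) (V : normedModType R) (f : X -> V) :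
  continuous f -> continuous (fun x => `|f x|).
Proof. by move=> cf x; apply: cvg_norm; exact: cf. Qed.

Lemma continuous_lincomb {R : realType} (X : topologicalType) (V : normedModType R)
    (a : X -> R) (f g : X -> V) : continuous a -> continuous f -> continuous g ->
  continuous (fun x => (1 - a x) *: f x + a x *: g x).
Proof.
move=> ca cf cg; apply: continuousD_fun; apply: continuousZ_fun => //.
by apply: (@Defs.sub_continuous R X (fun=> 1)) => //; exact: continuous_cst.
Qed.

(** * Avoiding finitely many fibres *)

Section Bulge.
Context {R : realType}.
Local Notation I := (unit_interval R).
(** A real copy of the complex line, because the convexity and lifting lemmas ask for a normed
    module over [R]. The norm is the maximum of the coordinates. *)
Definition plane : Type := (R^o * R^o)%type.
HB.instance Definition _ := NormedModule.copy plane (R^o * R^o)%type.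
Implicit Types (m d : plane).

Lemma avoid_finite (s : seq R) (e : R) : 0 < e -> exists x, 0 < x < e /\ x \notin s.
Proof.
move=> e0; elim: s e e0 => [|y s IH] e e0.
  by exists (e / 2); split=> //; lra.
have [ye|ye] := boolP (0 < y < e).
  have [x [/andP[x0 xy] xs]] := IH y (proj1 (andP ye)).
  by exists x; rewrite inE (lt_eqF xy) xs x0 (lt_trans xy) //; case/andP: ye.
have [x [xe xs]] := IH e e0; exists x; rewrite xe; split=> //; rewrite inE negb_or xs andbT.
by apply: contraNN ye => /eqP <-.
Qed.

Definition rot m : plane := (- m.2, m.1).
(** A parabola from [m] to [m']: at time [t] it leaves the segment by [eta * t * (1 - t)] times the
    rotated chord. As [t * (1 - t)] is at most 1/4, taking [eta] in (0, 1) keeps it within a quarter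
    of the chord length from the segment. *)
Definition bulge (eta : R) m m' (t : R) : plane :=
  (m.1 + t * (m'.1 - m.1) + eta * (t * (1 - t)) * (- (m'.2 - m.2)),
   m.2 + t * (m'.2 - m.2) + eta * (t * (1 - t)) * (m'.1 - m.1)).

(** The component along the chord determines the time, and then the component along the rotated
    chord determines [eta], since [t * (1 - t)] is nonzero. So each point of the plane spoils at
    most one parabola. *)
Lemma bulge_eta eta eta' m m' t t' : m != m' -> 0 < t < 1 ->
  bulge eta m m' t = bulge eta' m m' t' -> eta = eta'.
Proof.
move=> mm' /andP[t0 t1] [e1 e2].
set a := m'.1 - m.1 in e1 e2; set b := m'.2 - m.2 in e1 e2.
have n0 : a ^+ 2 + b ^+ 2 != 0.
  rewrite paddr_eq0 ?sqr_ge0 // !sqrf_eq0 !subr_eq0; apply: contraNN mm'.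
  by case/andP=> /eqP h1 /eqP h2; case: (m) (m') h1 h2 => ? ? [? ?] /= -> ->.
pose A := (t - t') * a - (eta * (t * (1 - t)) - eta' * (t' * (1 - t'))) * b.
pose C := (t - t') * b + (eta * (t * (1 - t)) - eta' * (t' * (1 - t'))) * a.
have A0 : A = 0 by rewrite /A; lra.
have C0 : C = 0 by rewrite /C; lra.
have : a * A + b * C = (t - t') * (a ^+ 2 + b ^+ 2) by rewrite /A /C; ring.
rewrite A0 C0 !mulr0 addr0 => /esym/eqP; rewrite mulf_eq0 (negbTE n0) orbF subr_eq0.
move=> /eqP tt'.
have : a * C - b * A = (eta - eta') * (t * (1 - t)) * (a ^+ 2 + b ^+ 2).
  by rewrite /A /C -tt'; ring.
rewrite A0 C0 !mulr0 subr0 => /esym/eqP; rewrite !mulf_eq0 (negbTE n0) orbF subr_eq0.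
by case/orP=> [/eqP//|/orP[]/eqP h]; lra.
Qed.

Lemma bulge_sub (eta : R) m m' (t : R) :
  bulge eta m m' t - ((1 - t) *: m + t *: m') = (eta * (t * (1 - t))) *: rot (m' - m).
Proof.
case: m m' => a b [c d]; congr pair => /=.
  rewrite /GRing.scale /=; ring.
rewrite /GRing.scale /=; ring.
Qed.

Lemma plane_normE (V W : normedModType R) (z : V * W) :
  `|z| = Num.max `|z.1| `|z.2|.
Proof. by []. Qed.

(* Only finitely many of the parabolas [bulge eta] meet the finite set S. *)
Lemma bulge_avoid (S : seq plane) m m' : m \notin S -> m' \notin S ->
  exists v : I -> plane, path_in [set u | u \notin S] m m' v /\
    forall t, `|v t - ((1 - ival t) *: m + ival t *: m')| <= `|m' - m| / 4.
Proof.
move=> mS m'S.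
pose bad (u : plane) : R :=
  if pselect (exists eta : R, exists2 t : R, 0 < t < 1 & bulge eta m m' t = u)
  is left h then sval (cid h) else 0.
have [eta [/andP[eta0 eta1] etaS]] := @avoid_finite (map bad S) 1 ltr01.
have [mm'|mm'] := eqVneq m m'.
  exists (fun=> m); split; first by rewrite -mm'; exact: cst_path_in.
  by move=> t; rewrite -mm' -scalerDl subrK scale1r !subrr normr0 mul0r.
exists (fun t => bulge eta m m' (ival t)); split; last first.
  move=> t; have t0 := ival_ge0 t; have t1 := ival_le1 t.
  have -> : bulge eta m m' (ival t) - ((1 - ival t) *: m + ival t *: m') =
            (eta * (ival t * (1 - ival t))) *: rot (m' - m).
    exact: bulge_sub.
  have -> : `|m' - m| = `|rot (m' - m)| by rewrite !plane_normE /= normrN maxC.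
  rewrite normrZ mulrC ler_wpM2l // ger0_norm ?mulr_ge0 //; try lra.
  have : (ival t * (1 - ival t)) <= 4^-1.
    by have := sqr_ge0 (ival t - 2^-1); nra.
  have : 0 <= ival t * (1 - ival t) by rewrite mulr_ge0 //; lra.
  by move: (_ * _) => q; nra.
have bend : bulge eta m m' 0 = m /\ bulge eta m m' 1 = m'.
  by rewrite /bulge; split; [case: (m) => a b|case: (m') => a b];
     congr pair => /=; ring.
split.
- have ci := @ival_continuous R.
  have ct : continuous (fun t : I => eta * (ival t * (1 - ival t))).
    apply: (@Defs.mul_continuous R I (fun=> eta)); first exact: continuous_cst.
    apply: (@Defs.mul_continuous R I ival) => //.
    by apply: (@Defs.sub_continuous R I (fun=> 1)) => //; exact: continuous_cst.
  have lin (a c e : R) : continuous (fun t : I => a + ival t * c + eta * (ival t * (1 - ival t)) * e).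
    apply: (@continuousD_fun R I R^o (fun t => a + ival t * c) (fun t => eta * (ival t * (1 - ival t)) * e)).
      apply: (@continuousD_fun R I R^o (fun=> a) (fun t => ival t * c)).
        exact: continuous_cst.
      by apply: (@Defs.mul_continuous R I ival (fun=> c)) => //; exact: continuous_cst.
    by apply: (@Defs.mul_continuous R I _ (fun=> e) ct); exact: continuous_cst.
  by apply: continuous_pair; exact: lin.
- move=> t /=; apply/negP => hS.
  have [t0|t0] := boolP (0 < ival t < 1).
    move/negP: etaS; apply; apply/mapP; exists (bulge eta m m' (ival t)) => //.
    rewrite /bad; case: pselect => [h|]; last by case; exists eta, (ival t).
    case: cid => eta' /= [t' t'0 e].
    exact: (esym (bulge_eta mm' t'0 e)).
  have [e|e] : ival t = 0 \/ ival t = 1.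
  + have := ival_ge0 t; have := ival_le1 t; rewrite !le_eqVlt => /orP[/eqP->|a1]; first by right.
    by move=> /orP[/eqP<-|a0]; [left|rewrite a0 a1 in t0].
  + by move: hS mS; rewrite e bend.1 => ->.
  + by move: hS m'S; rewrite e bend.2 => ->.
- by rewrite ival0 bend.1.
- by rewrite ival1 bend.2.
Qed.

Lemma punctured_plane_connected (S : seq plane) :
  @path_connected R plane [set u | u \notin S].
Proof. by move=> m m' mS m'S; have [v [vP _]] := bulge_avoid mS m'S; exists v. Qed.

End Bulge.

(** * Pushing a path off finitely many fibres *)

Section PushOff.
Context {R : realType}.
Local Notation I := (unit_interval R).
Local Notation plane := (@plane R).
Local Notation space := (plane * plane)%type.
Implicit Types (Om : set space) (p q : I -> space).

Lemma path_radius (V : normedModType R) (Om : set V) (p : I -> V) :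
  open Om -> continuous p -> (forall t, Om (p t)) ->
  exists2 e, 0 < e & forall t v, `|v - p t| < e -> Om v.
Proof.
move=> oO cp Op.
have [|e e0 he] := @compact_uniform R I setT
    (fun e t => forall v, `|v - p t| < e -> Om v) unit_interval_compact; last first.
  by exists e => // t; exact: he.
move=> t _.
have /nbhs_ballP[e /= e0 he] : nbhs (p t) Om by apply: open_nbhs_nbhs; split.
exists [set s | `|p s - p t| < e / 2], (e / 2); first by rewrite divr_gt0.
split.
  apply: nbhs_lt; [|exact: continuous_cst|].
    by apply: continuous_norm; apply: continuousB_fun => //; exact: continuous_cst.
  by rewrite subrr normr0 divr_gt0.
move=> e' s /andP[e'0 e'e] /= st v vs; apply: he.
rewrite -ball_normE /= distrC.
by have := @ler_distD R V (p s) v (p t); lra.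
Qed.

Lemma ball_convex (V : normedModType R) (c : V) (e : R) :
  convex_set [set v : V | `|v - c| < e].
Proof.
move=> u v t /= ue ve /andP[t0 t1].
have -> : (1 - t) *: u + t *: v - c = (1 - t) *: (u - c) + t *: (v - c).
  rewrite !scalerBr addrACA -opprD -scalerDl subrK scale1r //.
apply: le_lt_trans (ler_normD _ _) _; rewrite !normrZ !ger0_norm ?subr_ge0 //.
have [->|t_neq0] := eqVneq t 0; first by rewrite subr0 mul1r mul0r addr0.
have tp : 0 < t by rewrite lt_def t_neq0.
have : (1 - t) * `|u - c| <= (1 - t) * e by rewrite ler_wpM2l ?subr_ge0 // ltW.
have : t * `|v - c| < t * e by rewrite ltr_pM2l.
lra.
Qed.

(** Only the base coordinate has to avoid [S]: it follows a parabola while the fibre coordinate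
    follows a segment. Ends within [e / 2] of [c] are less than [e] apart, so the parabola adds at
    most [e / 4] to the distance from [c]. *)
Lemma bulge_avoid_fst (S : seq plane) (z z' : space) : z.1 \notin S -> z'.1 \notin S ->
  exists q : I -> space, path_in [set u | u.1 \notin S] z z' q /\
    forall c e, `|z - c| < e / 2 -> `|z' - c| < e / 2 -> forall t, `|q t - c| < e.
Proof.
move=> zS z'S; have [v [[cv Sv v0 v1] vb]] := bulge_avoid zS z'S.
pose w (t : I) : plane := (1 - ival t) *: z.2 + ival t *: z'.2.
have ci := @ival_continuous R.
exists (fun t => (v t, w t)); split.
  split=> //.
  - apply: continuous_pair => //.
    by apply: continuous_lincomb => //; exact: continuous_cst.
  - by rewrite v0 /w ival0 subr0 scale1r scale0r addr0; case: (z).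
  - by rewrite v1 /w ival1 subrr scale1r scale0r add0r; case: (z').
move=> c e ze z'e t.
pose l := (1 - ival t) *: z + ival t *: z'.
have lc : `|l - c| < e / 2.
  by apply: (@ball_convex _ c (e / 2) z z') => //; rewrite ival_ge0 ival_le1.
have zz' : `|z' - z| < e.
  have : `|z' - z| <= `|z' - c| + `|z - c| by rewrite (distrC z c) ler_distD.
    lra.
have ql : `|(v t, w t) - l| <= e / 4.
  rewrite plane_normE ge_max; apply/andP; split.
    have := vb t; have : `|z'.1 - z.1| <= `|z' - z|.
      by rewrite (plane_normE (z' - z)) le_max lexx.
    by rewrite /l /=; lra.
  by rewrite /l /= /w subrr normr0; have := normr_ge0 (z' - z); lra.
have : `|(v t, w t) - c| <= `|(v t, w t) - l| + `|l - c| by exact: ler_distD.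
have : 0 <= `|l - c| by []; lra.
Qed.

Lemma near_avoid (S : seq plane) (z : space) (e : R) : 0 < e ->
  exists z' : space, [/\ z'.1 \notin S, `|z' - z| < e & (z.1 \notin S -> z' = z)].
Proof.
move=> e0; have [zS|zS] := boolP (z.1 \in S); last by exists z; rewrite subrr normr0.
have [x [/andP[x0 xe] xS]] := @avoid_finite R [seq u.1 - z.1.1 | u : plane <- S] e e0.
exists ((z.1.1 + x, z.1.2), z.2); split=> //=.
- apply: contraNN xS => h; apply/mapP; exists (z.1.1 + x, z.1.2) => //=.
  by rewrite addrC addrA addNr add0r.
- rewrite !plane_normE /= !subrr !normr0 addrC addrA addNr add0r.
  by rewrite gtr0_norm // !max_l // ltW.
Qed.

Variables (Om : set space) (x0 : Om).
Hypotheses (Oo : open Om) (Oc : @path_connected R space Om).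

(** The path is cut into pieces lying in balls contained in [Om]; the cut points are moved off [S]
    and each piece is replaced by a bulge in the same ball, homotopic to it because balls are
    convex. A displacement and an oscillation of [e / 4] each keep the next cut point within [e / 2]
    of the centre, as [bulge_avoid_fst] demands. Cut points already off [S] stay, so the ends are
    preserved. *)
Lemma push_off (S : seq plane) z z' p : path_in Om z z' p ->
  z.1 \notin S -> z'.1 \notin S ->
  exists2 q, path_in (Om `&` [set u | u.1 \notin S]) z z' q &
    path_class x0 q = path_class x0 p.
Proof.
move=> pO zS z'S; have [cp Op p0 p1] := pO.
have [cf fO pE] := path_extension pO; set f := p \o clamp in cf fO pE.
have [e e0 he] := path_radius Oo cp Op.
have [eta eta0 close] := @uniform_modulus R I space (fun z => p z.2) (e / 4)
  unit_interval_compact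
  (continuous_comp2 (@snd_continuous _ _) cp) (divr_gt0 e0 (ltr0Sn _ _)).
have {}close s t : `|ival s - ival t| <= eta -> `|p s - p t| < e / 4 := close zero s t.
have [n n0 neta] : exists2 n, (0 < n)%N & n%:R^-1 <= eta :> R.
  exists (Num.trunc eta^-1).+1 => //; rewrite invf_ple ?posrE //.
  by apply: ltW; exact: truncnS_gt.
have nR : 0 < n%:R :> R by rewrite ltr0n.
pose a j : R := j%:R / n%:R.
have a01 j : (j <= n)%N -> 0 <= a j <= 1.
  by move=> jn; rewrite divr_ge0 //= ler_pdivrMr // mul1r ler_nat.
have aS j : a j.+1 = a j + n%:R^-1 by rewrite /a -natr1 mulrDl mul1r.
have /choice[v vP] j := @near_avoid S (f (a j)) (e / 4) (divr_gt0 e0 (ltr0Sn _ _)).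
pose seg (u w : space) (t : I) : space := (1 - ival t) *: u + ival t *: w.
have segP (u w : space) (C : set space) : convex_set C -> C u -> C w -> path_in C u w (seg u w).
  move=> cC Cu Cw; split.
  - by apply: continuous_lincomb; [exact: ival_continuous|exact: continuous_cst|exact: continuous_cst].
  - by move=> t; apply: cC => //; rewrite ival_ge0 ival_le1.
  - by rewrite /seg ival0 subr0 scale1r scale0r addr0.
  - by rewrite /seg ival1 subrr scale1r scale0r add0r.
have fO' j : path_in Om (f (a 0%N)) (f (a j)) (subpath f (a 0%N) (a j)) by exact: subpath_in.
have a0 : a 0%N = 0 by rewrite /a mul0r.
have an : a n = 1 by rewrite /a divff ?gt_eqF.
have f0 : f (a 0%N) = z by rewrite a0 /f /= clamp0.
have f1 : f (a n) = z' by rewrite an /f /= clamp1.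
have v0 : v 0%N = z by have [_ _ ->] := vP 0%N; rewrite f0.
have vn : v n = z' by have [_ _ ->] := vP n; rewrite f1.
pose bl j := [set u : space | `|u - f (a j)| < e].
have blO j : bl j `<=` Om by move=> u /= ue; apply: (he (clamp (a j))).
have segO j : path_in (bl j) (f (a j)) (v j) (seg (f (a j)) (v j)).
  apply: segP; [exact: ball_convex|by rewrite /bl /= subrr normr0|].
  by rewrite /bl /=; have [_ h _] := vP j; lra.
have segO' j : path_in Om (f (a j)) (v j) (seg (f (a j)) (v j)).
  by have [? h ? ?] := segO j; split=> // t; apply: blO; exact: h.
(* The factor [seg (f (a j)) (v j)] corrects the end of the partial path, from the original cut
   point to the displaced one; it is constant at both ends of [p]. *)
suff gen j : (j <= n)%N ->
    exists2 q, path_in (Om `&` [set u | u.1 \notin S]) z (v j) q &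
    path_class x0 q = (path_class x0 (subpath f (a 0%N) (a j)) *
                      path_class x0 (seg (f (a j)) (v j)))%g.
  have [q qP qc] := gen n (leqnn n).
  exists q; first by rewrite -vn.
  rewrite qc f1 vn pE a0 an -[RHS]mulg1; congr (_ * _)%g.
  have -> : seg z' z' = fun=> z'.
    by apply/funext => t; rewrite /seg -scalerDl subrK scale1r.
  by apply: path_class_cst => //; rewrite -p1.
elim: j => [|j IH] jn.
  exists (fun=> z).
    by rewrite v0; apply: cst_path_in; split=> //; rewrite -p0.
  rewrite path_class_cst -?p0 // f0 v0.
  have -> : subpath f (a 0%N) (a 0%N) = fun=> z.
    by apply/funext => t; rewrite /subpath subrr mul0r add0r f0.
  have -> : seg z z = fun=> z.
    by apply/funext => t; rewrite /seg -scalerDl subrK scale1r.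
  by rewrite !path_class_cst ?mulg1 // -p0.
have [q qP qc] := IH (ltnW jn).
have [vjS vje _] := vP j; have [vjS' vje' _] := vP j.+1.
have fstep u : a j <= u <= a j.+1 -> `|f u - f (a j)| < e / 4.
  move=> /andP[u1 u2]; have := a01 _ jn; have := a01 _ (ltnW jn).
  move=> /andP[? ?] /andP[? ?]; apply: close.
  rewrite !ival_clamp; try lra.
  by rewrite ger0_norm ?subr_ge0 //; rewrite aS in u2; lra.
have vjj : `|v j.+1 - f (a j)| < e / 2.
  have := fstep (a j.+1); rewrite lexx aS lerDl invr_ge0 ltW //= -aS => /(_ isT).
  have : `|v j.+1 - f (a j)| <= `|v j.+1 - f (a j.+1)| + `|f (a j.+1) - f (a j)|.
    exact: ler_distD.
  lra.
have [b [bS bb]] := bulge_avoid_fst vjS vjS'.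
have bbl t : bl j (b t) by apply: bb => //; lra.
have [cb Sb b0 b1] := bS.
have bO : path_in Om (v j) (v j.+1) b by split=> // t; exact: blO.
have bO' : path_in (Om `&` [set u | u.1 \notin S]) (v j) (v j.+1) b.
  by split=> // t; split; [exact: blO|exact: Sb].
exists (path_cat q b); first exact: path_cat_in qP bO'.
have qO : path_in Om z (v j) q by case: qP => ? h ? ?; split=> // t; case: (h t).
rewrite (path_class_cat x0 Oc qO bO) qc -(path_class_subpath x0 Oc (a 0%N) (a j) (a j.+1) cf fO).
rewrite -!mulgA; congr (_ * _)%g.
have sO : path_in Om (f (a j)) (f (a j.+1)) (subpath f (a j) (a j.+1)) by exact: subpath_in.
rewrite -(path_class_cat x0 Oc (segO' j) bO) -(path_class_cat x0 Oc sO (segO' j.+1)).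
have sbl : path_in (bl j) (f (a j)) (f (a j.+1)) (subpath f (a j) (a j.+1)).
  have [? _ ? ?] := sO; split=> // t; rewrite /bl /=; apply: lt_trans (fstep _ _) _; last by lra.
  rewrite aS; have := ival_ge0 t; have := ival_le1 t.
  have : 0 < n%:R^-1 :> R by rewrite invr_gt0.
  by move: (n%:R^-1) (a j) (ival t) => x y u; nra.
have s'bl : path_in (bl j) (f (a j.+1)) (v j.+1) (seg (f (a j.+1)) (v j.+1)).
  apply: segP; first exact: ball_convex.
    by have [_ h _ <-] := sbl; exact: h.
  by rewrite /bl /=; lra.
have bbl' : path_in (bl j) (v j) (v j.+1) b by [].
have [c1 C1 e1 e1'] := path_cat_in (segO j) bbl'.
have [c2 C2 e2 e2'] := path_cat_in sbl s'bl.
have ci : continuous (@id space) by move=> u; exact: cvg_id.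
apply: (@path_class_convex R space Om x0 Oc space (bl j) id _ _
  (@ball_convex _ _ _) ci (fun c => @blO j c) c1 c2 C1 C2); first by rewrite e1 e2.
by rewrite e1' e2'.
Qed.

End PushOff.

(** * Functoriality of the fundamental group *)

Section GroupIso.
Local Open Scope group_scope.

Lemma group_isomorphic_morph (G H : groupType) (f : G -> H) :
  {morph f : x y / x * y} -> injective f -> (forall y, exists x, f x = y) ->
  group_isomorphic G H.
Proof.
move=> fM fI /choice[g fg].
pose m := isMultiplicative.Build G H f fM.
pose F : {multiplicative G -> H} := HB.pack f m.
by exists F; exists g => // x; apply: fI; rewrite fg.
Qed.

Lemma group_isomorphic_refl (G : groupType) : group_isomorphic G G.
Proof. by apply: (@group_isomorphic_morph G G id) => // y; exists y. Qed.

Lemma group_isomorphic_trans (G H K : groupType) :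
  group_isomorphic G H -> group_isomorphic H K -> group_isomorphic G K.
Proof.
move=> [f [f' fK f'K]] [g [g' gK g'K]].
apply: (@group_isomorphic_morph G K (fun x => g (f x))).
- by move=> x y; rewrite !gmulfM.
- by move=> x y /(can_inj gK)/(can_inj fK).
- by move=> z; exists (f' (g' z)); rewrite f'K g'K.
Qed.

Lemma group_isomorphic_sym (G H : groupType) :
  group_isomorphic G H -> group_isomorphic H G.
Proof.
move=> [f [f' fK f'K]]; apply: (@group_isomorphic_morph H G f').
- by move=> x y; apply: (can_inj fK); rewrite gmulfM !f'K.
- exact: can_inj f'K.
- by move=> x; exists (f x).
Qed.

Lemma group_isomorphic_prod (G G' H H' : groupType) :
  group_isomorphic G G' -> group_isomorphic H H' ->
  group_isomorphic (G * H)%type (G' * H')%type.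
Proof.
move=> [f [f' fK f'K]] [g [g' gK g'K]].
apply: (@group_isomorphic_morph (G * H)%type (G' * H')%type (fun x => (f x.1, g x.2))).
- by move=> x y; rewrite !gmulfM.
- by move=> [x y] [x' y'] [/(can_inj fK) -> /(can_inj gK) ->].
- by move=> [x y]; exists (f' x, g' y); rewrite f'K g'K.
Qed.

End GroupIso.

Section Induced.
Context {R : realType} {T T' : topologicalType}.
Local Notation I := (unit_interval R).
Local Open Scope group_scope.

Section Image.
Variables (A : set T) (A' : set T') (f : T -> T').
Hypotheses (fA : forall x, A x -> A' (f x)) (fc : forall x, A x -> {for x, continuous f}).

Lemma image_path_in x y (p : I -> T) :
  path_in A x y p -> path_in A' (f x) (f y) (fun t => f (p t)).
Proof.
move=> [cp Ap p0 p1]; split; rewrite ?p0 ?p1 // => t; last exact: fA.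
by apply: continuous_comp; [exact: cp|apply: fc].
Qed.

Lemma image_path_homotopic (p q : I -> T) :
  path_homotopic A p q -> path_homotopic A' (fun t => f (p t)) (fun t => f (q t)).
Proof.
move=> [H [cH AH Hpq He]]; exists (fun z => f (H z)); split.
- by move=> z; apply: continuous_comp; [exact: cH|apply: fc].
- by move=> z; exact: fA.
- by move=> t; have [-> ->] := Hpq t.
- by move=> t; have [-> ->] := He t.
Qed.

Lemma image_path_cat (p q : I -> T) :
  (fun t => f (path_cat p q t)) = path_cat (fun t => f (p t)) (fun t => f (q t)).
Proof. by apply/funext => t; rewrite /path_cat; case: ifP. Qed.

End Image.

Definition loop_repr (A : set T) (x0 : A) (g : pi1 R x0) : I -> T :=
  sval (cid2 (loop_class_surj g)).

Lemma loop_repr_in (A : set T) (x0 : A) (g : pi1 R x0) :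
  path_in A (set_val x0) (set_val x0) (loop_repr g).
Proof. by rewrite /loop_repr; case: cid2. Qed.

Lemma loop_reprK (A : set T) (x0 : A) (g : pi1 R x0) : loop_class x0 (loop_repr g) = g.
Proof. by rewrite /loop_repr; case: cid2. Qed.

Lemma loop_repr_class (A : set T) (x0 : A) (p : I -> T) :
  path_in A (set_val x0) (set_val x0) p ->
  path_homotopic A (loop_repr (loop_class x0 p)) p.
Proof.
move=> pA; apply/(loop_class_eqP (x0 := x0)) => //; first exact: loop_repr_in.
exact: loop_reprK.
Qed.

Lemma loop_reprM (A : set T) (x0 : A) (g h : pi1 R x0) :
  path_homotopic A (loop_repr (g * h)) (path_cat (loop_repr g) (loop_repr h)).
Proof.
have gA := loop_repr_in g; have hA := loop_repr_in h.
apply/(loop_class_eqP (x0 := x0)).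
- exact: loop_repr_in.
- exact: path_cat_in gA hA.
- by rewrite (loop_class_cat gA hA) !loop_reprK.
Qed.

Section Map.
Variables (A : set T) (A' : set T') (x0 : A) (x0' : A') (f : T -> T').
Hypotheses (fA : forall x, A x -> A' (f x)) (fc : forall x, A x -> {for x, continuous f}).
Hypothesis fx0 : f (set_val x0) = set_val x0'.

Definition induced (g : pi1 R x0) : pi1 R x0' := loop_class x0' (fun t => f (loop_repr g t)).

Lemma image_loop_in (p : I -> T) : path_in A (set_val x0) (set_val x0) p ->
  path_in A' (set_val x0') (set_val x0') (fun t => f (p t)).
Proof. by move=> /(image_path_in fA fc); rewrite fx0. Qed.

Lemma induced_class (p : I -> T) : path_in A (set_val x0) (set_val x0) p ->
  induced (loop_class x0 p) = loop_class x0' (fun t => f (p t)).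
Proof.
move=> pA; apply/loop_class_eqP; [exact/image_loop_in/loop_repr_in|exact: image_loop_in|].
exact/(image_path_homotopic fA fc)/loop_repr_class.
Qed.

Lemma inducedM : {morph induced : g h / g * h}.
Proof.
move=> g h; have gA := loop_repr_in g; have hA := loop_repr_in h.
rewrite /induced -loop_class_cat -?image_path_cat; try exact: image_loop_in.
apply/loop_class_eqP; [exact/image_loop_in/loop_repr_in|
  exact: (image_loop_in (path_cat_in gA hA))|].
exact/(image_path_homotopic fA fc)/loop_reprM.
Qed.

End Map.
End Induced.

Section Transfer.
Context {R : realType}.
Local Open Scope group_scope.

Lemma induced_cancel (T T' : topologicalType) (A : set T) (A' : set T') (x0 : A) (x0' : A')
    (f : T -> T') (f' : T' -> T) (fA : forall x, A x -> A' (f x))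
    (fc : forall x, A x -> {for x, continuous f}) (f'A : forall x, A' x -> A (f' x))
    (f'c : forall x, A' x -> {for x, continuous f'}) :
  (forall x, A x -> f' (f x) = x) -> f (set_val x0) = set_val x0' ->
  f' (set_val x0') = set_val x0 ->
  cancel (@induced R T T' A A' x0 x0' f) (@induced R T' T A' A x0' x0 f').
Proof.
move=> fK fx0 f'x0 g; rewrite -[RHS]loop_reprK.
rewrite [induced x0' f g]/induced (induced_class f'A f'c f'x0).
  congr loop_class; apply/funext => t; apply: fK.
  by have [_ h _ _] := loop_repr_in g.
by apply: (image_loop_in fA fc fx0); exact: loop_repr_in.
Qed.

(** The maps are total on the ambient spaces and continuous only at points of [A] and [A']; this is
    the form in which a chart of the projective plane, with arbitrary values at infinity, can be
    used. *)
Lemma homeomorphic_pi1 (T T' : topologicalType) (A : set T) (A' : set T') (x0 : A) (x0' : A')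
    (f : T -> T') (f' : T' -> T) :
  (forall x, A x -> A' (f x)) -> (forall x, A x -> {for x, continuous f}) ->
  (forall x, A' x -> A (f' x)) -> (forall x, A' x -> {for x, continuous f'}) ->
  (forall x, A x -> f' (f x) = x) -> (forall x, A' x -> f (f' x) = x) ->
  f (set_val x0) = set_val x0' ->
  group_isomorphic (pi1 R x0) (pi1 R x0').
Proof.
move=> fA fc f'A f'c fK f'K fx0.
have f'x0 : f' (set_val x0') = set_val x0 by rewrite -fx0 fK //; exact: set_valP.
apply: (@group_isomorphic_morph _ _ (@induced R T T' A A' x0 x0' f)).
- exact: inducedM.
- exact: can_inj (induced_cancel fA fc f'A f'c fK fx0 f'x0).
- move=> g; exists (induced x0 f' g).
  exact: (induced_cancel f'A f'c fA fc f'K f'x0 fx0).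
Qed.

(* path_class y, restricted to loops at x, is conjugation by the tether from y
   to x. *)
Lemma pi1_base_point (T : topologicalType) (A : set T) (x y : A) :
  @path_connected R T A -> group_isomorphic (pi1 R x) (pi1 R y).
Proof.
move=> Ac.
pose F (x1 y1 : A) (g : pi1 R x1) : pi1 R y1 := path_class y1 (loop_repr g).
have key (x1 y1 : A) : exists c : pi1 R x1, forall g, F y1 x1 (F x1 y1 g) = c * g * c^-1.
  have tA := tether_in y1 Ac (set_valP x1).
  exists (path_class x1 (tether y1 (set_val x1))) => g; rewrite /F.
  set p := loop_repr g; have pA : path_in A _ _ p := loop_repr_in g.
  have [_ Ap p0 p1] := pA.
  have qA := path_cat_in tA (path_cat_in pA (path_rev_in tA)).
  rewrite -(path_class_rev x1 Ac tA) -mulgA.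
  have -> : g = path_class x1 p by rewrite path_class_loop // loop_reprK.
  rewrite -(path_class_cat x1 Ac pA (path_rev_in tA)).
  rewrite -(path_class_cat x1 Ac tA (path_cat_in pA (path_rev_in tA))).
  rewrite {2}/path_class p0 p1.
  apply: (path_class_homotopic x1 Ac (loop_repr_in _) qA).
  exact: loop_repr_class.
apply: (@group_isomorphic_morph _ _ (F x y)).
- move=> g h; have gA := loop_repr_in g; have hA := loop_repr_in h.
  rewrite /F -(path_class_cat y Ac gA hA).
  exact: path_class_homotopic (loop_repr_in _) (path_cat_in gA hA) (loop_reprM g h).
- move=> g h gh; have [c cP] := key x y.
  by have := cP g; rewrite gh cP => /mulIg/mulgI.
- move=> h; have [c cP] := key y x; exists (F y x (c^-1 * h * c)).
  by rewrite cP !mulgA mulgV mul1g mulgK.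
Qed.

End Transfer.

(** * Removing fibres *)

Section FibreRemoval.
Context {R : realType} (J K : finType).
Local Notation I := (unit_interval R).
Local Notation plane := (@plane R).
Local Notation space := (plane * plane)%type.
Variables (r : J -> plane -> plane) (s : plane -> plane) (S : seq plane).
Hypotheses (cr : forall j, continuous (r j)) (cs : continuous s).
Hypothesis sr : forall j m, s m != r j m.
Hypothesis rS : forall m i j, m \notin S -> i != j -> r i m != r j m.

Definition total (Q : set plane) : set space :=
  [set z | Q z.1 /\ forall j, z.2 != r j z.1].
(** Making the section a strand has two effects: a lift starting on the section stays on it, and one
    starting off it never touches it. *)
Definition strand (o : option J) : plane -> plane := if o is Some j then r j else s.
Definition section (m : plane) : space := (m, s m).

Lemma strand_continuous o : continuous (strand o).
Proof. by case: o. Qed.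

Lemma strand_disjoint m o o' : m \notin S -> o != o' -> strand o m != strand o' m.
Proof.
move=> mS; case: o o' => [i|] [j|] //= ij; first exact: rS.
by rewrite eq_sym; exact: sr.
Qed.

Lemma section_continuous : continuous section.
Proof. by apply: continuous_pair => // m; exact: cvg_id. Qed.

Lemma total_section Q m : Q m -> total Q (section m).
Proof. by move=> Qm; split=> // j; exact: sr. Qed.

Lemma section_path Q m m' (b : I -> plane) : path_in Q m m' b ->
  path_in (total Q) (section m) (section m') (fun t => section (b t)).
Proof.
apply: image_path_in; first exact: total_section.
by move=> z _; exact: section_continuous.
Qed.

Lemma total_lifting (X : topologicalType) (Q C : set _) (H : X * I -> plane) (e0 : X -> plane) :
  compact [set: X] -> closed C -> continuous H -> continuous e0 ->
  (forall z, Q (H z)) -> (forall x, total Q (H (x, zero), e0 x)) ->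
  (forall x, ~ C x -> forall t, H (x, t) = H (x, zero)) ->
  (forall x t, C x -> H (x, t) \notin S) ->
  exists e : X * I -> space,
    [/\ continuous e, forall z, total Q (e z), forall z, (e z).1 = H z,
        forall x, e (x, zero) = (H (x, zero), e0 x) &
        (forall x, (forall t, H (x, t) = H (x, zero)) -> forall t, e (x, t) = e (x, zero)) /\
        (forall x, e0 x = s (H (x, zero)) -> forall t, e (x, t) = section (H (x, t)))].
Proof.
move=> cX clC cH ce0 QH e0E stat HS.
have [x t o o' Cx oo'|e [ce ez eS est]] := homotopy_lifting cX clC cH ce0 strand_continuous stat.
  by apply: strand_disjoint => //; exact: HS.
exists (fun z => (H z, e z)); split=> //.
- exact: continuous_pair.
- move=> [x t]; split=> //= j; apply/eqP => /(eS x t (Some j)) /eqP.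
  by have [_ /(_ j)/negP] := e0E x.
- by move=> x; rewrite ez.
- split=> x; first by move=> st t; rewrite st est ?ez.
  by move=> e0s t; congr pair; apply/(eS x t None).
Qed.

Variables (m0 : plane).
Hypothesis m0S : m0 \notin S.

Definition fibre : set plane := [set w | forall j, w != r j m0].

Lemma fibre_path Q (f : I -> plane) w w' : Q m0 -> path_in fibre w w' f ->
  path_in (total Q) (m0, w) (m0, w') (fun t => (m0, f t)).
Proof.
move=> Qm0 [cf Ff f0 f1]; split=> //; rewrite ?f0 ?f1 //.
  by apply: continuous_pair => //; exact: continuous_cst.
by move=> t; split=> //= j; exact: (Ff t).
Qed.

Lemma total_open Q : open Q -> open (total Q).
Proof.
move=> oQ; have -> : total Q = fst @^-1` Q `&` [set z | forall j, j \in enum J -> z.2 != r j z.1].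
  apply/seteqP; split=> z [Qz zr].
    by split=> // j _; apply: zr.
  by split=> // j; apply: zr; rewrite mem_enum.
apply: openI; first by apply: open_comp => // z _; exact: cvg_fst.
elim: (enum J) => [|j l IH].
  by rewrite (_ : [set z | _] = setT); [exact: openT|apply/seteqP].
rewrite (_ : [set z | _] = [set z : space | 0 < `|z.2 - r j z.1|] `&`
    [set z | forall i, i \in l -> z.2 != r i z.1]).
  apply: openI => //; apply: (@open_comp _ _ (fun z : space => `|z.2 - r j z.1|) [set x | 0 < x]).
    move=> z _; move: z; apply: continuous_norm; apply: continuousB_fun.
      exact: snd_continuous.
    exact: (@continuous_comp2 space plane plane fst (r j) (@fst_continuous plane plane) (@cr j)).
  exact: open_gt.
apply/seteqP; split=> z /=.
  move=> h; split; first by rewrite normr_gt0 subr_eq0 h // mem_head.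
  by move=> i il; apply: h; rewrite inE il orbT.
by rewrite normr_gt0 subr_eq0 => -[h1 h2] i; rewrite inE => /orP[/eqP->//|]; exact: h2.
Qed.

(** After pushing the loop [p] off [S], its base part is retracted along itself to [m0] by [u], and
    this homotopy is lifted. The start of the loop stands still, its end runs backwards through the
    section, and what remains at time 1 lies in the fibre over [m0]. The square law then reads: [p]
    times the inverse of the section loop equals the fibre loop. *)
Lemma total_generation Q (x0 : total Q) (g : pi1 R x0) :
  open Q -> @path_connected R space (total Q) -> set_val x0 = section m0 ->
  exists f b, [/\ path_in fibre (s m0) (s m0) f, path_in Q m0 m0 b &
    g = (path_class x0 (fun t => (m0, f t)) * path_class x0 (fun t => section (b t)))%g].
Proof.
move=> oQ Qc x0E.
have [p' p'Q <-] := path_class_surj g.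
have [||p pQ pp'] := push_off (S := S) x0 (total_open oQ) Qc p'Q; [by rewrite x0E|by rewrite x0E|].
rewrite -pp' {p' p'Q pp'}; rewrite x0E in pQ; have [cp Qp p0 p1] := pQ.
have Qm0 : Q m0 by have [[]] := Qp zero; rewrite p0.
pose u (z : I * I) : I := clamp (ival z.1 * (1 - ival z.2)).
have cu : continuous u.
  apply: clamp_comp_continuous; apply: Defs.mul_continuous.
    exact: ival_comp_continuous (@fst_continuous _ _).
  apply: (@Defs.sub_continuous R _ (fun=> 1)); first exact: continuous_cst.
  exact: ival_comp_continuous (@snd_continuous _ _).
have u0 x : u (x, zero) = x by rewrite /u /= ival0 subr0 mulr1 clampK.
have u1 x : u (x, one) = zero by rewrite /u /= ival1 subrr mulr0 clamp0.
have ul t : u (zero, t) = zero by rewrite /u /= ival0 mul0r clamp0.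
have ur t : u (one, t) = clamp (1 - ival t) by rewrite /u /= ival1 mul1r.
have cp1 : continuous (fun t => (p t).1) by exact: continuous_comp2 cp (@fst_continuous _ _).
have cp2 : continuous (fun t => (p t).2) by exact: continuous_comp2 cp (@snd_continuous _ _).
have [||||||||e [ce Qe e1 e0 [est es]]] := @total_lifting I Q setT (fun z => (p (u z)).1) (fun t => (p t).2).
- exact: unit_interval_compact.
- exact: closedT.
- exact: continuous_comp2 cu cp1.
- exact: cp2.
- by move=> z; have [[]] := Qp (u z).
- by move=> x; rewrite u0; have [] := Qp x; case: (p x).
- by move=> x /(_ Logic.I).
- by move=> x t _; have [_] := Qp (u (x, t)).
have bQ : path_in Q m0 m0 (fun t => (p t).1).
  by split=> // [t||]; [have [[]] := Qp t|rewrite p0|rewrite p1].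
have fF : path_in fibre (s m0) (s m0) (fun t => (e (t, one)).2).
  split.
  - apply: continuous_comp2 (@snd_continuous _ _); apply: (@continuous_comp2 _ _ _ _ e) => //.
    by apply: continuous_pair => [t|]; [exact: cvg_id|exact: continuous_cst].
  - by move=> t j; have [_ /(_ j)] := Qe (t, one); rewrite e1 u1 p0.
  - by rewrite es ?u0 ?u1 ?p0.
  - by rewrite es ?u0 ?u1 ?p1 ?p0.
exists (fun t => (e (t, one)).2), (fun t => (p t).1); split=> //.
have := path_class_square x0 Qc ce Qe.
have -> : (fun t => e (t, zero)) = p.
  by apply/funext => t; rewrite e0 u0; case: (p t).
have -> : (fun t => e (zero, t)) = fun=> section m0.
  by apply/funext => t; rewrite es ?u0 ?ul ?p0.
have -> : (fun t => e (one, t)) = path_rev (fun t => section (p t).1).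
  by apply/funext => t; rewrite es ?u0 ?ur ?p1.
rewrite (path_class_cst x0 Qc (total_section Qm0)) mul1g (path_class_rev x0 Qc (section_path bQ)).
have -> : (fun t => e (t, one)) = fun t => (m0, (e (t, one)).2).
  by apply/funext => t; have := e1 (t, one); rewrite u1 p0; case: (e _) => ? ? /= ->.
by move=> <-; rewrite mulgVK.
Qed.

Lemma total_setT Q z : total Q z <-> total setT z /\ Q z.1.
Proof. by split=> [[]|[[]]]. Qed.

(* A null homotopy in the whole total space is pushed, by lifting the
   deformation D of its base part, into the part over Q. *)
Lemma fibre_null Q (C : set plane) (D : plane * I -> plane) (f : I -> plane) :
  closed C -> continuous D -> (forall m, D (m, zero) = m) -> (forall m, Q (D (m, one))) ->
  (forall t, D (m0, t) = m0) -> (forall m t, ~ C m -> D (m, t) = m) ->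
  (forall m t, C m -> D (m, t) \notin S) ->
  path_in fibre (s m0) (s m0) f ->
  path_homotopic (total setT) (fun t => (m0, f t)) (fun=> section m0) ->
  path_homotopic (total Q) (fun t => (m0, f t)) (fun=> section m0).
Proof.
move=> clC cD D0 D1 Dm0 DC CS fF [N [cN TN Nf Ne]].
have cN1 : continuous (fun z => (N z).1) by exact: continuous_comp2 cN (@fst_continuous _ _).
have cN2 : continuous (fun z => (N z).2) by exact: continuous_comp2 cN (@snd_continuous _ _).
have [||||||||e [ce Te e1 e0 [est _]]] := @total_lifting (I * I)%type setT
    [set z | C (N z).1] (fun z => D ((N z.1).1, z.2)) (fun z => (N z).2).
- by rewrite -setXTT; apply: compact_setX; exact: unit_interval_compact.
- by apply: closed_comp => // z _; exact: cN1.
- apply: (@continuous_comp2 _ _ _ _ D) => //; apply: continuous_pair.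
    exact: continuous_comp2 (@fst_continuous _ _) cN1.
  exact: snd_continuous.
- exact: cN2.
- by [].
- by move=> z; rewrite D0; have := TN z; case: (N z).
- by move=> z nC t; rewrite !DC.
- by move=> z t Cz; exact: CS.
(* The deformation fixes [m0], so points of the null homotopy over [m0] are not moved; all its
   boundary conditions are over [m0] and therefore survive. *)
have stat z : (N z).1 = m0 -> e (z, one) = N z.
  by move=> Nz; rewrite est ?e0 ?D0 => [|t]; [case: (N z)|rewrite /= Nz !Dm0].
exists (fun z => e (z, one)); split.
- apply: (@continuous_comp2 _ _ _ _ e) => //; apply: continuous_pair => [z|].
    exact: cvg_id.
  exact: continuous_cst.
- move=> z; apply/total_setT; split=> //; rewrite e1; exact: D1.
- by move=> t; have [h1 h2] := Nf t; rewrite /= !stat ?h1 ?h2.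
- by move=> t; have [h1 h2] := Ne t; rewrite /= !stat ?h1 ?h2.
Qed.

(** The isomorphism [F] pairs the inclusion into [total setT] with the projection to [Q]. Section
    loops die in [total setT], where the base is the whole plane, and fibre loops die in [Q], so [F]
    reads off the two factors given by [total_generation]. That these factors commute needs no
    separate argument: it follows from the injectivity of [F]. *)
Lemma total_pi1 Q (x0 : total Q) (y0 : total setT) (b0 : Q)
    (C : set plane) (D : plane * I -> plane) :
  open Q -> @path_connected R space (total Q) -> @path_connected R space (total setT) ->
  closed C -> continuous D -> (forall m, D (m, zero) = m) -> (forall m, Q (D (m, one))) ->
  (forall t, D (m0, t) = m0) -> (forall m t, ~ C m -> D (m, t) = m) ->
  (forall m t, C m -> D (m, t) \notin S) ->
  set_val x0 = section m0 -> set_val y0 = section m0 -> set_val b0 = m0 ->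
  group_isomorphic (pi1 R x0) (pi1 R y0 * pi1 R b0)%type.
Proof.
move=> oQ cQ cT clC cD D0 D1 Dm0 DC CS x0E y0E b0E.
have Qm0 : Q m0 by rewrite -b0E; exact: set_valP.
have iA z : total Q z -> total setT z by move=> /total_setT[].
have ic z : total Q z -> {for z, continuous (@id space)} by move=> _; exact: cvg_id.
have i0 : id (set_val x0) = set_val y0 by rewrite y0E.
have pA z : total Q z -> Q z.1 by case.
have pc z : total Q z -> {for z, continuous (@fst plane plane)} by move=> _; exact: cvg_fst.
have p0 : (set_val x0).1 = set_val b0 by rewrite x0E b0E.
pose F (g : pi1 R x0) : pi1 R y0 * pi1 R b0 := (induced y0 id g, induced b0 fst g).
have FM : {morph F : g h / (g * h)%g}.
  by move=> g h; congr pair; [exact: (inducedM iA ic i0)|exact: (inducedM pA pc p0)].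
have sec_null (b : I -> plane) : path_in setT m0 m0 b -> path_class y0 (fun t => section (b t)) = 1%g.
  move=> [cb _ be0 be1].
  rewrite (@path_class_convex R space _ y0 cT plane setT section b (fun=> m0)) //.
  - by apply: path_class_cst => //; exact: total_section.
  - exact: section_continuous.
  - by move=> m _; exact: total_section.
  - exact: continuous_cst.
have FE (f b : I -> plane) : path_in fibre (s m0) (s m0) f -> path_in Q m0 m0 b ->
    F (path_class x0 (fun t => (m0, f t)) * path_class x0 (fun t => section (b t)))%g =
    (path_class y0 (fun t => (m0, f t)), path_class b0 b).
  move=> fF bQ.
  have f1 : path_in (total Q) (set_val x0) (set_val x0) (fun t => (m0, f t)).
    by rewrite x0E; exact: fibre_path.
  have s1 : path_in (total Q) (set_val x0) (set_val x0) (fun t => section (b t)).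
    by rewrite x0E; exact: section_path.
  have f2 : path_in (total setT) (set_val y0) (set_val y0) (fun t => (m0, f t)).
    by rewrite y0E; exact: fibre_path.
  have s2 : path_in (total setT) (set_val y0) (set_val y0) (fun t => section (b t)).
    by rewrite y0E; apply: section_path; case: bQ => *; split.
  have b1 : path_in Q (set_val b0) (set_val b0) b by rewrite b0E.
  rewrite FM (path_class_loop f1) (path_class_loop s1) /F.
  rewrite (induced_class iA ic i0 f1) (induced_class iA ic i0 s1).
  rewrite (induced_class pA pc p0 f1) (induced_class pA pc p0 s1).
  congr pair => /=.
    rewrite -[RHS]mulg1 -(sec_null b) ?path_class_loop //.
    by case: bQ => *; split.
  by rewrite path_class_loop // -b0E loop_class_cst mul1g.
have gen g := total_generation g oQ cQ x0E.
have Fker g : F g = 1%g -> g = 1%g.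
  have [f [b [fF bQ ->]]] := gen g; rewrite FE // => -[cf cb].
  have fP : path_in (total Q) (section m0) (section m0) (fun t => (m0, f t)).
    exact: fibre_path.
  have cstP A m : A m -> path_in A m m (fun _ : I => m) by exact: cst_path_in.
  have sP : path_in (total Q) (section m0) (section m0) (fun _ : I => section m0).
    by apply: cstP; exact: total_section.
  rewrite (path_class_homotopic x0 cQ fP sP); last first.
    apply: (fibre_null clC) => //.
    apply: (path_class_inj (x0 := y0)); rewrite ?y0E.
    - exact: fibre_path.
    - by apply: cstP; exact: total_section.
    - by rewrite cf path_class_cst //; exact: total_section.
  rewrite (path_class_homotopic x0 cQ (section_path bQ) sP); last first.
    have := @image_path_homotopic R _ _ Q (total Q) section _ _ b (fun=> m0); apply.
    - exact: total_section.
    - by move=> m _; exact: section_continuous.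
    - apply: (path_class_inj (x0 := b0)); rewrite ?b0E //; first exact: cstP.
      by rewrite cb -b0E path_class_base.
  by rewrite path_class_cst ?mulg1 //; exact: total_section.
apply: (group_isomorphic_morph FM).
- move=> g h gh; apply: (mulIg h^-1%g); rewrite mulgV; apply: Fker.
  apply: (mulIg (F h)); rewrite -FM mulgVK mul1g //.
(* Over the whole plane the section loop in the decomposition of [u] is trivial, so [u] is the class
   of a loop of the fibre, and this loop already lies over [Q]. *)
- move=> [u v].
  have [f [c [fF cQ' ->]]] := total_generation u openT cT y0E.
  have [b bQ <-] := path_class_surj v; rewrite b0E in bQ.
  exists (path_class x0 (fun t => (m0, f t)) * path_class x0 (fun t => section (b t)))%g.
  by rewrite FE // sec_null // mulg1.
Qed.

End FibreRemoval.

(** * Holonomy of a local cocycle *)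

Section Holonomy.
Context {R : realType} {V : normedModType R} {G : groupType}.
Local Notation I := (unit_interval R).
Variables (A : set V) (c : V -> V -> G).
Local Notation cocycle u v w := ((c u v * c v w)%g = c u w).
Hypothesis loc : forall z, A z -> exists2 e, 0 < e & forall u v w : V,
  `|u - z| < e -> `|v - z| < e -> `|w - z| < e -> cocycle u v w.

Fixpoint iter_prod (f : nat -> G) n : G := if n is m.+1 then (iter_prod f m * f m)%g else 1%g.

Lemma iter_prodD f m n :
  iter_prod f (m + n) = (iter_prod f m * iter_prod (fun j => f (m + j)%N) n)%g.
Proof.
by elim: n => [|n IH]; rewrite ?addn0 ?mulg1 // addnS /= IH mulgA.
Qed.

Lemma iter_prodM f m n : iter_prod f (m * n) =
  iter_prod (fun j => iter_prod (fun i => f (j * n + i)%N) n) m.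
Proof. by elim: m => //= m IH; rewrite mulSnr iter_prodD IH. Qed.

Lemma eq_iter_prod f g n : (forall j, (j < n)%N -> f j = g j) -> iter_prod f n = iter_prod g n.
Proof. by elim: n => //= n IH fg; rewrite IH ?fg // => j jn; apply: fg; rewrite ltnS ltnW. Qed.

Definition time (n j : nat) : I := clamp (j%:R / n%:R).

Definition holn (p : I -> V) n : G :=
  iter_prod (fun j => c (p (time n j)) (p (time n j.+1))) n.

(** [e] is a Lebesgue number for the cocycle identity. The distance is a parameter because both the
    interval and the square are subdivided. *)
Definition fine (X : Type) (d : X -> X -> R) (p : X -> V) (e : R) : Prop :=
  forall s t u, d s t <= e -> d t u <= e -> d s u <= e -> cocycle (p s) (p t) (p u).

Definition dI (s t : I) : R := `|ival s - ival t|.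
Definition dII (y z : I * I) : R := Num.max (dI y.1 z.1) (dI y.2 z.2).

Lemma c_id x : A x -> c x x = 1%g.
Proof.
move=> /loc[e e0 /(_ x x x)]; rewrite subrr normr0 => /(_ e0 e0 e0) h.
by apply: (mulgI (c x x)); rewrite h mulg1.
Qed.

Lemma fine_le (X : Type) (d : X -> X -> R) p e e' : e' <= e -> fine d p e -> fine d p e'.
Proof. by move=> ee' h s t u st tu su; apply: h; apply: le_trans ee'. Qed.

(** A point of the compact triple product either has two coordinates apart, and then the premises
    fail around it for small [e], or lies on the diagonal, where [loc] applies. *)
Lemma fine_exists (X : topologicalType) (d : X -> X -> R) (p : X -> V) :
  compact [set: X] -> continuous p -> (forall t, A (p t)) ->
  continuous (fun z : X * X => d z.1 z.2) -> (forall x y, d x y <= 0 -> x = y) ->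
  exists2 e, 0 < e & fine d p e.
Proof.
move=> cX cp Ap cd d0.
have cX3 : compact [set: (X * X) * X].
  by rewrite -setXTT; apply: compact_setX => //; rewrite -setXTT; exact: compact_setX.
have [|e e0 he] := @compact_uniform R _ setT
    (fun e z => d z.1.1 z.1.2 <= e -> d z.1.2 z.2 <= e -> d z.1.1 z.2 <= e ->
       cocycle (p z.1.1) (p z.1.2) (p z.2)) cX3; last first.
  by exists e => // s t u st tu su; exact: (he ((s, t), u)).
have c1 := @fst_continuous (X * X)%type X; have c2 := @snd_continuous (X * X)%type X.
have c11 : continuous (fun z : (X * X) * X => z.1.1).
  exact: continuous_comp2 c1 (@fst_continuous _ _).
have c12 : continuous (fun z : (X * X) * X => z.1.2).
  exact: continuous_comp2 c1 (@snd_continuous _ _).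
have far (f g : (X * X) * X -> X) (z : (X * X) * X) : continuous f -> continuous g ->
    0 < d (f z) (g z) -> nbhs z [set y | d (f z) (g z) / 2 < d (f y) (g y)].
  move=> cf cg dz; apply: nbhs_lt; [exact: continuous_cst| |lra].
  exact: continuous_comp2 (continuous_pair cf cg) cd.
move=> [[s t] u] _.
have [st|st] := ltP 0 (d s t).
  exists [set y | d s t / 2 < d y.1.1 y.1.2], (d s t / 2); first by rewrite divr_gt0.
  split; first exact: (far (fun z => z.1.1) (fun z => z.1.2) ((s, t), u)).
  by move=> e y /andP[_ e1] /= y1 y2; exfalso; lra.
have [tu|tu] := ltP 0 (d t u).
  exists [set y | d t u / 2 < d y.1.2 y.2], (d t u / 2); first by rewrite divr_gt0.
  split; first exact: (far (fun z => z.1.2) (fun z => z.2) ((s, t), u)).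
  by move=> e y /andP[_ e1] /= y1 y2 y3; exfalso; lra.
rewrite -(d0 _ _ tu) -(d0 _ _ st) {st tu t u}.
have [e e0 he] := loc (Ap s).
exists ([set y | `|p y.1.1 - p s| < e] `&` [set y | `|p y.1.2 - p s| < e] `&`
        [set y | `|p y.2 - p s| < e]), 1 => //.
split; last by move=> e' y _ /= [[h1 h2] h3] _ _ _; exact: he.
have nb (f : (X * X) * X -> X) : continuous f -> f ((s, s), s) = s ->
    nbhs ((s, s), s) [set y | `|p (f y) - p s| < e].
  move=> cf fs; apply: nbhs_lt; [|exact: continuous_cst|by rewrite fs subrr normr0].
  apply: continuous_norm; apply: continuousB_fun; last exact: continuous_cst.
  exact: continuous_comp2 cf cp.
exact: (filterI (filterI (nb _ c11 erefl) (nb _ c12 erefl)) (nb _ c2 erefl)).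
Qed.

Lemma dI_continuous : continuous (fun z : I * I => dI z.1 z.2).
Proof.
apply: (@continuous_norm R (I * I)%type R^o (fun z => ival z.1 - ival z.2)).
apply: Defs.sub_continuous.
  exact: ival_comp_continuous (@fst_continuous _ _).
exact: ival_comp_continuous (@snd_continuous _ _).
Qed.

Lemma dI_le0 x y : dI x y <= 0 -> x = y.
Proof. by rewrite /dI normr_le0 subr_eq0 => /eqP/ival_inj. Qed.

Lemma path_fine (p : I -> V) : continuous p -> (forall t, A (p t)) ->
  exists2 e, 0 < e & fine dI p e.
Proof.
move=> cp Ap; apply: fine_exists => //; first exact: unit_interval_compact.
  exact: dI_continuous.
exact: dI_le0.
Qed.

Lemma square_fine (H : I * I -> V) : continuous H -> (forall z, A (H z)) ->
  exists2 e, 0 < e & fine dII H e.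
Proof.
move=> cH AH; apply: fine_exists => //.
- by rewrite -setXTT; apply: compact_setX; exact: unit_interval_compact.
- have c1 := @fst_continuous (I * I)%type (I * I)%type.
  have c2 := @snd_continuous (I * I)%type (I * I)%type.
  apply: max_fun_continuous.
    apply: (continuous_comp2 _ dI_continuous (f := fun z : (I * I) * (I * I) => (z.1.1, z.2.1))).
    by apply: continuous_pair; [exact: continuous_comp2 c1 (@fst_continuous _ _)|
      exact: continuous_comp2 c2 (@fst_continuous _ _)].
  apply: (continuous_comp2 _ dI_continuous (f := fun z : (I * I) * (I * I) => (z.1.2, z.2.2))).
  by apply: continuous_pair; [exact: continuous_comp2 c1 (@snd_continuous _ _)|
    exact: continuous_comp2 c2 (@snd_continuous _ _)].
- by move=> [x x'] [y y']; rewrite ge_max => /andP[/dI_le0 /= -> /dI_le0 /= ->].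
Qed.

Lemma ival_time n j : (0 < n)%N -> (j <= n)%N -> ival (time n j) = j%:R / n%:R.
Proof.
move=> n0 jn; rewrite /time ival_clamp // divr_ge0 //= ler_pdivrMr ?ltr0n //.
by rewrite mul1r ler_nat.
Qed.

Lemma time0 n : time n 0 = zero. Proof. by rewrite /time mul0r clamp0. Qed.

Lemma timen n : (0 < n)%N -> time n n = one.
Proof. by move=> n0; rewrite /time divff ?clamp1 // pnatr_eq0 -lt0n. Qed.

(** Inside one interval of the coarse subdivision the finer factors telescope by the cocycle
    identity. *)
Lemma holn_refine p n m : (0 < n)%N -> (0 < m)%N -> (forall t, A (p t)) ->
  fine dI p n%:R^-1 -> holn p (n * m) = holn p n.
Proof.
move=> n0 m0 Ap fp; rewrite /holn iter_prodM; apply: eq_iter_prod => j jn.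
have nR : 0 < n%:R :> R by rewrite ltr0n.
have mR : 0 < m%:R :> R by rewrite ltr0n.
have tm i : (i <= m)%N -> ival (time (n * m) (j * m + i)) = (j%:R + i%:R / m%:R) / n%:R.
  move=> im; rewrite ival_time ?muln_gt0 ?n0 //; last first.
    by rewrite (leq_trans (leq_add (leqnn _) im)) // -mulSnr leq_mul2r jn orbT.
  rewrite natrD !natrM; field; rewrite !gt_eqF //.
pose T i := time (n * m) (j * m + i).
have dT i i' : (i <= i' <= m)%N -> dI (T i) (T i') <= n%:R^-1.
  move=> /andP[ii' im]; rewrite /dI distrC !tm // ?(leq_trans ii') //.
  have i1 : i%:R <= i'%:R :> R by rewrite ler_nat.
  have i2 : i'%:R <= m%:R :> R by rewrite ler_nat.
  rewrite -mulrBl normrM [X in _ * X]ger0_norm ?invr_ge0 ?ler0n //.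
  rewrite -[leRHS]mul1r ler_wpM2r ?invr_ge0 ?ler0n //.
  rewrite opprD addrACA subrr add0r -mulrBl ger0_norm ?divr_ge0 ?subr_ge0 //.
  by rewrite ler_pdivrMr // mul1r lerBlDr (le_trans i2) // lerDl.
have T0 : time n j = T 0%N.
  by apply: ival_inj; rewrite ival_time ?(ltnW jn) // tm // mul0r addr0.
have Tm : time n j.+1 = T m.
  by apply: ival_inj; rewrite ival_time // tm // divff ?gt_eqF // natr1.
have step i : (i <= m)%N ->
    iter_prod (fun i => c (p (T i)) (p (T i.+1))) i = c (p (T 0%N)) (p (T i)).
  elim: i => [|i IH] im; first by rewrite c_id.
  by rewrite /= IH ?(ltnW im) //; apply: fp; apply: dT; lia.
rewrite T0 Tm -step //; apply: eq_iter_prod => i _.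
by rewrite /T addnS.
Qed.

(** The choice of subdivision does not matter, because two fine ones agree with their common
    refinement. A map with no fine subdivision gets the value 1. *)
Definition hol (p : I -> V) : G :=
  if pselect (exists n, fine dI p n.+1%:R^-1) is left h then holn p (sval (cid h)).+1 else 1%g.

Lemma holE p n : (forall t, A (p t)) -> fine dI p n.+1%:R^-1 -> hol p = holn p n.+1.
Proof.
move=> Ap fp; rewrite /hol; case: pselect => [h|]; last by case; exists n.
case: cid => m fm /=.
by rewrite -(holn_refine (m := n.+1) _ _ Ap fm) // mulnC holn_refine.
Qed.

Lemma inv_nat_le (e : R) : 0 < e -> exists n, n.+1%:R^-1 <= e.
Proof.
move=> e0; exists (Num.trunc e^-1); rewrite invf_ple ?posrE // ltW //.
exact: truncnS_gt.
Qed.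

Lemma hol_potential p (phi : V -> G) e : 0 < e -> continuous p -> (forall t, A (p t)) ->
  (forall s t, dI s t <= e -> c (p s) (p t) = ((phi (p s))^-1 * phi (p t))%g) ->
  hol p = ((phi (p zero))^-1 * phi (p one))%g.
Proof.
move=> e0 cp Ap pe; have [n ne] := inv_nat_le e0.
have fp : fine dI p n.+1%:R^-1.
  move=> s t u st tu su; rewrite !pe ?(le_trans _ ne) //.
  by rewrite mulgA mulgK.
suff gen j : (j <= n.+1)%N ->
    iter_prod (fun j => c (p (time n.+1 j)) (p (time n.+1 j.+1))) j =
    ((phi (p zero))^-1 * phi (p (time n.+1 j)))%g.
  by rewrite (holE Ap fp) /holn gen // timen.
elim: j => [|j IH] jn; first by rewrite time0 mulVg.
rewrite /= IH ?(ltnW jn) // pe; first by rewrite mulgA mulgK.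
apply: le_trans ne; rewrite /dI !ival_time ?(ltnW jn) // -mulrBl -natr1 opprD addNKr.
by rewrite mulN1r normrN ger0_norm ?invr_ge0 //.
Qed.

(** Consecutive rows of a fine grid on the square have the same holonomy, and the side edges
    contribute 1 because the ends of the paths do not move. *)
Lemma hol_homotopic p q : path_homotopic A p q -> hol p = hol q.
Proof.
move=> [H [cH AH Hpq He]].
have [e e0 fe] := square_fine cH AH; have [n ne] := inv_nat_le e0.
have {fe ne e e0} fH := fine_le ne fe.
have dxx t : dI t t = 0 by rewrite /dI subrr normr0.
have row s : fine dI (fun t => H (t, s)) n.+1%:R^-1.
  by move=> t u v tu uv tv; apply: fH; rewrite /dII /= dxx ge_max ?tu ?uv ?tv /= invr_ge0 ler0n.
have dtime j : (j < n.+1)%N -> dI (time n.+1 j) (time n.+1 j.+1) <= n.+1%:R^-1.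
  move=> jn; rewrite /dI !ival_time ?(ltnW jn) // -mulrBl -natr1 opprD addNKr mulN1r normrN.
  by rewrite ger0_norm ?invr_ge0.
have rowE s : hol (fun t => H (t, s)) = holn (fun t => H (t, s)) n.+1.
  exact: (@holE (fun t => H (t, s))).
have -> : p = fun t => H (t, zero) by apply/funext => t; have [] := Hpq t.
have -> : q = fun t => H (t, one) by apply/funext => t; have [] := Hpq t.
suff gen k : (k <= n.+1)%N -> hol (fun t => H (t, zero)) = hol (fun t => H (t, time n.+1 k)).
  by rewrite (gen n.+1) // timen.
elim: k => [|k IH] kn; first by rewrite time0.
rewrite IH ?(ltnW kn) // !rowE {IH}.
set u := time n.+1 k; set v := time n.+1 k.+1; have uv : dI u v <= n.+1%:R^-1 by exact: dtime.
(* Each cell is crossed by two uses of the cocycle identity, one on either side of its diagonal. *)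
have strip j : (j <= n.+1)%N ->
    (iter_prod (fun j => c (H (time n.+1 j, u)) (H (time n.+1 j.+1, u))) j *
       c (H (time n.+1 j, u)) (H (time n.+1 j, v)) =
     c (H (zero, u)) (H (zero, v)) *
       iter_prod (fun j => c (H (time n.+1 j, v)) (H (time n.+1 j.+1, v))) j)%g.
  elim: j => [|j IH] jn; first by rewrite /= mul1g mulg1 time0.
  have tj := dtime _ jn; have n0 : 0 <= n.+1%:R^-1 :> R by rewrite invr_ge0 ler0n.
  rewrite /= mulgA -IH ?(ltnW jn) // -!mulgA; congr (_ * _)%g.
  rewrite !fH // /dII /= ?dxx ge_max ?tj ?uv ?n0 //.
have := strip n.+1 (leqnn _); rewrite timen // !(He _).1 !(He _).2 !c_id ?mulg1 ?mul1g //.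
- by rewrite -(Hpq zero).1; exact: AH.
- by rewrite -(Hpq one).1; exact: AH.
Qed.

Lemma hol_cat x y z p q : path_in A x y p -> path_in A y z q ->
  hol (path_cat p q) = (hol p * hol q)%g.
Proof.
move=> pA qA; have pqA := path_cat_in pA qA.
have [cp Ap p0 p1] := pA; have [cq Aq q0 q1] := qA; have [cr Ar _ _] := pqA.
have [e1 e10 f1] := path_fine cp Ap; have [e2 e20 f2] := path_fine cq Aq.
have [e3 e30 f3] := path_fine cr Ar.
have [n1 h1] := inv_nat_le e10; have [n2 h2] := inv_nat_le e20.
have [n3 h3] := inv_nat_le e30.
pose n := (n1 + n2 + n3)%N.
have le m : (m <= n)%N -> n.+1%:R^-1 <= m.+1%:R^-1 :> R.
  by move=> mn; rewrite lef_pV2 ?posrE ?ltr0n // ler_nat ltnS.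
have g1 : fine dI p n.+1%:R^-1.
  by apply: fine_le f1; apply: le_trans h1; apply: le; rewrite /n; lia.
have g2 : fine dI q n.+1%:R^-1.
  by apply: fine_le f2; apply: le_trans h2; apply: le; rewrite /n; lia.
(* [holE] speaks of [n.+1] intervals, so twice as many intervals have the index [n + n.+1]. *)
have E : (n + n.+1).+1 = (n.+1 + n.+1)%N by [].
have g3 : fine dI (path_cat p q) (n + n.+1).+1%:R^-1.
  apply: fine_le f3; apply: le_trans h3; apply: le_trans (le n3 _); last by rewrite /n; lia.
  by rewrite lef_pV2 ?posrE ?ltr0n // ler_nat; lia.
rewrite (holE Ap g1) (holE Aq g2) (holE Ar g3) E /holn iter_prodD.
have nR : 0 < n.+1%:R :> R by rewrite ltr0n.
have half j : (j <= n.+1)%N ->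
    path_cat p q (time (n.+1 + n.+1) j) = p (time n.+1 j).
  move=> jn; rewrite /path_cat ival_time //; last by lia.
  have jR : j%:R <= n.+1%:R :> R by rewrite ler_nat.
  have e : 2 * (j%:R / (n.+1 + n.+1)%:R) = j%:R / n.+1%:R :> R.
    by rewrite natrD; field; have := ler0n R n; move=> ?; apply/andP; split; rewrite gt_eqF //; lra.
  rewrite e ifT // -(ler_pM2l (x := 2)) // e mulfV // ler_pdivrMr // mul1r //.
have half' j : (j <= n.+1)%N ->
    path_cat p q (time (n.+1 + n.+1) (n.+1 + j)) = q (time n.+1 j).
  move=> jn; case: j jn => [|j] jn.
    by rewrite addn0 half // timen // time0 p1 q0.
  rewrite /path_cat ival_time //; last by lia.
  have e : 2 * ((n.+1 + j.+1)%:R / (n.+1 + n.+1)%:R) = 1 + j.+1%:R / n.+1%:R :> R.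
    by rewrite !natrD; field; have := ler0n R n; move=> ?; apply/andP; split; rewrite gt_eqF //; lra.
  rewrite e ifF; first by congr (q (clamp _)); ring.
  apply/negbTE; rewrite -ltNge -(ltr_pM2l (x := 2)) // e mulfV // ltrDl divr_gt0 //.
congr (_ * _)%g; apply: eq_iter_prod => j jn; first by rewrite !half // ltnW.
by rewrite -addnS !half' // ltnW.
Qed.

End Holonomy.

(** * The plane without finitely many points *)

Section FreeGroupEval.
Context (k : nat).
Local Open Scope group_scope.
Local Notation F := (free_group k).

Definition letter_eval (G : groupType) (f : 'I_k -> G) (l : letter k) : G :=
  if l.2 then f l.1 else (f l.1)^-1.

Definition word_eval (G : groupType) (f : 'I_k -> G) (u : seq (letter k)) : G :=
  foldr (fun l g => letter_eval f l * g) 1 u.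

Definition free_eval (G : groupType) (f : 'I_k -> G) (w : F) : G := word_eval f (val w).

Definition free_gen (i : 'I_k) : F := exist (fun w => reduced w) [:: (i, true)] isT.

Lemma word_eval_red_cons (G : groupType) (f : 'I_k -> G) l u :
  word_eval f (red_cons l u) = letter_eval f l * word_eval f u.
Proof.
case: u => [|m u] //=; case: eqVneq => // ->.
rewrite mulgA /letter_eval /=; case: l.2 => /=; first by rewrite mulgV mul1g.
by rewrite mulVg mul1g.
Qed.

Lemma free_evalM (G : groupType) (f : 'I_k -> G) :
  {morph free_eval f : u v / u * v}.
Proof.
move=> u v; rewrite /free_eval /=; elim: (val u) => [|l w IH] /=; first by rewrite mul1g.
by rewrite word_eval_red_cons IH mulgA.
Qed.

Lemma free_eval_gen (G : groupType) (f : 'I_k -> G) i : free_eval f (free_gen i) = f i.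
Proof. by rewrite /free_eval /= mulg1. Qed.

Lemma free_eval_id w : free_eval free_gen w = w.
Proof.
apply: val_inj; rewrite -[RHS](word_mul1 (valP w)) /free_eval.
elim: (val w) => //= l u IH; rewrite -IH.
by case: l => i [].
Qed.

Lemma morph_free_eval (G H : groupType) (phi : G -> H) (f : 'I_k -> G) w :
  {morph phi : x y / x * y} -> phi (free_eval f w) = free_eval (fun i => phi (f i)) w.
Proof.
move=> phiM; have phi1 : phi 1 = 1.
  by apply: (mulgI (phi 1)); rewrite -phiM !mulg1.
have phiV x : phi x^-1 = (phi x)^-1.
  by apply: (mulgI (phi x)); rewrite -phiM !mulgV.
rewrite /free_eval; elim: (val w) => //= l u IH; rewrite phiM IH; congr (_ * _).
by rewrite /letter_eval; case: l.2; rewrite ?phiV.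
Qed.

Lemma eq_free_eval (G : groupType) (f g : 'I_k -> G) w :
  f =1 g -> free_eval f w = free_eval g w.
Proof. by move=> fg; congr free_eval; apply/funext. Qed.

End FreeGroupEval.

Lemma open_forall (K : finType) (T : topologicalType) (P : K -> set T) :
  (forall i, open (P i)) -> open [set z | forall i, P i z].
Proof.
move=> oP; have -> : [set z | forall i, P i z] = [set z | forall i, i \in enum K -> P i z].
  by apply/seteqP; split=> z Pz i; [move=> _; exact: Pz|apply: Pz; rewrite mem_enum].
elim: (enum K) => [|j l IH].
  by rewrite (_ : [set z | _] = setT); [exact: openT|apply/seteqP].
rewrite (_ : [set z | _] = P j `&` [set z | forall i, i \in l -> P i z]).
  exact: openI.
apply/seteqP; split=> z /=.
  by move=> h; split=> [|i il]; apply: h; rewrite inE ?eqxx // il orbT.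
by move=> -[h1 h2] i; rewrite inE => /orP[/eqP->//|]; exact: h2.
Qed.

Lemma lerp_lt {R : realType} (u x y w : R) :
  0 <= u <= 1 -> x < w -> y < w -> (1 - u) * x + u * y < w.
Proof.
move=> /andP[u0 u1] xw yw; have [xy|yx] := leP x y.
  have h : 0 <= (1 - u) * (y - x) by rewrite mulr_ge0 // subr_ge0.
  by nra.
have h : 0 <= u * (x - y) by rewrite mulr_ge0 // subr_ge0 ltW.
by nra.
Qed.

Lemma lerp_gt {R : realType} (u x y w : R) :
  0 <= u <= 1 -> w < x -> w < y -> w < (1 - u) * x + u * y.
Proof.
move=> u01 wx wy; rewrite -ltrN2 opprD -!mulrN; apply: lerp_lt => //; by rewrite ltrN2.
Qed.

(** * Two slit planes and the crossing cocycle *)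

Section PuncturedPlane.
Context {R : realType} (k : nat).
Local Notation I := (unit_interval R).
Local Notation plane := (@plane R).
Variable a : 'I_k -> plane.
Hypothesis ainj : forall i j, (a i).1 = (a j).1 -> i = j.

Definition punctured : set plane := [set m | forall i, m != a i].

(* The plane minus the closed vertical rays from the a i, going up for
   sg = 1 and down for sg = -1. *)
Definition slit (sg : R) : set plane :=
  [set m | forall i, m.1 = (a i).1 -> sg * (m.2 - (a i).2) < 0].

Definition sign_of (b : bool) : R := if b then 1 else -1.
Local Notation U b := (slit (sign_of b)).

Lemma sign_sqr b : sign_of b * sign_of b = 1.
Proof. by case: b; rewrite /sign_of ?mulrNN mulr1. Qed.

Lemma slit_punctured b : U b `<=` punctured.
Proof.
move=> m mU i; apply/eqP => mi; have := mU i; rewrite mi subrr mulr0 ltxx.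
by move=> /(_ erefl).
Qed.

Lemma punctured_slit m : punctured m -> exists b, U b m.
Proof.
move=> mP; have [[i mi]|no] := pselect (exists i, m.1 = (a i).1); last first.
  by exists true => i mi; case: no; exists i.
have uniq j : m.1 = (a j).1 -> j = i by move=> mj; apply: ainj; rewrite -mi -mj.
have ne : m.2 != (a i).2.
  by apply: contraNneq (mP i) => e; case: (m) (a i) mi e => ? ? [? ?] /= -> ->.
have [lt|gt|/eqP] := ltgtP m.2 (a i).2; last by rewrite (negbTE ne).
  by exists true => j /uniq ->; rewrite mul1r subr_lt0.
by exists false => j /uniq ->; rewrite mulN1r oppr_lt0 subr_gt0.
Qed.

Lemma slit_open b : open (U b).
Proof.
apply: (@open_forall _ _ (fun i => [set m : plane | m.1 = (a i).1 -> _ * (m.2 - (a i).2) < 0])) => i.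
have c1 : continuous (fun m : plane => m.1) by exact: fst_continuous.
have c2 : continuous (fun m : plane => m.2) by exact: snd_continuous.
rewrite (_ : [set m | _] = [set m : plane | 0 < `|m.1 - (a i).1|] `|`
    [set m : plane | sign_of b * (m.2 - (a i).2) < 0]).
  apply: openU.
    apply: (@open_comp plane R (fun m => `|m.1 - (a i).1|) [set x | 0 < x]); last exact: open_gt.
    move=> m _; apply: (@continuous_norm R plane R^o (fun m => m.1 - (a i).1)).
    by apply: Defs.sub_continuous => //; exact: continuous_cst.
  apply: (@open_comp plane R (fun m => sign_of b * (m.2 - (a i).2)) [set x | x < 0]); last exact: open_lt.
  move=> m _; apply: Defs.mul_continuous; first exact: continuous_cst.
  by apply: Defs.sub_continuous => //; exact: continuous_cst.
apply/seteqP; split=> m /=.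
  move=> h; have [e|e] := eqVneq m.1 (a i).1; first by right; exact: h.
  by left; rewrite normr_gt0 subr_eq0.
by move=> [|//]; rewrite normr_gt0 subr_eq0 => /eqP.
Qed.

Lemma punctured_open : open punctured.
Proof.
rewrite (_ : punctured = U true `|` U false).
  by apply: openU; exact: slit_open.
apply/seteqP; split=> [m /punctured_slit[[]]|m []]; [by left|by right| |]; exact: slit_punctured.
Qed.

Lemma punctured_connected : @path_connected R plane punctured.
Proof.
have -> : punctured = [set u | u \notin codom a].
  apply/seteqP; split=> m /= mP.
    by apply/negP => /codomP[i mi]; have := mP i; rewrite mi eqxx.
  by move=> i; apply: contraNneq mP => ->; exact: codom_f.
exact: punctured_plane_connected.
Qed.

(** Slides points away from the rays of the slit plane [b]: downwards when the rays go up, upwards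
    when they go down. *)
Definition shift (b : bool) (h : R) (m : plane) : plane := (m.1, m.2 - sign_of b * h).

Lemma shift_slit b h m : 0 <= h -> U b m -> U b (shift b h m).
Proof.
move=> h0 mU i /mU /=; have := sign_sqr b; move: (sign_of b) => sg sg2.
have -> : sg * (m.2 - sg * h - (a i).2) = sg * (m.2 - (a i).2) - sg * sg * h by ring.
by rewrite sg2; lra.
Qed.

Definition far_side b : set plane := [set m | forall i, sign_of b * (m.2 - (a i).2) < 0].

Lemma far_slit b : far_side b `<=` U b.
Proof. by move=> m h i _; exact: h. Qed.

Lemma far_convex b : @convex_set R plane (far_side b).
Proof.
move=> u v t uF vF /andP[t0 t1] i /=.
have := uF i; have := vF i; move: (sign_of b) => sg.
rewrite /GRing.scale /=.
have -> : sg * ((1 - t) * u.2 + t * v.2 - (a i).2) =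
  (1 - t) * (sg * (u.2 - (a i).2)) + t * (sg * (v.2 - (a i).2)) by ring.
by move: (sg * _) (sg * _) => x y; nra.
Qed.

Lemma far_exists b (p : I -> plane) : continuous p ->
  exists2 h, 0 <= h & forall t, far_side b (shift b h (p t)).
Proof.
move=> cp.
(* The uniform lemmas produce small positive numbers, so the bound is stated as [x * e < 1] and [M]
   is the inverse of [e]. *)
have [M M0 pM] : exists2 M, 0 < M & forall i t, sign_of b * ((p t).2 - (a i).2) < M.
  have [|i e e' /andP[e'0 ee'] h t|e e0 he] := @fin_uniform R 'I_k
     (fun i e => forall t, sign_of b * ((p t).2 - (a i).2) * e < 1).
  - move=> i; have [|e e0 he] := @compact_uniform R I setT
      (fun e t => sign_of b * ((p t).2 - (a i).2) * e < 1) unit_interval_compact; last first.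
      by exists e => // t; exact: he.
    move=> t _; set g := fun t => sign_of b * ((p t).2 - (a i).2).
    have cg : continuous g.
      apply: Defs.mul_continuous; first exact: continuous_cst.
      apply: Defs.sub_continuous; last exact: continuous_cst.
      exact: continuous_comp2 cp (@snd_continuous _ _).
    exists [set s | g s < `|g t| + 1], ((`|g t| + 1)^-1).
      by rewrite invr_gt0 ltr_wpDl.
    split.
      apply: nbhs_lt => //; first exact: continuous_cst.
      by rewrite (le_lt_trans (ler_norm _)) // ltrDl.
    move=> e s /andP[e0 eg] /= gs; rewrite -/(g s).
    have p1 : 0 < `|g t| + 1 by rewrite ltr_wpDl.
    apply: lt_trans (_ : (`|g t| + 1) * e < 1); first by rewrite ltr_pM2r.
    by rewrite -ltr_pdivlMl // mulr1.
  - have := h t; have [x0|x0] := leP (sign_of b * ((p t).2 - (a i).2)) 0; move: (sign_of b * _) x0 => x; nra.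
  exists e^-1; first by rewrite invr_gt0.
  by move=> i t; have := he i t; rewrite -ltr_pdivlMr // mul1r.
exists M; first exact: ltW.
move=> t i; rewrite /far_side /shift /=; have := pM i t; have := sign_sqr b; move: (sign_of b) => sg sg2 /=.
have -> : sg * ((p t).2 - sg * M - (a i).2) = sg * ((p t).2 - (a i).2) - sg * sg * M by ring.
by rewrite sg2; lra.
Qed.

Lemma far_mono b h h' m : h <= h' -> far_side b (shift b h m) -> far_side b (shift b h' m).
Proof.
move=> hh' mF i; have := mF i; rewrite /shift /=.
have := sign_sqr b; move: (sign_of b) => sg sg2.
have -> : sg * (m.2 - sg * h - (a i).2) = sg * (m.2 - (a i).2) - sg * sg * h by ring.
have -> : sg * (m.2 - sg * h' - (a i).2) = sg * (m.2 - (a i).2) - sg * sg * h' by ring.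
by rewrite sg2; lra.
Qed.

Variable b0 : punctured.
Local Notation base := (set_val b0).
Hypothesis base_left : forall i, base.1 < (a i).1.
Local Notation pc := (path_class b0).
Local Notation Pc := punctured_connected.
Local Open Scope group_scope.

Lemma path_in_sub (T : topologicalType) (A A' : set T) x y (p : I -> T) :
  A `<=` A' -> path_in A x y p -> path_in A' x y p.
Proof. by move=> AA' [? h ? ?]; split=> // t; apply: AA'; exact: h. Qed.

Lemma slit_path b x y (p : I -> plane) : path_in (U b) x y p -> path_in punctured x y p.
Proof. by apply: path_in_sub; exact: slit_punctured. Qed.

Lemma shift_continuous b (X : topologicalType) (h : X -> R) (p : X -> plane) :
  continuous h -> continuous p -> continuous (fun x => shift b (h x) (p x)).
Proof.
move=> ch cp; apply: continuous_pair; first exact: continuous_comp2 cp (@fst_continuous _ _).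
apply: (@Defs.sub_continuous R X); first exact: continuous_comp2 cp (@snd_continuous _ _).
by apply: (@Defs.mul_continuous R X (fun=> sign_of b)) => //; exact: continuous_cst.
Qed.

Lemma shift0 b m : shift b 0 m = m.
Proof. by rewrite /shift mulr0 subr0; case: m. Qed.

(** The effect of simple connectedness of a slit plane: both paths slide away from the rays into the
    convex [far_side], where a straight-line homotopy joins them. The two squares swept out share
    their vertical edges, which cancel. *)
Lemma slit_path_class b x y (p q : I -> plane) :
  path_in (U b) x y p -> path_in (U b) x y q -> pc p = pc q.
Proof.
move=> pU qU; have [cp Up p0 p1] := pU; have [cq Uq q0 q1] := qU.
have [h1 h10 pF] := far_exists b cp; have [h2 h20 qF] := far_exists b cq.
pose h := Num.max h1 h2.
have h0 : (0 <= h)%R by rewrite le_max h10.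
have {}pF t : far_side b (shift b h (p t)) by apply: far_mono (pF t); rewrite le_max lexx.
have {}qF t : far_side b (shift b h (q t)) by apply: far_mono (qF t); rewrite le_max lexx orbT.
have sq (u : I -> plane) : continuous u -> (forall t, U b (u t)) ->
    pc u * pc (fun s => shift b (h * ival s)%R (u one)) =
    pc (fun s => shift b (h * ival s)%R (u zero)) * pc (fun t => shift b h (u t)).
  move=> cu Uu; pose H (z : I * I) := shift b (h * ival z.2)%R (u z.1).
  have := @path_class_square R plane _ b0 Pc H.
  have -> : (fun t => H (t, zero)) = u.
    by apply/funext => t; rewrite /H /= ival0 mulr0 shift0.
  have -> : (fun t => H (t, one)) = (fun t => shift b h (u t)).
    by apply/funext => t; rewrite /H /= ival1 mulr1.
  apply.
    apply: shift_continuous; last exact: continuous_comp2 (@fst_continuous _ _) cu.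
    apply: Defs.mul_continuous; first exact: continuous_cst.
    exact: ival_comp_continuous (@snd_continuous _ _).
  move=> z; apply: (@slit_punctured b); apply: shift_slit => //.
  by rewrite mulr_ge0 ?ival_ge0.
have := sq p cp Up; have := sq q cq Uq; rewrite p0 p1 q0 q1.
have -> : pc (fun t => shift b h (p t)) = pc (fun t => shift b h (q t)).
  apply: (@path_class_convex R plane _ b0 Pc plane (far_side b) id).
  - exact: far_convex.
  - by move=> m; exact: cvg_id.
  - by move=> m /far_slit/slit_punctured.
  - by apply: shift_continuous => //; exact: continuous_cst.
  - by apply: shift_continuous => //; exact: continuous_cst.
  - exact: pF.
  - exact: qF.
  - by rewrite p0 q0.
  - by rewrite p1 q1.
by move=> <- /mulIg.
Qed.

Definition segment_path (x y : plane) (t : I) : plane := ((1 - ival t) *: x + ival t *: y)%R.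

Lemma segment_path_in (C : set plane) x y :
  (forall t, C (segment_path x y t)) -> path_in C x y (segment_path x y).
Proof.
move=> xyC; split=> //.
- apply: continuous_lincomb; [exact: ival_continuous|exact: continuous_cst|exact: continuous_cst].
- by rewrite /segment_path ival0 subr0 scale1r scale0r addr0.
- by rewrite /segment_path ival1 subrr scale1r scale0r add0r.
Qed.

Lemma slit_connected b : @path_connected R plane (U b).
Proof.
move=> x y xU yU.
have [h1 h10 xF] := far_exists b (@continuous_cst I plane x).
have [h2 h20 yF] := far_exists b (@continuous_cst I plane y).
pose h := Num.max h1 h2; have h0 : (0 <= h)%R by rewrite le_max h10.
have {}xF : far_side b (shift b h x) by apply: far_mono (xF zero); rewrite le_max lexx.
have {}yF : far_side b (shift b h y) by apply: far_mono (yF zero); rewrite le_max lexx orbT.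
have down z : U b z -> path_in (U b) z (shift b h z) (fun s => shift b (h * ival s)%R z).
  move=> zU; split.
  - apply: shift_continuous; last exact: continuous_cst.
    by apply: Defs.mul_continuous; [exact: continuous_cst|exact: ival_continuous].
  - by move=> t; apply: shift_slit => //; rewrite mulr_ge0 ?ival_ge0.
  - by rewrite ival0 mulr0 shift0.
  - by rewrite ival1 mulr1.
have mid : path_in (U b) (shift b h x) (shift b h y) (segment_path (shift b h x) (shift b h y)).
  apply: segment_path_in => t; apply: far_slit.
  by apply: far_convex => //; rewrite ival_ge0 ival_le1.
exists (path_cat (fun s => shift b (h * ival s)%R x) (path_cat
  (segment_path (shift b h x) (shift b h y)) (path_rev (fun s => shift b (h * ival s)%R y)))).
exact: path_cat_in (down _ xU) (path_cat_in mid (path_rev_in (down _ yU))).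
Qed.

Lemma slit_base b : U b base.
Proof. by move=> i e; have := base_left i; rewrite e ltxx. Qed.

Lemma slit_tether_subproof b z : exists p : I -> plane, U b z -> path_in (U b) base z p.
Proof.
have [zU|zU] := pselect (U b z); last by exists (fun=> z).
by have [p pU] := slit_connected (@slit_base b) zU; exists p.
Qed.

Definition slit_tether b z : I -> plane := sval (cid (slit_tether_subproof b z)).

Lemma slit_tether_in b z : U b z -> path_in (U b) base z (slit_tether b z).
Proof. by rewrite /slit_tether; case: cid. Qed.

Definition slit_class b z : pi1 R b0 := pc (slit_tether b z).

Lemma slit_classE b z z' p : path_in (U b) z z' p ->
  pc p = (slit_class b z)^-1 * slit_class b z'.
Proof.
move=> pU; have [_ Up p0 p1] := pU.
have zt : path_in (U b) base z (slit_tether b z) by apply: slit_tether_in; rewrite -p0.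
have zt' : path_in (U b) base z' (slit_tether b z') by apply: slit_tether_in; rewrite -p1.
apply: (mulgI (slit_class b z)); rewrite mulVKg -(path_class_cat b0 Pc (slit_path zt) (slit_path pU)).
exact: slit_path_class (path_cat_in zt pU) zt'.
Qed.

Lemma slit_class_base b : slit_class b base = 1.
Proof.
have bU := @slit_base b.
rewrite -(path_class_base b0); apply: (slit_path_class (slit_tether_in bU)).
exact: cst_path_in.
Qed.

(** The loop that goes to [z] above the punctures and comes back below them, the price of changing
    slit plane at [z]. *)
Definition slit_jump z : pi1 R b0 := slit_class false z * (slit_class true z)^-1.

Lemma off_ray z : U true z -> U false z -> forall i, z.1 != (a i).1.
Proof.
move=> zT zF i; apply/eqP => zi; have := zT i zi; have := zF i zi.
by rewrite /sign_of mulN1r mul1r oppr_lt0 => /lt_trans/[apply]; rewrite ltxx.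
Qed.

(** The segment from [z] to [z'] crosses no vertical line through a puncture, so it lies in both
    slit planes and changes both classes by the same right factor, which cancels. *)
Lemma slit_jump_strip z z' : U true z -> U false z -> U true z' -> U false z' ->
  (forall i, ((a i).1 < z.1) = ((a i).1 < z'.1)) -> slit_jump z = slit_jump z'.
Proof.
move=> zT zF zT' zF' zz'.
have seg b : path_in (U b) z z' (segment_path z z').
  apply: segment_path_in => t i /= e; exfalso.
  have := off_ray zT zF i; have := off_ray zT' zF' i; have := zz' i.
  move: e; rewrite /GRing.scale /=; have := ival_ge0 t; have := ival_le1 t.
  move: (ival t) (z.1) (z'.1) ((a i).1) => u x y w u1 u0 e xy.
  rewrite !neq_lt => /orP[yw|wy] /orP[xw|wx].
  - by have := @lerp_lt R u x y w; rewrite u0 u1 e ltxx => /(_ isT xw yw).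
  - by move: xy; rewrite wx => /esym; lra.
  - by move: xy; rewrite wy; lra.
  - by have := @lerp_gt R u x y w; rewrite u0 u1 e ltxx => /(_ isT wx wy).
rewrite /slit_jump.
have := slit_classE (seg true); rewrite (slit_classE (seg false)) => e.
have -> : slit_class true z' = slit_class true z * ((slit_class true z)^-1 * slit_class true z').
  by rewrite mulVKg.
by rewrite -e invgM invgM invgK mulgA mulVKg.
Qed.

(** Names the vertical strip at abscissa [x] by the puncture on its left edge; [None] is the
    leftmost strip, which contains the base point. *)
Definition left_puncture (x : R) : option 'I_k :=
  [pick i | ((a i).1 < x) && [forall j, ((a j).1 < x) ==> ((a j).1 <= (a i).1)]].

Definition strip_gen (x : R) : free_group k :=
  if left_puncture x is Some i then free_gen i else 1.

Lemma left_puncture_some x i : left_puncture x = Some i ->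
  forall j, ((a j).1 < x) = ((a j).1 <= (a i).1).
Proof.
rewrite /left_puncture; case: pickP => // i' /andP[ix /forallP h] [<-] j.
by apply/idP/idP => [jx|ji]; [exact: (implyP (h j))|exact: le_lt_trans ji ix].
Qed.

Lemma left_puncture_none x : left_puncture x = None -> forall j, ((a j).1 < x) = false.
Proof.
rewrite /left_puncture; case: pickP => // h _ j; apply/negbTE/negP => jx.
have [i ix imax] := @Order.TotalTheory.arg_maxP _ _ 'I_k j (fun i => (a i).1 < x) (fun i => (a i).1) jx.
have /negP := h i; apply; rewrite ix /=; apply/forallP => l; apply/implyP.
exact: imax.
Qed.

Lemma left_puncture_eq x x' : (forall i, ((a i).1 < x) = ((a i).1 < x')) ->
  left_puncture x = left_puncture x'.
Proof.
move=> xx'; apply: eq_pick => i; rewrite xx'; congr (_ && _).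
by apply: eq_forallb => j; rewrite xx'.
Qed.

Lemma left_puncture_of i x : (forall j, ((a j).1 < x) = ((a j).1 <= (a i).1)) ->
  left_puncture x = Some i.
Proof.
move=> h; rewrite /left_puncture; case: pickP => [i' /andP[ix /forallP hi]|/(_ i)].
  congr Some; apply: ainj; apply/eqP; rewrite eq_le -h ix /=.
  by apply: (implyP (hi i)); rewrite h.
by rewrite h lexx /= => /forallP[] j; rewrite h; apply/implyP.
Qed.

Lemma right_point_subproof i : exists z : plane,
  (forall j, z.1 != (a j).1) /\ forall j, ((a j).1 < z.1) = ((a j).1 <= (a i).1).
Proof.
have [j|j e e' /andP[e'0 ee'] h|e e0 he] := @fin_uniform R 'I_k
    (fun j e => (a i).1 < (a j).1 -> (a i).1 + e < (a j).1)%R.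
- have [ij|ji] := ltP (a i).1 (a j).1; last by exists 1%R.
  by exists (((a j).1 - (a i).1) / 2)%R => [|_]; [rewrite divr_gt0 // subr_gt0|lra].
- by move=> ij; apply: le_lt_trans (h ij); rewrite lerD2l.
exists (((a i).1 + e)%R, 0%R); split=> j /=; have [ij|ji] := ltP (a i).1 (a j).1.
- by rewrite lt_eqF // he.
- by rewrite gt_eqF // (le_lt_trans ji) // ltrDl.
- by apply/negbTE; rewrite -leNgt ltW // he.
- by rewrite (le_lt_trans ji) // ltrDl.
Qed.

Definition right_point i : plane := sval (cid (right_point_subproof i)).

Lemma right_point_off i j : (right_point i).1 != (a j).1.
Proof. by rewrite /right_point; case: cid => z []. Qed.

Lemma right_point_left i : left_puncture (right_point i).1 = Some i.
Proof. by apply: left_puncture_of; rewrite /right_point; case: cid => z []. Qed.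

Lemma right_point_slit b i : U b (right_point i).
Proof. by move=> j /eqP; rewrite (negbTE (right_point_off i j)). Qed.

(** This loop goes round every puncture with abscissa at most that of [a i], not round [a i] alone.
    With these generators each strip corresponds to a single letter. *)
Definition loop_gen i : pi1 R b0 := slit_jump (right_point i).

Lemma slit_jumpE z : U true z -> U false z -> slit_jump z = free_eval loop_gen (strip_gen z.1).
Proof.
move=> zT zF; rewrite /strip_gen; case E: left_puncture => [i|].
  rewrite free_eval_gen; apply: slit_jump_strip => // [||j]; try exact: right_point_slit.
  by rewrite (left_puncture_some E) (left_puncture_some (right_point_left i)).
rewrite /free_eval /= (@slit_jump_strip z base) //; try exact: slit_base.
  by rewrite /slit_jump !slit_class_base mulgV.
by move=> j; rewrite (left_puncture_none E) ltNge ltW.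
Qed.

Lemma free_eval_inv (w : free_group k) : free_eval loop_gen w^-1 = (free_eval loop_gen w)^-1.
Proof.
apply: (mulgI (free_eval loop_gen w)); rewrite mulgV -free_evalM mulgV //.
Qed.

Lemma slit_lebesgue (p : I -> plane) : continuous p -> (forall t, punctured (p t)) ->
  exists2 e, (0 < e)%R & forall s, exists b, forall v, (`|v - p s| < e)%R -> U b v.
Proof.
move=> cp Pp.
have [|e e0 he] := @compact_uniform R I setT
    (fun e s => exists b, forall v, (`|v - p s| < e)%R -> U b v) unit_interval_compact.
  move=> s _; have [b bU] := punctured_slit (Pp s).
  have /nbhs_ballP[e /= e0 he] : nbhs (p s) (U b).
    by apply: open_nbhs_nbhs; split=> //; exact: slit_open.
  exists [set t | (`|p t - p s| < e / 2)%R], (e / 2)%R; first by rewrite divr_gt0.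
  split.
    apply: nbhs_lt; [|exact: continuous_cst|by rewrite subrr normr0 divr_gt0].
    by apply: continuous_norm; apply: continuousB_fun => //; exact: continuous_cst.
  move=> e' t /andP[_ e'e] /= ts; exists b => v vt; apply: he.
  rewrite -ball_normE /= distrC.
  have : (`|v - p s| <= `|v - p t| + `|p t - p s|)%R by exact: ler_distD.
  by move=> ?; lra.
by exists e => // s; exact: he.
Qed.

Lemma path_modulus (p : I -> plane) (e : R) : continuous p -> (0 < e)%R ->
  exists2 d, (0 < d)%R & forall s t, (dI s t <= d)%R -> (`|p s - p t| < e)%R.
Proof.
move=> cp e0.
have [d d0 dP] := @uniform_modulus R I plane (fun z => p z.2) e
  unit_interval_compact (continuous_comp2 (@snd_continuous _ _) cp) e0.
by exists d => // s t; exact: (dP zero).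
Qed.

(** The loop is cut into pieces lying in one slit plane each. The class of an initial part is a word
    times a [slit_class]; a piece changes only the second factor, and a change of slit plane costs a
    [slit_jump], which is a generator, its inverse or 1. *)
Lemma loop_gen_generate (g : pi1 R b0) : exists w, free_eval loop_gen w = g.
Proof.
have [p pP <-] := path_class_surj g; have [cp Pp p0 p1] := pP.
have [cf fP pE] := path_extension pP; set f := p \o clamp in cf fP pE.
have [e e0 pe] := slit_lebesgue cp Pp.
have [d d0 pd] := path_modulus cp e0; have [n nd] := inv_nat_le d0.
have nR : (0 < n.+1%:R :> R)%R by rewrite ltr0n.
pose T j : R := (j%:R / n.+1%:R)%R.
have T01 j : (j <= n.+1)%N -> (0 <= T j <= 1)%R.
  by move=> jn; rewrite divr_ge0 //= ler_pdivrMr // mul1r ler_nat.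
have TS j : T j.+1 = (T j + n.+1%:R^-1)%R by rewrite /T -natr1 mulrDl mul1r.
have T0 : T 0%N = 0%R by rewrite /T mul0r.
have Tn : T n.+1 = 1%R by rewrite /T divff ?gt_eqF.
(* The claim covers every slit plane containing the cut point, so the induction hypothesis can be
   taken in the one that contains the next piece. *)
suff gen j : (j <= n.+1)%N -> forall b, U b (f (T j)) ->
    exists w, pc (subpath f 0 (T j)) = free_eval loop_gen w * slit_class b (f (T j)).
  have f1 : f (T n.+1) = base by rewrite Tn /f /= clamp1.
  have [|w] := gen n.+1 (leqnn _) true; first by rewrite f1; exact: slit_base.
  by rewrite f1 slit_class_base mulg1 Tn -pE => ->; exists w.
elim: j => [|j IH] jn b fb.
  exists 1; rewrite T0 /free_eval /= mul1g /f /= clamp0 p0 slit_class_base.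
  have -> : subpath (p \o clamp) 0 0 = fun=> base.
    by apply/funext => t; rewrite /subpath subrr mul0r add0r /= clamp0 p0.
  exact: path_class_base.
have [c cU] := pe (clamp (T j)).
have step u : (T j <= u <= T j.+1)%R -> U c (f u).
  move=> /andP[u1 u2]; have /andP[? ?] := T01 _ jn; have /andP[? ?] := T01 _ (ltnW jn).
  apply: cU; apply: pd; apply: le_trans nd; rewrite /dI !ival_clamp; [|lra|lra].
  by rewrite ger0_norm ?subr_ge0 // lerBlDl -TS.
have Tle : (T j <= T j.+1)%R by rewrite TS lerDl invr_ge0.
have [|w wE] := IH (ltnW jn) c; first by apply: step; rewrite lexx.
have sU : path_in (U c) (f (T j)) (f (T j.+1)) (subpath f (T j) (T j.+1)).
  have [? _ ? ?] := @subpath_in R plane punctured f (T j) (T j.+1) cf fP.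
  split=> // t; apply: step; have := ival_ge0 t; have := ival_le1 t.
  by move: (ival t) (T j) (T j.+1) Tle => u x y xy u1 u0; apply/andP; split; nra.
have cE : pc (subpath f 0 (T j.+1)) = free_eval loop_gen w * slit_class c (f (T j.+1)).
  rewrite -(path_class_subpath b0 Pc 0 (T j) (T j.+1) cf fP) wE (slit_classE sU).
  by rewrite -mulgA mulVKg.
have [bc|bc] := eqVneq b c; first by exists w; rewrite bc.
have Uc : U c (f (T j.+1)) by apply: step; rewrite Tle lexx.
have Tb : U true (f (T j.+1)) by case: (b) (c) bc fb Uc => [] [].
have Fb : U false (f (T j.+1)) by case: (b) (c) bc fb Uc => [] [].
have J := slit_jumpE Tb Fb; set v := strip_gen _ in J.
exists (w * (if b then v else v^-1)); rewrite cE free_evalM -mulgA; congr (_ * _).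
case: (b) (c) bc {fb Uc cU step sU cE wE} => [] [] // _.
  by rewrite -J /slit_jump mulgVK.
by rewrite free_eval_inv -J /slit_jump invgM invgK mulgVK.
Qed.

(** Trivial in the plane [U true] and the coboundary of [strip_gen] in [U false]. Only segments
    contained in one of the two planes matter, since the holonomy uses short ones. *)
Definition crossing (m m' : plane) : free_group k :=
  if pselect (forall t, U true (segment_path m m' t)) then 1
  else (strip_gen m.1)^-1 * strip_gen m'.1.

(** The two recipes for [crossing] agree on the overlap: by the intermediate value property, a
    segment in both slit planes stays in one strip. *)
Lemma strip_gen_segment m m' : (forall b t, U b (segment_path m m' t)) ->
  strip_gen m.1 = strip_gen m'.1.
Proof.
move=> h; rewrite /strip_gen (left_puncture_eq (x' := m'.1)) // => i.
have no t : ((1 - ival t) * m.1 + ival t * m'.1)%R != (a i).1.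
  exact: (off_ray (h true t) (h false t) i).
have key (x y z : R) : (z < x)%R -> (y <= z)%R ->
    exists t : I, ((1 - ival t) * x + ival t * y = z)%R.
  move=> zx yz; have xy : (0 < x - y)%R by rewrite subr_gt0 (le_lt_trans yz).
  exists (clamp ((x - z) / (x - y))%R); rewrite ival_clamp.
    by field; rewrite gt_eqF.
  apply/andP; split; first by apply: divr_ge0; rewrite ltW // subr_gt0.
  by rewrite ler_pdivrMr // mul1r lerD2l lerN2.
apply/idP/idP => im; rewrite ltNge; apply/negP => mi.
  by have [t e] := key _ _ _ im mi; have := no t; rewrite e eqxx.
have [t e] := key _ _ _ im mi; have := no (clamp (1 - ival t)%R).
rewrite ival_clamp; last by have := ival_ge0 t; have := ival_le1 t; move=> ? ?; lra.
by rewrite subKr addrC e eqxx.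
Qed.

Lemma crossing_true m m' : (forall t, U true (segment_path m m' t)) -> crossing m m' = 1.
Proof. by move=> h; rewrite /crossing; case: pselect. Qed.

Lemma crossing_false m m' : (forall t, U false (segment_path m m' t)) ->
  crossing m m' = (strip_gen m.1)^-1 * strip_gen m'.1.
Proof.
move=> h; rewrite /crossing; case: pselect => // h'.
by rewrite (@strip_gen_segment m m') ?mulVg // => -[].
Qed.

Lemma crossing_local z : punctured z -> exists2 e, (0 < e)%R & forall u v w : plane,
  (`|u - z| < e)%R -> (`|v - z| < e)%R -> (`|w - z| < e)%R ->
  crossing u v * crossing v w = crossing u w.
Proof.
move=> /punctured_slit[b bU].
have /nbhs_ballP[e /= e0 he] : nbhs z (U b).
  by apply: open_nbhs_nbhs; split=> //; exact: slit_open.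
have seg u v : (`|u - z| < e)%R -> (`|v - z| < e)%R -> forall t, U b (segment_path u v t).
  move=> ue ve t; apply: he; rewrite -ball_normE /= distrC.
  by apply: (@ball_convex R plane z e) => //; rewrite ival_ge0 ival_le1.
exists e => // u v w ue ve we; case: (b) seg => seg.
  by rewrite !crossing_true ?mulg1 //; exact: seg.
rewrite !crossing_false; [|exact: seg..].
by rewrite mulgA mulgK.
Qed.

Lemma slit_path_segments b x y (p : I -> plane) : path_in (U b) x y p ->
  exists2 e, (0 < e)%R & forall s t, (dI s t <= e)%R ->
    forall u, U b (segment_path (p s) (p t) u).
Proof.
move=> [cp Up _ _]; have [e e0 he] := path_radius (slit_open (b := b)) cp Up.
have [d d0 pd] := path_modulus cp e0; exists d => // s t st u; apply: (he s).
apply: (@ball_convex R plane (p s) e); rewrite /= ?subrr ?normr0 //; last first.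
  by rewrite ival_ge0 ival_le1.
by rewrite distrC; exact: pd.
Qed.

Local Notation hol := (hol crossing).

Lemma hol_slit_true x y (p : I -> plane) : path_in (U true) x y p -> hol p = 1.
Proof.
move=> pU; have [e e0 he] := slit_path_segments pU; have [cp Pp _ _] := slit_path pU.
rewrite (hol_potential crossing_local (phi := fun=> 1) e0 cp Pp) ?mulVg // => s t st.
by rewrite ?mulVg crossing_true //; exact: he.
Qed.

Lemma hol_slit_false x y (p : I -> plane) : path_in (U false) x y p ->
  hol p = (strip_gen x.1)^-1 * strip_gen y.1.
Proof.
move=> pU; have [e e0 he] := slit_path_segments pU; have [cp Pp p0 p1] := slit_path pU.
rewrite (hol_potential crossing_local (phi := fun m => strip_gen m.1) e0 cp Pp) ?p0 ?p1 //.
by move=> s t st; rewrite crossing_false //; exact: he.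
Qed.

(** The way out, in [U false], contributes the letter of the strip of [right_point i], as the base
    point lies in the strip of value 1; the way back, in [U true], contributes 1. *)
Lemma hol_loop_gen i : hol (loop_repr (loop_gen i)) = free_gen i.
Proof.
have tU b := slit_tether_in (@right_point_slit b i).
have fP := slit_path (tU false); have tP := path_rev_in (slit_path (tU true)).
have lP := path_cat_in fP tP.
have -> : loop_gen i = path_class b0 (path_cat (slit_tether false (right_point i))
                                       (path_rev (slit_tether true (right_point i)))).
  by rewrite (path_class_cat b0 Pc fP tP) (path_class_rev b0 Pc (slit_path (tU true))).
rewrite (path_class_loop lP) (hol_homotopic crossing_local (loop_repr_class lP)).
rewrite (hol_cat crossing_local fP tP) (hol_slit_true (path_rev_in (tU true))) mulg1.
rewrite (hol_slit_false (tU false)) {2}/strip_gen right_point_left.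
rewrite /strip_gen; case E: (left_puncture base.1) => [j|]; last by rewrite invg1 mul1g.
by have := left_puncture_some E j; rewrite lexx ltNge ltW.
Qed.

Lemma punctured_pi1 : group_isomorphic (free_group k) (pi1 R b0).
Proof.
have holM : {morph (fun g : pi1 R b0 => hol (loop_repr g)) : g h / g * h}.
  move=> g h /=; rewrite (hol_homotopic crossing_local (loop_reprM g h)).
  exact: (hol_cat crossing_local (loop_repr_in g) (loop_repr_in h)).
apply: (group_isomorphic_morph (free_evalM loop_gen)).
  apply: (can_inj (g := fun g : pi1 R b0 => hol (loop_repr g))) => w.
  rewrite (morph_free_eval (phi := fun g : pi1 R b0 => hol (loop_repr g))) //.
  by rewrite -[RHS]free_eval_id; apply: eq_free_eval => i; exact: hol_loop_gen.
exact: loop_gen_generate.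
Qed.

End PuncturedPlane.

(** * Removing vertical lines *)

Section Assemble.
Context {R : realType}.
Local Notation I := (unit_interval R).
Local Notation plane := (@plane R).
Local Notation space := (plane * plane)%type.

Definition in_set (T : topologicalType) (A : set T) x (Ax : A x) : A := exist _ x (mem_set Ax).

Lemma vanishing_function (l : seq R) : exists Z : R -> R, continuous Z /\
  forall x, (Z x == 0) = (x \in l).
Proof.
elim: l => [|y l [Z [cZ Zl]]].
  exists (fun=> 1); split; first exact: continuous_cst.
  by move=> x; rewrite oner_eq0.
exists (fun x => (x - y) * Z x); split; last first.
  by move=> x; rewrite mulf_eq0 Zl subr_eq0 inE.
apply: Defs.mul_continuous => //; apply: Defs.sub_continuous; last exact: continuous_cst.
by move=> x; exact: cvg_id.
Qed.

(** Newton interpolation: the correction for a new node is a multiple of a function whose zeros are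
    the old nodes. Its graph is the curve that will separate [S] from the punctures. *)
Lemma interpolation (l : seq (R * R)) :
  (forall p q, p \in l -> q \in l -> p.1 = q.1 -> p.2 = q.2) ->
  exists G : R -> R, continuous G /\ forall p, p \in l -> G p.1 = p.2.
Proof.
elim: l => [|p l IH] h.
  by exists (fun=> 0); split=> //; exact: continuous_cst.
have [|G [cG Gl]] := IH.
  by move=> q q' ql ql'; apply: h; rewrite inE ?ql ?ql' orbT.
have [/mapP[q ql pq]|pl] := boolP (p.1 \in map fst l).
  exists G; split=> // q'; rewrite inE => /orP[/eqP->|]; last exact: Gl.
  by rewrite pq Gl //; apply: h; rewrite ?inE ?eqxx ?ql ?orbT.
have [Z [cZ Zl]] := vanishing_function (map fst l).
exists (fun x => G x + (p.2 - G p.1) / Z p.1 * Z x); split.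
  apply: (@continuousD_fun R R R^o) => //.
  by apply: Defs.mul_continuous => //; exact: continuous_cst.
move=> q; rewrite inE => /orP[/eqP->|ql].
  by rewrite mulfVK ?Zl // addrC subrK.
have /eqP -> : Z q.1 == 0 by rewrite Zl map_f.
by rewrite mulr0 addr0 Gl.
Qed.

Section DistinctAbscissas.
Context (J : finType) (k : nat).
Variables (r : J -> plane -> plane) (s : plane -> plane) (S : seq plane) (a : 'I_k -> plane).
Hypotheses (cr : forall j, continuous (r j)) (cs : continuous s).
Hypothesis sr : forall j m, s m != r j m.
Hypothesis rS : forall m i j, m \notin S -> i != j -> r i m != r j m.
Hypothesis aS : forall i, a i \notin S.
Hypothesis ainj : injective a.
Let l := S ++ codom a.
Hypothesis abscissa : forall u v, u \in l -> v \in l -> u.1 = v.1 -> u = v.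
Let Q := punctured a.
Hypotheses (cQ : @path_connected R space (total r Q)) (cT : @path_connected R space (total r setT)).

Lemma distinct_abscissas_pi1 (x0 : total r Q) (y0 : total r setT) :
  group_isomorphic (pi1 R x0) (pi1 R y0 * free_group k)%type.
Proof.
have al i : a i \in l by rewrite mem_cat codom_f orbT.
have Sl u : u \in S -> u \in l by move=> uS; rewrite mem_cat uS.
have ainj1 i j : (a i).1 = (a j).1 -> i = j.
  by move=> e; apply: ainj; apply: abscissa.
(* The curve passes above every point of [S] and below every [a i]; the margin 1 is arbitrary. *)
pose pts := [seq (u.1, u.2 + 1) | u : plane <- S] ++ [seq ((a i).1, (a i).2 - 1) | i <- enum 'I_k].
have [|G [cG Gp]] := interpolation (l := pts).
  move=> p q; rewrite !mem_cat => /orP[/mapP[u uS ->]|/mapP[i _ ->]] /orP[/mapP[v vS ->]|/mapP[j _ ->]] /= e.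
  - by rewrite (abscissa (Sl _ uS) (Sl _ vS) e).
  - by have := aS j; rewrite -(abscissa (Sl _ uS) (al j) e) uS.
  - by have := aS i; rewrite (abscissa (al i) (Sl _ vS) e) vS.
  - by rewrite (abscissa (al i) (al j) e).
have Ga i : G (a i).1 < (a i).2.
  have -> : G (a i).1 = (a i).2 - 1.
    by apply: (Gp ((a i).1, (a i).2 - 1)); rewrite mem_cat; apply/orP; right;
       apply/mapP; exists i; rewrite ?mem_enum.
  by rewrite ltrBlDr ltrDl.
have GS u : u \in S -> u.2 < G u.1.
  move=> uS; have -> : G u.1 = u.2 + 1.
    by apply: (Gp (u.1, u.2 + 1)); rewrite mem_cat; apply/orP; left; apply/mapP; exists u.
  by rewrite ltrDl.
pose x1 := - (1 + \sum_i `|(a i).1|).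
have x1a i : x1 < (a i).1.
  have : `|(a i).1| <= \sum_i `|(a i).1| by rewrite (bigD1 i) //= lerDl sumr_ge0.
  have : - (a i).1 <= `|(a i).1| by rewrite -normrN ler_norm.
  by rewrite /x1; move=> ? ?; lra.
(* On the curve, hence fixed by [D] and outside [S]; to the left of every [a i], hence a legitimate
   base point for [punctured_pi1]. *)
pose m0 : plane := (x1, G x1).
have m0S : m0 \notin S by apply/negP => /GS; rewrite ltxx.
have m0Q : Q m0 by move=> i; apply/eqP => e; have := x1a i; rewrite -e ltxx.
(* Pushes everything above the curve vertically down onto it. The moving points stay on or above the
   curve and so avoid [S]; at the end nothing is above it, where the [a i] are. *)
pose D (z : plane * I) : plane :=
  (z.1.1, (1 - ival z.2) * z.1.2 + ival z.2 * Num.min z.1.2 (G z.1.1)).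
have c1 := @fst_continuous plane I; have c2 := @snd_continuous plane I.
have c11 : continuous (fun z : plane * I => z.1.1) by exact: continuous_comp2 c1 (@fst_continuous _ _).
have c12 : continuous (fun z : plane * I => z.1.2) by exact: continuous_comp2 c1 (@snd_continuous _ _).
have ci : continuous (fun z : plane * I => ival z.2) by exact: ival_comp_continuous c2.
have cD : continuous D.
  apply: continuous_pair => //.
  apply: (@continuous_lincomb R _ R^o (fun z : plane * I => ival z.2) (fun z => z.1.2)
    (fun z => Num.min z.1.2 (G z.1.1))) => //.
  by apply: min_fun_continuous => //; exact: continuous_comp2 c11 cG.
have clC : closed [set m : plane | G m.1 <= m.2].
  have -> : [set m : plane | G m.1 <= m.2] = (fun m : plane => m.2 - G m.1) @^-1` [set x | 0 <= x].
    by apply/seteqP; split=> m /=; rewrite subr_ge0.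
  apply: closed_comp; last exact: closed_ge.
  move=> m _; apply: Defs.sub_continuous; first exact: snd_continuous.
  exact: continuous_comp2 (@fst_continuous _ _) cG.
pose x0' := in_set (total_section sr m0Q).
pose y0' := in_set (total_section sr (Q := setT) (m := m0) Logic.I).
pose b0 : punctured a := in_set m0Q.
apply: group_isomorphic_trans (pi1_base_point x0 x0' cQ) _.
apply: (@group_isomorphic_trans _ (pi1 R y0' * pi1 R b0)%type).
  apply: (total_pi1 cr cs sr rS m0S (punctured_open ainj1) cQ cT clC cD) => //.
  - by move=> m; rewrite /D /= ival0 subr0 mul1r mul0r addr0; case: m.
  - move=> m i; apply/eqP; rewrite /D /= ival1 subrr mul0r mul1r add0r => e.
    have := Ga i; rewrite -e /= => h.
    have : Num.min m.2 (G m.1) <= G m.1 by rewrite ge_min lexx orbT.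
    by rewrite leNgt h.
  - by move=> t; rewrite /D /= minxx -mulrDl subrK mul1r.
  - move=> m t /= /negP; rewrite -ltNge => /ltW mG; rewrite /D /= min_l // -mulrDl subrK mul1r.
    by case: m mG.
  - move=> m t /= mG; apply/negP => /GS; rewrite /D /= min_r //.
    have := ival_ge0 t; have := ival_le1 t; move: (ival t) mG => u mG u1 u0.
    by rewrite ltNge; apply/negP; rewrite negbK; nra.
apply: group_isomorphic_prod; first exact: pi1_base_point.
by apply: group_isomorphic_sym; apply: punctured_pi1.
Qed.

End DistinctAbscissas.

Definition shear (tau : R) (m : plane) : plane := (m.1 + tau * m.2, m.2).

Lemma shearK tau : cancel (shear tau) (shear (- tau)).
Proof. by move=> m; rewrite /shear /= mulNr addrK; case: m. Qed.

Lemma shear_continuous tau : continuous (shear tau).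
Proof.
apply: continuous_pair; last exact: snd_continuous.
apply: (@continuousD_fun R plane R^o fst (fun m => tau * m.2)); first exact: fst_continuous.
by apply: Defs.mul_continuous; [exact: continuous_cst|exact: snd_continuous].
Qed.

(** Two points with different ordinates get the same abscissa for one value of [tau] only; two with
    equal ordinates are never brought together. *)
Lemma shear_generic (l : seq plane) : exists tau : R, forall u v, u \in l -> v \in l ->
  (shear tau u).1 = (shear tau v).1 -> u = v.
Proof.
have [tau [_ tauP]] := @avoid_finite R
  [seq (v.1 - u.1) / (u.2 - v.2) | u : plane <- l, v : plane <- l] 1 ltr01.
exists tau => u v ul vl /= e; have [uv|uv] := eqVneq u.2 v.2.
  case: u v uv e {ul vl} => x y [x' y'] /= -> e; congr pair; lra.
case/negP: tauP; apply/allpairsP; exists (u, v); split=> //=.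
apply: (mulIf (x := u.2 - v.2)); first by rewrite subr_eq0.
by rewrite mulfVK ?subr_eq0 //; lra.
Qed.

Lemma affine_pi1 (J : finType) (k : nat) (r : J -> plane -> plane) (s : plane -> plane)
    (S : seq plane) (a : 'I_k -> plane) :
  (forall j, continuous (r j)) -> continuous s -> (forall j m, s m != r j m) ->
  (forall m i j, m \notin S -> i != j -> r i m != r j m) ->
  (forall i, a i \notin S) -> injective a ->
  @path_connected R space (total r (punctured a)) -> @path_connected R space (total r setT) ->
  forall (x0 : total r (punctured a)) (y0 : total r setT),
  group_isomorphic (pi1 R x0) (pi1 R y0 * free_group k)%type.
Proof.
move=> cr cs sr rS aS ainj cQ cT x0 y0.
have [tau tauP] := shear_generic (S ++ codom a).
pose sh := shear tau; pose hs := shear (- tau).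
have shK : cancel sh hs by exact: shearK.
have hsK : cancel hs sh by move=> m; rewrite /sh -[X in shear X]opprK; exact: shearK.
have csh : continuous sh by exact: shear_continuous.
have chs : continuous hs by exact: shear_continuous.
pose r' j m := r j (hs m); pose a' i := sh (a i).
pose F (z : space) : space := (sh z.1, z.2); pose F' (z : space) : space := (hs z.1, z.2).
have cF : continuous F.
  by apply: continuous_pair; [exact: continuous_comp2 (@fst_continuous _ _) csh|exact: snd_continuous].
have cF' : continuous F'.
  by apply: continuous_pair; [exact: continuous_comp2 (@fst_continuous _ _) chs|exact: snd_continuous].
have FK : cancel F F' by move=> z; rewrite /F /F' /= shK; case: z.
have F'K : cancel F' F by move=> z; rewrite /F /F' /= hsK; case: z.
have FT z : total r setT z -> total r' setT (F z).
  by move=> [_ h]; split=> // j; rewrite /r' /= shK; exact: h.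
have F'T z : total r' setT z -> total r setT (F' z).
  by move=> [_ h]; split=> // j; exact: h.
have FQ z : total r (punctured a) z -> total r' (punctured a') (F z).
  move=> [h1 h]; split; last by move=> j; rewrite /r' /= shK; exact: h.
  by move=> i; rewrite /a' /= (can_eq shK).
have F'Q z : total r' (punctured a') z -> total r (punctured a) (F' z).
  move=> [h1 h]; split=> // i /=.
  by rewrite -(can_eq shK) hsK; exact: h1.
have conn (A A' : set space) : (forall z, A z -> A' (F z)) -> (forall z, A' z -> A (F' z)) ->
    @path_connected R space A -> @path_connected R space A'.
  move=> AF A'F cA x y xA yA; have [p pP] := cA _ _ (A'F _ xA) (A'F _ yA).
  exists (fun t => F (p t)); rewrite -[x]F'K -[y]F'K.
  by apply: (image_path_in AF) pP => z _; exact: cF.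
have iso (A A' : set space) (u : A) (v : A') : (forall z, A z -> A' (F z)) -> (forall z, A' z -> A (F' z)) ->
    F (set_val u) = set_val v -> group_isomorphic (pi1 R u) (pi1 R v).
  move=> AF A'F uv; apply: (@homeomorphic_pi1 R _ _ A A' u v F F') => // z _; first exact: cF.
  exact: cF'.
pose x0' := in_set (FQ _ (set_valP x0)); pose y0' := in_set (FT _ (set_valP y0)).
apply: group_isomorphic_trans (iso _ _ x0 x0' FQ F'Q erefl) _.
apply: (@group_isomorphic_trans _ (pi1 R y0' * free_group k)%type); last first.
  apply: group_isomorphic_prod; last exact: group_isomorphic_refl.
  by apply: group_isomorphic_sym; exact: iso.
apply: (@distinct_abscissas_pi1 _ _ r' (fun m => s (hs m)) (map sh S) a').
- by move=> j; exact: continuous_comp2 chs (cr j).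
- exact: continuous_comp2 chs cs.
- by move=> j m; exact: sr.
- move=> m i j mS; apply: rS; apply: contraNN mS => h.
  by rewrite -[m]hsK map_f.
- by move=> i; rewrite (mem_map (can_inj shK)).
- by move=> i j /(can_inj shK)/ainj.
- move=> u v; have -> : codom a' = map sh (codom a) by rewrite !codomE -map_comp.
  by rewrite -map_cat => /mapP[u' ul ->] /mapP[v' vl ->] /(tauP _ _ ul vl) ->.
- exact: conn FQ F'Q cQ.
- exact: conn FT F'T cT.
Qed.

End Assemble.

(** * Affine charts of the projective plane *)

Section ComplexPlane.
Context {R : realType}.
Local Notation I := (unit_interval R).
Local Notation plane := (@plane R).
Local Notation space := (plane * plane)%type.
Local Open Scope complex_scope.

Definition toC (m : plane) : R[i] := m.1 +i* m.2.
Definition ofC (z : R[i]) : plane := (complex.Re z, complex.Im z).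

Lemma toCK : cancel toC ofC. Proof. by case. Qed.
Lemma ofCK : cancel ofC toC. Proof. by case. Qed.

Lemma real_pos_complex (e : R[i]) : 0 < e -> exists2 d : R, 0 < d & e = d%:C.
Proof. by case: e => x y; rewrite ltcE /= => /andP[/eqP -> x0]; exists x. Qed.

Lemma ofC_continuous : continuous ofC.
Proof.
have ball_ofC (g : R[i] -> R) : (forall z, `|g z|%:C <= `|z|) -> {morph g : x y / x - y} ->
    continuous (g : R[i] -> R).
  move=> gle gB z A /= /(@nbhs_ballP R R^o) [e /= e0 eA].
  have e0' : 0 < e%:C by rewrite ltcR.
  apply/(@nbhs_ballP R[i] R[i]^o); exists e%:C => //= w wz; apply: eA.
  move: wz; rewrite /ball /= => wz.
  by rewrite -ltcR -gB; exact: le_lt_trans (gle _) wz.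
apply: continuous_pair; apply: ball_ofC.
- exact: normc_ge_Re.
- by case=> a b [c d].
- by move=> [x y]; have := normc_ge_Re (y +i* x); rewrite !normc_def /= addrC.
- by case=> a b [c d].
Qed.

Lemma toC_continuous : continuous toC.
Proof.
move=> m A /= /(@nbhs_ballP R[i] R[i]^o) [e /= /real_pos_complex[d d0 ->] eA].
apply/nbhs_ballP; exists (d / 2) => [|n]; first by rewrite /= divr_gt0.
rewrite -ball_normE /= plane_normE gt_max /= => /andP[h1 h2]; apply: eA.
rewrite /ball /=.
rewrite normc_def ltcR /= -(ger0_norm (ltW d0)) -sqrtr_sqr ltr_sqrt ?exprn_gt0 //.
have e1 : (m.1 - n.1) ^+ 2 < (d / 2) ^+ 2.
  by rewrite -real_normK ?num_real // ltr_pXn2r ?nnegrE // ltW // divr_gt0.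
have e2 : (m.2 - n.2) ^+ 2 < (d / 2) ^+ 2.
  by rewrite -real_normK ?num_real // ltr_pXn2r ?nnegrE // ltW // divr_gt0.
by nra.
Qed.

(* The complement of finitely many complex affine lines is connected: the
   complex line through two of its points leaves it at finitely many points. *)
Lemma affine_complement_connected (N : finType) (f : N -> R[i] * R[i] * R[i]) :
  @path_connected R space [set z : space | forall n,
     (f n).1.1 + (f n).1.2 * toC z.1 + (f n).2 * toC z.2 != 0].
Proof.
move=> z z' zA z'A.
pose ev n (z : space) := (f n).1.1 + (f n).1.2 * toC z.1 + (f n).2 * toC z.2.
(* The complex parameters at which the line through [z] and [z'] meets a removed line. If a form
   takes equal values at [z] and [z'], the quotient is the default 0; the filter discards it, since
   the path of parameters starts at 0. *)
pose S : seq plane := [seq u <- [seq ofC (ev n z / (ev n z - ev n z')) | n <- enum N] |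
  (u != (0, 0)) && (u != (1, 0))].
have [||v [[cv vS v0 v1] _]] := @bulge_avoid R S (0, 0) (1, 0).
- by rewrite mem_filter eqxx.
- by rewrite mem_filter eqxx andbF.
pose mix (u a a' : plane) : plane :=
  (a.1 + (u.1 * (a'.1 - a.1) - u.2 * (a'.2 - a.2)), a.2 + (u.1 * (a'.2 - a.2) + u.2 * (a'.1 - a.1))).
have mixE u a a' : toC (mix u a a') = toC a + toC u * (toC a' - toC a).
  by case: u a a' => x y [a b] [c d].
have cmix a a' : continuous (fun t : I => mix (v t) a a').
  have cv1 : continuous (fun t : I => (v t).1) by exact: continuous_comp2 cv (@fst_continuous _ _).
  have cv2 : continuous (fun t : I => (v t).2) by exact: continuous_comp2 cv (@snd_continuous _ _).
  have cl (b c d : R) (g h : I -> R) : continuous g -> continuous h ->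
      continuous (fun t => b + (g t * c + h t * d)).
    move=> cg ch; apply: (@continuousD_fun R I R^o (fun=> b)); first exact: continuous_cst.
    by apply: (@continuousD_fun R I R^o); apply: Defs.mul_continuous => //; exact: continuous_cst.
  rewrite (_ : (fun t => _) = fun t => (a.1 + ((v t).1 * (a'.1 - a.1) + (v t).2 * (- (a'.2 - a.2))),
      a.2 + ((v t).1 * (a'.2 - a.2) + (v t).2 * (a'.1 - a.1)))); last first.
    by apply/funext => t; rewrite /mix mulrN.
  by apply: continuous_pair; exact: cl.
have mix0 a a' : mix (0, 0) a a' = a by rewrite /mix /= !mul0r subrr !addr0; case: a.
have mix1 a a' : mix (1, 0) a a' = a'.
  by rewrite /mix /= !mul0r !mul1r subr0 !addr0 [_ + (_ - _)]addrC subrK [a.2 + _]addrC subrK; case: a'.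
exists (fun t => (mix (v t) z.1 z'.1, mix (v t) z.2 z'.2)); split.
- by apply: continuous_pair; exact: cmix.
- move=> t n /=; rewrite !mixE.
  have -> : (f n).1.1 + (f n).1.2 * (toC z.1 + toC (v t) * (toC z'.1 - toC z.1)) +
      (f n).2 * (toC z.2 + toC (v t) * (toC z'.2 - toC z.2)) =
      ev n z - toC (v t) * (ev n z - ev n z') by rewrite /ev; ring.
  have zn : ev n z != 0 := zA n; have zn' : ev n z' != 0 := z'A n.
  apply/negP => /eqP e; have := vS t => /=; apply/negP; rewrite negbK mem_filter.
  have ne : ev n z - ev n z' != 0.
    by apply: contraNneq zn => h; move: e; rewrite h mulr0 subr0 => /eqP.
  have vE : toC (v t) = ev n z / (ev n z - ev n z').
    by apply: (mulIf ne); rewrite mulfVK //; apply/esym/eqP; rewrite -subr_eq0 e eqxx.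
  have h1 : v t != (0, 0).
    apply: contraNneq zn => h; move: e; rewrite h /toC /=.
    by rewrite (_ : 0 +i* 0 = 0) // mul0r subr0 => /eqP.
  have h2 : v t != (1, 0).
    apply: contraNneq zn' => h; move: e; rewrite h /toC /=.
    by rewrite (_ : 1 +i* 0 = 1) // mul1r opprB addrC subrK => /eqP.
  by rewrite h1 h2 /=; apply/mapP; exists n; rewrite ?mem_enum // -vE toCK.
- by rewrite v0 !mix0; case: (z).
- by rewrite v1 !mix1; case: (z').
Qed.

End ComplexPlane.

Section ComplexContinuity.
Context {R : realType} {X : topologicalType}.
Implicit Types (f g : X -> R[i]) (x : X).

Lemma continuousD_at f g x : f @ x --> f x -> g @ x --> g x ->
  (fun y => f y + g y) @ x --> f x + g x.
Proof. by move=> cf cg; apply: (@cvgD R[i] R[i]^o); [exact: cf|exact: cg]. Qed.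

Lemma continuousM_at f g x : f @ x --> f x -> g @ x --> g x ->
  (fun y => f y * g y) @ x --> f x * g x.
Proof. by move=> cf cg; apply: (@cvgM R[i]); [exact: cf|exact: cg]. Qed.

Lemma continuousV_at f x : f x != 0 -> f @ x --> f x ->
  (fun y => (f y)^-1) @ x --> (f x)^-1.
Proof. by move=> fx cf; apply: (@cvgV R[i]); [exact: fx|exact: cf]. Qed.

Lemma continuous_comp_at (Y Z : topologicalType) (f : X -> Y) (g : Y -> Z) x :
  f @ x --> f x -> continuous g -> (fun y => g (f y)) @ x --> g (f x).
Proof. by move=> cf cg; apply: continuous_comp; [exact: cf|exact: cg]. Qed.

Lemma continuous_pair_at (Y Z : topologicalType) (f : X -> Y) (g : X -> Z) x :
  f @ x --> f x -> g @ x --> g x -> (fun y => (f y, g y)) @ x --> (f x, g x).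
Proof. by move=> cf cg; apply: cvg_pair; [exact: cf|exact: cg]. Qed.

Lemma continuous_row_at n (f : X -> 'rV[R[i]]_n) x :
  (forall j, {for x, continuous (fun y => f y ord0 j)}) -> {for x, continuous f}.
Proof.
move=> cf A /= [P fP PA].
have : \forall y \near x, forall j, P ord0 j (f y ord0 j).
  by apply: filter_forall => j; exact: (cf j _ (fP ord0 j)).
by apply: filterS => y yP; apply: PA => i j; rewrite ord1.
Qed.

End ComplexContinuity.

(** * Charts defined by three independent linear forms *)

Section Chart.
Context {R : realType}.
Local Notation plane := (@plane R).
Local Notation space := (plane * plane)%type.
Local Notation C := R[i].
Local Notation CP2 := (CP2 R).

(** In the quotient topology continuity is tested on nonzero vectors. The test is restricted to an
    open set [N], because a chart is only to be used off its line at infinity. *)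
Lemma CP2_continuous_at (T : topologicalType) (f : CP2 -> T) (N : set CP2) :
  open [set v | N (\pi_CP2 v)] ->
  (forall v, N (\pi_CP2 v) -> {for v, continuous (fun v => f (\pi_CP2 v))}) ->
  forall p, N p -> {for p, continuous f}.
Proof.
move=> oN cf p Np A; rewrite nbhsE /=; case=> O [oO Op] OA.
have oW : open [set q | N q /\ O (f q)].
  suff : open [set v : punctured_C3 R | N (\pi_CP2 v) /\ O (f (\pi_CP2 v))] by [].
  rewrite openE => v /= [Nv Ov]; apply: filterI; first exact: open_nbhs_nbhs.
  by apply: (cf v Nv); exact: open_nbhs_nbhs.
have : nbhs p [set q | N q /\ O (f q)] by exact: open_nbhs_nbhs.
by apply: filterS => q [_ /OA].
Qed.

Definition i1 : 'I_3 := lift ord0 ord0.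
Definition i2 : 'I_3 := lift ord0 (lift ord0 ord0).

Lemma sum3 (F : 'I_3 -> C) : \sum_j F j = F ord0 + F i1 + F i2.
Proof. by rewrite !big_ord_recl big_ord0 addr0 addrA. Qed.

Variable M : 'M[C]_3.
Hypothesis Mu : M \in unitmx.

(** The columns of [M] are three linear forms, of which the first vanishes on the line at infinity
    of the chart. *)
Definition hcoord (v : 'rV[C]_3) (j : 'I_3) : C := (v *m M) ord0 j.

Lemma hcoord_form v (b : 'cV[C]_3) :
  v *m b = 0 <-> hcoord v ord0 * (invmx M *m b) ord0 ord0 +
    hcoord v i1 * (invmx M *m b) i1 ord0 + hcoord v i2 * (invmx M *m b) i2 ord0 = 0.
Proof.
have -> : v *m b = (v *m M) *m (invmx M *m b) by rewrite mulmxA mulmxK.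
set u := v *m M; set c := invmx M *m b.
rewrite -[X in _ <-> X = 0](sum3 (fun j => u ord0 j * c j ord0)).
have -> : \sum_j u ord0 j * c j ord0 = (u *m c) ord0 ord0 by rewrite mxE.
split=> [->|h]; first by rewrite mxE.
by apply/matrixP => i j; rewrite !ord1 h mxE.
Qed.

Definition chart_of (v : 'rV[C]_3) : space :=
  (ofC (hcoord v i1 / hcoord v ord0), ofC (hcoord v i2 / hcoord v ord0)).

Definition chart (p : CP2) : space := chart_of (coords (repr p)).

Lemma coords_neq0 (v : punctured_C3 R) : coords v != 0.
Proof. by have := set_valP v. Qed.

Lemma coords_pi v : exists2 c : C, c != 0 & coords (repr (\pi_CP2 v)) = c *: coords v.
Proof.
have /eqmodP/andP[/submxP[c rc] _] : repr (\pi_CP2 v) = v %[mod CP2] by rewrite reprK.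
have rE : coords (repr (\pi_CP2 v)) = c ord0 ord0 *: coords v.
  by rewrite rc [c]mx11_scalar mul_scalar_mx !mxE.
exists (c ord0 ord0) => //; apply: contraNneq (coords_neq0 (repr (\pi_CP2 v))) => c0.
by rewrite rE c0 scale0r.
Qed.

Lemma hcoordZ c v j : hcoord (c *: v) j = c * hcoord v j.
Proof. by rewrite /hcoord -scalemxAl mxE. Qed.

Lemma chart_pi v : chart (\pi_CP2 v) = chart_of (coords v).
Proof.
have [c c0 e] := coords_pi v; rewrite /chart e /chart_of !hcoordZ.
have E j : c * hcoord (coords v) j / (c * hcoord (coords v) ord0) =
    hcoord (coords v) j / hcoord (coords v) ord0 by rewrite -mulf_div divff // mul1r.
by rewrite !E.
Qed.

Lemma hcoord_pi v j : (hcoord (coords (repr (\pi_CP2 v))) j == 0) = (hcoord (coords v) j == 0).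
Proof. by have [c c0 ->] := coords_pi v; rewrite hcoordZ mulf_eq0 (negbTE c0). Qed.

Lemma coords_continuous : continuous (@coords R).
Proof. exact: (@initial_continuous _ _ (@set_val _ [set v : 'rV[C]_3 | v != 0])). Qed.

Lemma hcoord_continuous j : continuous (fun v : punctured_C3 R => hcoord (coords v) j).
Proof.
have cE i : continuous (fun v : punctured_C3 R => coords v ord0 i).
  exact: (continuous_comp2 coords_continuous (@coord_continuous C 1 3 ord0 i)).
have -> : (fun v : punctured_C3 R => hcoord (coords v) j) =
    fun v => coords v ord0 ord0 * M ord0 j + coords v ord0 i1 * M i1 j + coords v ord0 i2 * M i2 j.
  by apply/funext => v; rewrite /hcoord mxE sum3.
move=> v; apply: continuousD_at; first apply: continuousD_at;
  apply: continuousM_at; try exact: cE; exact: continuous_cst.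
Qed.

Lemma chart_continuous p : hcoord (coords (repr p)) ord0 != 0 -> {for p, continuous chart}.
Proof.
apply: (@CP2_continuous_at _ chart [set p | hcoord (coords (repr p)) ord0 != 0]).
  rewrite (_ : [set v | _] = [set v | hcoord (coords v) ord0 != 0]); last first.
    by apply/seteqP; split=> v /=; rewrite hcoord_pi.
  apply: (@open_comp _ _ (fun v => hcoord (coords v) ord0) [set z : C | z != 0]).
    by move=> v _; exact: hcoord_continuous.
  rewrite (_ : [set z : C | z != 0] = ofC @^-1` [set m : plane | 0 < `|m|]).
    apply: open_comp => [z _|]; first exact: ofC_continuous.
    apply: (@open_comp plane R (fun m => `|m|) [set x | 0 < x]); last exact: open_gt.
    by move=> m _; apply: continuous_norm => ?; exact: cvg_id.
  apply/seteqP; split=> z /=; rewrite normr_gt0; apply: contraNN => /eqP.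
    by case: z => x y [-> ->].
  by move=> ->.
move=> v /=; rewrite hcoord_pi => v0.
have -> : (fun v => chart (\pi_CP2 v)) = fun v => chart_of (coords v).
  by apply/funext => w; rewrite chart_pi.
have cj j : (fun v => ofC (hcoord (coords v) j / hcoord (coords v) ord0)) @ v -->
    ofC (hcoord (coords v) j / hcoord (coords v) ord0).
  apply: continuous_comp_at (@ofC_continuous R).
  apply: continuousM_at; first exact: hcoord_continuous.
  by apply: continuousV_at; [exact: v0|exact: hcoord_continuous].
by apply: continuous_pair_at; exact: cj.
Qed.

Definition affine_vec (z : space) : 'rV[C]_3 :=
  (\row_j if j == ord0 then 1 else if j == i1 then toC z.1 else toC z.2) *m invmx M.

Lemma hcoord_affine z :
  [/\ hcoord (affine_vec z) ord0 = 1, hcoord (affine_vec z) i1 = toC z.1 &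
      hcoord (affine_vec z) i2 = toC z.2].
Proof. by rewrite /hcoord /affine_vec mulmxKV // !mxE. Qed.

Lemma affine_vec_neq0 z : affine_vec z \in [set v | v != 0]%classic.
Proof.
apply/mem_set/eqP => z0; have [] := hcoord_affine z.
by rewrite z0 /hcoord mul0mx mxE => /esym/eqP; rewrite oner_eq0.
Qed.

Definition affine_rep (z : space) : punctured_C3 R := exist _ (affine_vec z) (affine_vec_neq0 z).

Definition unchart (z : space) : CP2 := \pi_CP2 (affine_rep z).

Lemma unchart_continuous : continuous unchart.
Proof.
have c : continuous affine_rep.
  apply: continuous_comp_initial => z; apply: continuous_row_at => j.
  have -> : (fun y => affine_vec y ord0 j) = fun y : space =>
      (invmx M ord0 j + toC y.1 * invmx M i1 j) + toC y.2 * invmx M i2 j.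
    by apply/funext => y; rewrite mxE sum3 !mxE /= mul1r.
  have c1 : continuous (fun y : space => toC y.1).
    exact: continuous_comp2 (@fst_continuous _ _) (@toC_continuous R).
  have c2 : continuous (fun y : space => toC y.2).
    exact: continuous_comp2 (@snd_continuous _ _) (@toC_continuous R).
  apply: continuousD_at; first apply: continuousD_at; first exact: continuous_cst.
    by apply: continuousM_at; [exact: c1|exact: continuous_cst].
  by apply: continuousM_at; [exact: c2|exact: continuous_cst].
exact: (continuous_comp2 c (@pi_continuous _ _)).
Qed.

Lemma unchartK : cancel unchart chart.
Proof.
move=> z; rewrite /unchart chart_pi /chart_of /=.
have [-> -> ->] := hcoord_affine z; rewrite !divr1 !toCK.
by case: z.
Qed.

Lemma ord3P (j : 'I_3) : [\/ j = ord0, j = i1 | j = i2].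
Proof.
by case: j => -[|[|[|//]]] jlt; [apply: Or31|apply: Or32|apply: Or33]; apply: val_inj.
Qed.

Lemma hcoord_inj v w : (forall j, hcoord v j = hcoord w j) -> v = w.
Proof.
move=> vw; rewrite -[v](mulmxK Mu) -[w](mulmxK Mu); congr (_ *m _).
by apply/rowP => j; exact: vw.
Qed.

Lemma chartK p : hcoord (coords (repr p)) ord0 != 0 -> unchart (chart p) = p.
Proof.
move=> p0; rewrite -[RHS]reprK; apply/eqmodP/eqmxP.
have e : coords (repr p) = hcoord (coords (repr p)) ord0 *: affine_vec (chart p).
  apply: hcoord_inj => j; rewrite hcoordZ.
  have [h0 h1 h2] := hcoord_affine (chart p).
  case: (ord3P j) => ->; rewrite ?h0 ?h1 ?h2 ?mulr1 // ofCK mulrC mulfVK //.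
by rewrite [X in (_ :=: X)%MS]e; apply: eqmx_sym; exact: eqmx_scale.
Qed.

Lemma line_chart (b : 'cV[C]_3) p : hcoord (coords (repr p)) ord0 != 0 ->
  line b p <-> (invmx M *m b) ord0 ord0 + (invmx M *m b) i1 ord0 * toC (chart p).1 +
    (invmx M *m b) i2 ord0 * toC (chart p).2 = 0.
Proof.
move=> p0; rewrite /line /= hcoord_form /chart /chart_of /= !ofCK.
set x := hcoord _ ord0 in p0 *; set y := hcoord _ i1; set z := hcoord _ i2.
move: (invmx M *m b) => c.
have -> : x * c ord0 ord0 + y * c i1 ord0 + z * c i2 ord0 =
  x * (c ord0 ord0 + c i1 ord0 * (y / x) + c i2 ord0 * (z / x)) by field.
by split=> [/eqP|->]; [rewrite mulf_eq0 (negbTE p0) => /eqP|rewrite mulr0].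
Qed.

Lemma chart_pi1 (A : set CP2) (A' : set space) (x : A) (y : A') :
  (forall p, A p <-> hcoord (coords (repr p)) ord0 != 0 /\ A' (chart p)) ->
  chart (set_val x) = set_val y -> group_isomorphic (pi1 R x) (pi1 R y).
Proof.
move=> AE xy.
have unA z : A' z -> A (unchart z).
  move=> Az; apply/AE; rewrite unchartK; split=> //.
  by rewrite hcoord_pi /=; have [-> _ _] := hcoord_affine z; rewrite oner_eq0.
apply: (@homeomorphic_pi1 R _ _ A A' x y chart unchart).
- by move=> p /AE[].
- by move=> p /AE[p0 _]; exact: chart_continuous.
- exact: unA.
- by move=> z _; exact: unchart_continuous.
- by move=> p /AE[p0 _]; exact: chartK.
- by move=> z _; exact: unchartK.
- exact: xy.
Qed.

End Chart.

Lemma lines_meet (F : fieldType) (A A' B B' X : F) : B != B' ->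
  A + B * X = A' + B' * X <-> X = (A' - A) / (B - B').
Proof.
move=> BB'; have n0 : B - B' != 0 by rewrite subr_eq0.
split=> [e|->]; last by field.
apply: (mulIf n0); rewrite mulfVK //.
have -> : A' = A + B * X - B' * X by rewrite e addrK.
ring.
Qed.

Lemma line_solve (F : fieldType) (f0 f1 f2 X Y : F) : f2 != 0 ->
  (f0 + f1 * X + f2 * Y == 0) = (Y == - (f0 / f2) + - (f1 / f2) * X).
Proof.
move=> n0; have -> : f0 + f1 * X + f2 * Y = f2 * (Y - (- (f0 / f2) + - (f1 / f2) * X)).
  by field.
by rewrite mulf_eq0 (negbTE n0) subr_eq0.
Qed.

(** * Removing the lines of a pencil *)

Section Pencil.
Context {R : realType}.
Local Notation plane := (@plane R).
Local Notation space := (plane * plane)%type.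
Local Notation C := R[i].
Context (J : finType) (k : nat).
Variables (a0 : 'cV[C]_3) (a : 'I_k.+1 -> 'cV[C]_3) (b : J -> 'cV[C]_3) (vP : 'rV[C]_3).
Hypotheses (vP0 : vP != 0) (Pa0 : vP *m a0 = 0) (Pa : forall i, vP *m a i = 0).
Hypothesis Pb : forall j, vP *m b j != 0.
Hypothesis a0_neq0 : a0 != 0.
Hypothesis a_a0 : forall i c, a i != c *: a0.
Hypothesis a_a : forall i i' c, i != i' -> a i != c *: a i'.
Hypothesis b_b : forall j j' c, j != j' -> b j != c *: b j'.
Hypothesis generic : forall i j j' (v : 'rV[C]_3), j != j' ->
  v *m a i = 0 -> v *m b j = 0 -> v *m b j' = 0 -> v = 0.

Lemma transversal_form : exists a2 : 'cV[C]_3, vP *m a2 != 0.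
Proof.
have [j vj] : exists j, vP ord0 j != 0.
  by apply/existsP; apply: contraNT vP0 => /existsPn h; apply/eqP/rowP => j;
     rewrite mxE; apply/eqP; rewrite -[_ == _]negbK h.
exists (delta_mx j ord0); apply: contraNneq vj => /matrixP/(_ ord0 ord0).
rewrite !mxE (bigD1 j) //= mxE !eqxx mulr1 big1 ?addr0 => [->//|i ij].
by rewrite mxE (negbTE ij) mulr0.
Qed.

Definition a2 : 'cV[C]_3 := sval (cid transversal_form).

Lemma Pa2 : vP *m a2 != 0. Proof. by rewrite /a2; case: cid. Qed.

(** The form [a0] puts its line at infinity. The forms [a0] and [a ord0] span all forms vanishing at
    the vertex, so the equations of the pencil involve the first affine coordinate only. The form
    [a2], nonzero at the vertex, completes the frame. *)
Definition frame : 'M[C]_3 := \matrix_(i, j)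
  (if j == ord0 then a0 i ord0 else if j == i1 then a ord0 i ord0 else a2 i ord0).

Lemma frameE (c : 'cV[C]_3) :
  frame *m c = c ord0 ord0 *: a0 + c i1 ord0 *: a ord0 + c i2 ord0 *: a2.
Proof. by apply/colP => i; rewrite !mxE sum3 !mxE /= !(mulrC (c _ _)). Qed.

Lemma mulP_frame (c : 'cV[C]_3) : vP *m (frame *m c) = c i2 ord0 *: (vP *m a2).
Proof. by rewrite frameE !mulmxDr -!scalemxAr Pa0 Pa !scaler0 !add0r. Qed.

Lemma frame_unit : frame \in unitmx.
Proof.
rewrite -unitmx_tr -row_free_unit; apply: inj_row_free => v.
move=> /(congr1 trmx); rewrite trmx_mul trmxK trmx0; set c := v^T => fc.
suff c0 : c = 0 by rewrite -[v]trmxK -/c c0 trmx0.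
have c2 : c i2 ord0 = 0.
  have /eqP := mulP_frame c; rewrite fc mulmx0 eq_sym scaler_eq0 (negbTE Pa2) orbF.
  by move/eqP.
have := frameE c; rewrite fc c2 scale0r addr0 => e.
have c1 : c i1 ord0 = 0.
  apply/eqP/negPn/negP => c1; have /negP := a_a0 ord0 (- (c ord0 ord0 / c i1 ord0)); apply.
  apply/eqP; apply: (scalerI c1); rewrite scalerA mulrN mulrC mulfVK // scaleNr.
  by apply/eqP; rewrite -addr_eq0 addrC -e.
have c0 : c ord0 ord0 = 0.
  have /eqP := e; rewrite c1 scale0r addr0 eq_sym scaler_eq0 (negbTE a0_neq0) orbF.
  by move/eqP.
by apply/colP => j; rewrite [RHS]mxE; case: (ord3P j) => ->.
Qed.

Local Notation Mu := frame_unit.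
Definition fcoord (u : 'cV[C]_3) (j : 'I_3) : C := (invmx frame *m u) j ord0.

Lemma fcoordE u : u = fcoord u ord0 *: a0 + fcoord u i1 *: a ord0 + fcoord u i2 *: a2.
Proof. by rewrite -frameE mulKVmx ?Mu. Qed.

Lemma fcoord_P u : (vP *m u == 0) = (fcoord u i2 == 0).
Proof. by rewrite -[u in LHS](mulKVmx Mu) mulP_frame scaler_eq0 (negbTE Pa2) orbF. Qed.

Lemma fcoord_a2 i : fcoord (a i) i2 = 0.
Proof. by apply/eqP; rewrite -fcoord_P Pa. Qed.

Lemma fcoord_a1 i : fcoord (a i) i1 != 0.
Proof.
apply/negP => /eqP e; have /negP := a_a0 i (fcoord (a i) ord0); apply.
by rewrite {1}[a i]fcoordE e fcoord_a2 !scale0r !addr0.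
Qed.

Lemma fcoord_b2 j : fcoord (b j) i2 != 0.
Proof. by rewrite -fcoord_P. Qed.

(** A line missing the vertex has a nonzero last coordinate in the frame, hence is the graph of
    [offset j + slope j * m] over the base. *)
Definition offset j : C := - (fcoord (b j) ord0 / fcoord (b j) i2).
Definition slope j : C := - (fcoord (b j) i1 / fcoord (b j) i2).
Definition branch j (m : plane) : plane := ofC (offset j + slope j * toC m).
Definition vertical i : plane := ofC (- (fcoord (a i) ord0 / fcoord (a i) i1)).

Lemma branchE j m w : (fcoord (b j) ord0 + fcoord (b j) i1 * toC m + fcoord (b j) i2 * toC w == 0) =
  (w == branch j m).
Proof.
by rewrite -(can_eq (@toCK R)) /branch ofCK line_solve ?fcoord_b2.
Qed.

Lemma verticalE i m w : (fcoord (a i) ord0 + fcoord (a i) i1 * toC m + fcoord (a i) i2 * toC w == 0) =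
  (m == vertical i).
Proof.
rewrite -(can_eq (@toCK R)) /vertical ofCK fcoord_a2 mul0r addr0.
have := line_solve (fcoord (a i) ord0) 0 (toC w) (toC m) (fcoord_a1 i).
by rewrite !mul0r oppr0 mul0r !addr0.
Qed.

Lemma affine_vec_form (u : 'cV[C]_3) z : affine_vec frame z *m u = 0 <->
  fcoord u ord0 + fcoord u i1 * toC z.1 + fcoord u i2 * toC z.2 = 0.
Proof.
rewrite (hcoord_form Mu); have [-> -> ->] := hcoord_affine Mu z.
by rewrite mul1r ![toC _ * _]mulrC.
Qed.

Lemma branch_continuous j : continuous (branch j).
Proof.
have c : continuous (fun m : plane => offset j + slope j * toC m).
  move=> m; apply: continuousD_at; first exact: continuous_cst.
  by apply: continuousM_at; [exact: continuous_cst|exact: toC_continuous].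
exact: continuous_comp2 c (@ofC_continuous R).
Qed.

Definition slope_bound : R := 1 + \sum_j (`|(ofC (offset j)).1| +
  `|(ofC (slope j)).1| + `|(ofC (slope j)).2|).

(** Its real part grows faster than the real part of any branch; this alone keeps it off all of
    them, also over the branch points. *)
Definition high_section (m : plane) : plane := (slope_bound * (1 + (`|m.1| + `|m.2|)), 0).

Lemma high_section_continuous : continuous high_section.
Proof.
apply: continuous_pair; last exact: continuous_cst.
apply: Defs.mul_continuous; first exact: continuous_cst.
apply: (@continuousD_fun R plane R^o (fun=> 1)); first exact: continuous_cst.
apply: (@continuousD_fun R plane R^o).
  exact: (@continuous_norm R plane R^o fst (@fst_continuous _ _)).
exact: (@continuous_norm R plane R^o snd (@snd_continuous _ _)).
Qed.

Lemma high_section_branch j m : high_section m != branch j m.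
Proof.
apply/eqP => /(congr1 fst) /=.
have -> : complex.Re (offset j + slope j * toC m) =
    (ofC (offset j)).1 + ((ofC (slope j)).1 * m.1 - (ofC (slope j)).2 * m.2).
  by case: (offset j) (slope j) m => ? ? [? ?] [? ?].
set p := (ofC (offset j)).1; set q := (ofC (slope j)).1; set t := (ofC (slope j)).2.
have sb : `|p| + `|q| + `|t| + 1 <= slope_bound.
  rewrite /slope_bound (bigD1 j) //= [leRHS]addrC lerD2r lerDl.
  by apply: sumr_ge0 => i _; rewrite !addr_ge0.
have h1 : p <= `|p| by exact: ler_norm.
have h2 : q * m.1 <= `|q| * `|m.1| by rewrite -normrM ler_norm.
have h3 : - (t * m.2) <= `|t| * `|m.2| by rewrite -normrM -normrN ler_norm.
have h4 : (`|p| + `|q| + `|t| + 1) * (1 + (`|m.1| + `|m.2|)) <=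
    slope_bound * (1 + (`|m.1| + `|m.2|)).
  by rewrite ler_wpM2r // !addr_ge0.
have : 0 <= `|p| * (`|m.1| + `|m.2|) by rewrite mulr_ge0 ?addr_ge0.
have : 0 <= `|q| * (1 + `|m.2|) by rewrite mulr_ge0 ?addr_ge0.
have : 0 <= `|t| * (1 + `|m.1|) by rewrite mulr_ge0 ?addr_ge0.
have : 0 <= `|m.1| + `|m.2| by rewrite addr_ge0.
nra.
Qed.

(** Pairs of branches with equal slopes are left out: being different lines they are parallel and
    never meet. *)
Definition branch_points : seq plane :=
  [seq ofC ((offset p.2 - offset p.1) / (slope p.1 - slope p.2)) |
    p <- enum [set: J * J]%SET & slope p.1 != slope p.2].

Lemma branch_distinct m i j : m \notin branch_points -> i != j -> branch i m != branch j m.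
Proof.
move=> mS ij; apply/negP; rewrite /branch (can_eq (@ofCK R)) => /eqP e.
have [s|s] := eqVneq (slope i) (slope j); last first.
  case/negP: mS; apply/mapP; exists (i, j); first by rewrite mem_filter s mem_enum inE.
  by rewrite -[LHS]toCK; congr ofC; exact/(lines_meet _ _ _ s).
have o : offset i = offset j by move: e; rewrite s => /addIr.
have /negP := b_b (fcoord (b i) i2 / fcoord (b j) i2) ij; apply.
have bE l : b l = fcoord (b l) i2 *: (a2 - offset l *: a0 - slope l *: a ord0).
  rewrite {1}[b l]fcoordE !scalerBr !scalerA /offset /slope !mulrN !(mulrCA (fcoord _ i2)).
  by rewrite mulfV ?fcoord_b2 // !mulr1 !scaleNr !opprK addrC addrA.
by apply/eqP; rewrite {1}(bE i) [X in _ = _ *: X](bE j) o s scalerA mulfVK ?fcoord_b2.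
Qed.

(** Otherwise two branches would meet on the vertical line [i], a triple point excluded by
    [generic]. *)
Lemma vertical_generic i : vertical i \notin branch_points.
Proof.
apply/negP => /mapP[[j j']]; rewrite mem_filter /= => /andP[s _] e.
have jj' : j != j' by apply: contraNneq s => ->.
pose w := branch j (vertical i).
have e' : w = branch j' (vertical i).
  by rewrite /w /branch; congr ofC; apply/(lines_meet _ _ _ s); rewrite e ofCK.
pose v := affine_vec frame (vertical i, w).
have v0 : v = 0.
  apply: (@generic i j j' v jj'); apply/affine_vec_form/eqP => /=.
  - by rewrite verticalE.
  - by rewrite branchE.
  - by rewrite branchE -e'.
by have /set_mem/= := affine_vec_neq0 Mu (vertical i, w); rewrite -/v v0 eqxx.
Qed.

Lemma vertical_inj : injective vertical.
Proof.
move=> i i' /(can_inj (@ofCK R)) /oppr_inj e; apply/eqP/negPn/negP => ii'.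
have /negP := a_a (fcoord (a i) i1 / fcoord (a i') i1) ii'; apply.
have aE l : a l = fcoord (a l) i1 *: ((fcoord (a l) ord0 / fcoord (a l) i1) *: a0 + a ord0).
  rewrite {1}[a l]fcoordE fcoord_a2 scale0r addr0 scalerDr scalerA.
  by rewrite mulrCA mulfV ?fcoord_a1 // mulr1.
by apply/eqP; rewrite {1}(aE i) [X in _ = _ *: X](aE i') e scalerA mulfVK ?fcoord_a1.
Qed.

Lemma total_connected : @path_connected R space (total branch setT).
Proof.
pose f j := (fcoord (b j) ord0, fcoord (b j) i1, fcoord (b j) i2).
have := @affine_complement_connected R J f; rewrite (_ : [set z | _] = total branch setT) //.
apply/seteqP; split=> [z h|z [_ h] j] /=; last by rewrite branchE h.
by split=> // j; have := h j; rewrite /= branchE.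
Qed.

Lemma total_punctured_connected : @path_connected R space (total branch (punctured vertical)).
Proof.
pose f (n : J + 'I_k.+1) := match n with
  | inl j => (fcoord (b j) ord0, fcoord (b j) i1, fcoord (b j) i2)
  | inr i => (fcoord (a i) ord0, fcoord (a i) i1, fcoord (a i) i2) end.
have := @affine_complement_connected R _ f.
rewrite (_ : [set z | _] = total branch (punctured vertical)) //.
apply/seteqP; split=> [z h|z [h1 h2] [j|i]] /=; last first.
- by rewrite verticalE h1.
- by rewrite branchE h2.
by split=> [i|j]; [have := h (inr i)|have := h (inl j)]; rewrite /= ?verticalE ?branchE.
Qed.

Lemma line_a0 p : line a0 p <-> hcoord frame (coords (repr p)) ord0 = 0.
Proof.
rewrite /line /=; have e : hcoord frame (coords (repr p)) ord0 = (coords (repr p) *m a0) ord0 ord0.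
  by rewrite /hcoord !mxE; apply: eq_bigr => i _; rewrite mxE.
rewrite e; split=> [->|h]; first by rewrite mxE.
by apply/matrixP => i j; rewrite !ord1 h mxE.
Qed.

(* The line a0 is at infinity: then the pencil consists of vertical lines. *)
Lemma pencil_pi1
    (x : [set p | [/\ ~ line a0 p, forall i, ~ line (a i) p & forall j, ~ line (b j) p]])
    (y : [set p | ~ line a0 p /\ forall j, ~ line (b j) p]) :
  set_val x = set_val y ->
  group_isomorphic (pi1 R x) (pi1 R y * free_group k.+1)%type.
Proof.
move=> xy.
have lb p j : hcoord frame (coords (repr p)) ord0 != 0 ->
    line (b j) p <-> (chart frame p).2 = branch j (chart frame p).1.
  move=> p0; rewrite (line_chart Mu) // -!/(fcoord _ _); split=> /eqP h; apply/eqP.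
    by rewrite -(branchE j).
  by rewrite branchE.
have la p i : hcoord frame (coords (repr p)) ord0 != 0 ->
    line (a i) p <-> (chart frame p).1 = vertical i.
  move=> p0; rewrite (line_chart Mu) // -!/(fcoord _ _); split=> /eqP h; apply/eqP.
    by rewrite -(verticalE i _ (chart frame p).2).
  by rewrite verticalE.
have BE p : ~ line a0 p /\ (forall j, ~ line (b j) p) <->
    hcoord frame (coords (repr p)) ord0 != 0 /\ total branch setT (chart frame p).
  split=> [[l0 h]|[p0 [_ h]]].
    have p0 : hcoord frame (coords (repr p)) ord0 != 0 by apply/eqP => /line_a0.
    by split=> //; split=> // j; apply/eqP => /(lb p j p0); exact: h.
  split=> [|j]; first by move=> /line_a0/eqP; exact/negP.
  by move=> /(lb p j p0)/eqP; exact/negP/h.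
have AE p : [/\ ~ line a0 p, forall i, ~ line (a i) p & forall j, ~ line (b j) p] <->
    hcoord frame (coords (repr p)) ord0 != 0 /\ total branch (punctured vertical) (chart frame p).
  split=> [[l0 h1 h]|[p0 [h1 h]]].
    have p0 : hcoord frame (coords (repr p)) ord0 != 0 by apply/eqP => /line_a0.
    split=> //; split=> [i|j]; apply/eqP.
      by move=> /(la p i p0); exact: h1.
    by move=> /(lb p j p0); exact: h.
  split=> [|i|j]; first by move=> /line_a0/eqP; exact/negP.
    by move=> /(la p i p0)/eqP; exact/negP/h1.
  by move=> /(lb p j p0)/eqP; exact/negP/h.
have xA : total branch (punctured vertical) (chart frame (set_val x)).
  by have [] := (AE _).1 (set_valP x).
have yB : total branch setT (chart frame (set_val y)) by have [] := (BE _).1 (set_valP y).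
apply: group_isomorphic_trans (chart_pi1 (y := in_set xA) Mu AE erefl) _.
apply: (@group_isomorphic_trans _ (pi1 R (in_set yB) * free_group k.+1)%type).
  apply: (affine_pi1 branch_continuous high_section_continuous high_section_branch
    branch_distinct vertical_generic vertical_inj total_punctured_connected total_connected).
apply: group_isomorphic_prod; last exact: group_isomorphic_refl.
by apply: group_isomorphic_sym; exact: (chart_pi1 (y := in_set yB) Mu BE erefl).
Qed.

End Pencil.

(** * Rearranging products of groups *)

Section GroupAlgebra.
Local Open Scope group_scope.
Local Notation Zmul := (Algebra.to_multiplicative int).

Definition gen1 : free_group 1 := free_gen ord0.
Definition gen1_exp (n : int) : free_group 1 :=
  match n with Posz m => gen1 ^+ m | Negz m => (gen1 ^+ m.+1)^-1 end.

Definition degree : free_group 1 -> Zmul := free_eval (fun=> (1%R : int) : Zmul).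

Lemma degreeM : {morph degree : u v / u * v}.
Proof. exact: free_evalM. Qed.

Lemma degree_gen1 : degree gen1 = (1%R : int).
Proof. by rewrite /degree free_eval_gen. Qed.

Lemma degreeX m : degree (gen1 ^+ m) = (Posz m : int).
Proof.
elim: m => [|m IH]; first by [].
by rewrite expgS degreeM IH degree_gen1 intS.
Qed.

Lemma degreeK (n : int) : degree (gen1_exp n) = n.
Proof.
case: n => m; first exact: degreeX.
apply: (mulIg (degree (gen1 ^+ m.+1))); rewrite -degreeM /= mulVg degreeX.
by rewrite NegzE; apply/esym; exact: addNr.
Qed.

Lemma gen1_exp_surj (w : free_group 1) : exists n, gen1_exp n = w.
Proof.
rewrite -(free_eval_id w) /free_eval; elim: (val w) => [|[i s] u [n nE]] /=.
  by exists 0%R.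
rewrite (ord1 i) -nE -/gen1 /letter_eval /=; case: s => /=; case: n {nE} => m /=.
- by exists (Posz m.+1); rewrite /= expgS.
- case: m => [|m]; first by exists 0%R; rewrite /= expg1 mulgV.
  by exists (Negz m); rewrite /= [gen1 ^+ m.+2]expgSr invgM mulVKg.
- case: m => [|m]; first by exists (Negz 0); rewrite /= expg0 mulg1 expg1.
  by exists (Posz m); rewrite /= expgS mulKg.
- by exists (Negz m.+1); rewrite /= [gen1 ^+ m.+2]expgSr invgM.
Qed.

Lemma free_group1 : group_isomorphic (free_group 1) Zmul.
Proof.
apply: (group_isomorphic_morph degreeM) => [u v|n]; last by exists (gen1_exp n); exact: degreeK.
have [n <-] := gen1_exp_surj u; have [m <-] := gen1_exp_surj v.
by rewrite !degreeK => ->.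
Qed.

Lemma direct_prodS (G : nat -> groupType) (n : nat) :
  group_isomorphic (direct_prod (fun i : 'I_n.+1 => G i))
    (direct_prod (fun i : 'I_n => G i) * G n)%type.
Proof.
pose f (d : direct_prod (fun i : 'I_n.+1 => G i)) :
    (direct_prod (fun i : 'I_n => G i) * G n)%type :=
  ((fun i : 'I_n => d (widen_ord (leqnSn n) i)), d ord_max).
apply: (@group_isomorphic_morph _ _ f) => //.
  move=> d d' [e1 e2]; apply: functional_extensionality_dep => i.
  have [lt|ge] := ltnP i n.
    have -> : i = widen_ord (leqnSn n) (Ordinal lt) by apply: val_inj.
    exact: (congr1 (fun g : direct_prod (fun i : 'I_n => G i) => g (Ordinal lt)) e1).
  have -> : i = ord_max by apply: val_inj; apply/eqP; rewrite eqn_leq ge -ltnS ltn_ord.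
  exact: e2.
move=> [d u].
have eqn (i : 'I_n.+1) : ~ (i < n)%N -> n = i.
  by move=> /negP; rewrite -leqNgt => ge; apply/eqP; rewrite eqn_leq ge -ltnS ltn_ord.
(* The last component lives in [G n] but is wanted in [G i], where [i] equals [n] only up to a
   proof; hence the transport. *)
pose g : direct_prod (fun i : 'I_n.+1 => G i) := fun i : 'I_n.+1 =>
  match pselect (is_true (i < n)%N) with
  | left lt => d (Ordinal lt)
  | right nlt => eq_rect n (fun m => G m : Type) u i (eqn i nlt) end.
exists g; congr pair.
  apply: functional_extensionality_dep => i; rewrite /g.
  case: pselect => [lt|nlt]; last by case: nlt; exact: (ltn_ord i).
  by case: i lt => m lt0 lt /=; rewrite (bool_irrelevance lt lt0).
rewrite /g; case: pselect => [lt|nlt]; first by have := lt; rewrite /= ltnn.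
by rewrite (eq_irrelevance (eqn ord_max nlt) (erefl n)).
Qed.

Lemma row_multiplicativeS (n : nat) :
  group_isomorphic (Algebra.to_multiplicative 'rV[int]_n.+1)
    (Algebra.to_multiplicative 'rV[int]_n * Zmul)%type.
Proof.
pose f (d : 'rV[int]_n.+1) : ('rV[int]_n * int)%type :=
  (\row_i d ord0 (widen_ord (leqnSn n) i), d ord0 ord_max).
apply: (@group_isomorphic_morph (Algebra.to_multiplicative 'rV[int]_n.+1)
    (Algebra.to_multiplicative 'rV[int]_n * Zmul)%type f).
- move=> d d'; congr pair; last by rewrite [LHS]mxE.
  by apply/rowP => i; rewrite [LHS]mxE [LHS]mxE [RHS]mxE !mxE.
- move=> d d' [/rowP e1 e2]; apply/rowP => i.
  have [lt|ge] := ltnP i n.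
    have -> : i = widen_ord (leqnSn n) (Ordinal lt) by apply: val_inj.
    by have := e1 (Ordinal lt); rewrite !mxE.
  have -> : i = ord_max by apply: val_inj; apply/eqP; rewrite eqn_leq ge -ltnS ltn_ord.
  exact: e2.
- move=> [d u]; exists (\row_(i < n.+1) if insub (val i) is Some j then (d : 'rV[int]_n) ord0 j else u).
  congr pair; last by rewrite mxE insubN //= ltnn.
  by apply/rowP => i; rewrite !mxE /= valK.
Qed.

Lemma group_isomorphic_regroup (A B C D : groupType) :
  group_isomorphic ((A * B) * C * D)%type ((A * D) * (B * C))%type.
Proof.
apply: (@group_isomorphic_morph _ _ (fun x : ((A * B) * C * D)%type =>
  ((x.1.1.1, x.2), (x.1.1.2, x.1.2)))) => //.
- by move=> [[[x y] z] w] [[[x' y'] z'] w'] [-> -> -> ->].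
- by move=> [[x w] [y z]]; exists (((x, y), z), w).
Qed.

End GroupAlgebra.

(** * Line arrangements *)

Section Lines.
Context {R : realType}.
Local Notation C := R[i].
Local Notation CP2 := (CP2 R).
Implicit Types (l : set CP2) (p : CP2).

Lemma is_real_line_line l : is_real_line l -> is_line l.
Proof.
case=> a a0 ->; exists (map_mx (real_complex R) a) => //.
by rewrite map_mx_eq0.
Qed.

Definition covector l : 'cV[C]_3 := xget 0 [set a : 'cV[C]_3 | a != 0 /\ l = line a].

Lemma covectorP l : is_line l -> covector l != 0 /\ l = line (covector l).
Proof.
case=> a a0 la; apply: (xgetPex 0 (P := [set a : 'cV[C]_3 | a != 0 /\ l = line a])).
by exists a.
Qed.

Lemma covectorE l : is_line l -> line (covector l) = l.
Proof. by move=> /covectorP[_ <-]. Qed.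

Lemma covectorN l l' c : is_line l -> is_line l' -> l != l' -> covector l != c *: covector l'.
Proof.
move=> /covectorP[l0 lE] /covectorP[l'0 l'E]; apply: contra_neq => e.
have c0 : c != 0 by apply: contraNneq l0 => c0; rewrite e c0 scale0r.
rewrite lE l'E e; apply/seteqP; split=> p; rewrite /line /= -scalemxAr.
  by move/eqP; rewrite scaler_eq0 (negbTE c0) => /eqP.
by move=> ->; rewrite scaler0.
Qed.

Lemma point_of_vec (v : 'rV[C]_3) : v != 0 ->
  exists p, forall a, line a p <-> v *m a = 0.
Proof.
move=> v0; exists (\pi_CP2 (exist _ v (mem_set v0) : punctured_C3 R)) => a.
by rewrite line_pi.
Qed.

(** A matrix with three rows and two columns has a nonzero left kernel vector. *)
Lemma lines_intersect l l' : is_line l -> is_line l' -> exists p, l p /\ l' p.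
Proof.
move=> [a _ ->] [a' _ ->].
have : kermx (row_mx a a') != 0.
  by rewrite kermx_eq0 /row_free neq_ltn ltnS rank_leq_col.
case/rowV0Pn => v /sub_kermxP; rewrite mul_mx_row => e v0.
have [p pE] := point_of_vec v0; exists p; rewrite !pE.
by move: e; rewrite -[0 in RHS]row_mx0 => /eq_row_mx.
Qed.

(** Passes from equations to lines: each line receives a chosen covector, and distinct lines have
    covectors that are not proportional. *)
Lemma pencil_lines_pi1 (l0 : set CP2) (s : seq (set CP2)) (rest : {fset (set CP2)})
    (P : CP2) (A B : set CP2) (x : A) (y : B) :
  s != [::] -> uniq (l0 :: s) ->
  (forall l, l \in l0 :: s -> is_line l /\ l P) ->
  (forall l, l \in rest -> is_line l /\ ~ l P) ->
  (forall l r r' p, l \in s -> r \in rest -> r' \in rest -> r != r' -> l p -> r p -> ~ r' p) ->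
  (forall p, A p <-> [/\ ~ l0 p, forall l, l \in s -> ~ l p & forall l, l \in rest -> ~ l p]) ->
  (forall p, B p <-> ~ l0 p /\ forall l, l \in rest -> ~ l p) ->
  set_val x = set_val y ->
  group_isomorphic (pi1 R x) (pi1 R y * free_group (size s))%type.
Proof.
case: s => // l1 s _ us lP rP gen AE BE.
have isl l : l \in l0 :: l1 :: s -> is_line l by move=> /lP[].
have isr (j : rest) : is_line (val j) by have [] := rP _ (valP j).
pose a (i : 'I_(size s).+1) := covector (nth l1 (l1 :: s) i).
pose b (j : rest) := covector (val j).
have sP (i : 'I_(size s).+1) : nth l1 (l1 :: s) i \in l1 :: s by exact: mem_nth.
have isa (i : 'I_(size s).+1) : is_line (nth l1 (l1 :: s) i).
  by apply: isl; rewrite inE sP orbT.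
have is0 : is_line l0 by apply: isl; rewrite mem_head.
pose vP := coords (repr P).
have vPE l : is_line l -> (l P <-> vP *m covector l = 0).
  by move=> ll; rewrite -{1}(covectorE ll).
have eA : A = [set p | [/\ ~ line (covector l0) p, forall i, ~ line (a i) p &
    forall j, ~ line (b j) p]].
  apply/seteqP; split=> p.
    move=> /AE[h0 h1 h2]; split=> [|i|j].
    - by rewrite (covectorE is0).
    - by rewrite (covectorE (isa i)); exact: h1 (sP i).
    - by rewrite (covectorE (isr j)); exact: h2 (valP j).
  move=> [h0 h1 h2]; apply/AE; rewrite -{1}(covectorE is0); split=> // l ls.
    have il : (index l (l1 :: s) < (size s).+1)%N by rewrite index_mem.
    by have := h1 (Ordinal il); rewrite covectorE // nth_index.
  by have := h2 [` ls]%fset; rewrite covectorE.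
have eB : B = [set p | ~ line (covector l0) p /\ forall j, ~ line (b j) p].
  apply/seteqP; split=> p.
    move=> /BE[h0 h2]; split=> [|j]; first by rewrite (covectorE is0).
    by rewrite (covectorE (isr j)); exact: h2 (valP j).
  move=> [h0 h2]; apply/BE; rewrite -{1}(covectorE is0); split=> // l ls.
  by have := h2 [` ls]%fset; rewrite covectorE.
subst A B; apply: (@pencil_pi1 R rest (size s) (covector l0) a b vP).
- exact: coords_neq0.
- by apply/(vPE _ is0); have [] := lP l0 (mem_head _ _).
- by move=> i; apply/(vPE _ (isa i)); have [] := lP _ (mem_behead (s := l0 :: l1 :: s) (sP i)).
- by move=> j; apply/eqP => /(vPE _ (isr j)) h; have [_] := rP _ (valP j); apply; exact: h.
- by have [] := covectorP is0.
- move=> i c; apply: covectorN => //; apply: contraTneq us => <-.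
  by rewrite cons_uniq sP.
- move=> i i' c ii'; apply: covectorN => //; rewrite nth_uniq //.
  by have := us; rewrite cons_uniq => /andP[].
- move=> j j' c jj'; apply: covectorN => //.
- move=> i j j' v jj' va vb vb'; apply/eqP; apply/negPn/negP => v0.
  have [p pE] := point_of_vec v0.
  have lp l : is_line l -> v *m covector l = 0 -> l p by move=> ll /pE; rewrite covectorE.
  apply: (gen _ _ _ p (sP i) (valP j) (valP j')) => //; exact: lp.
Qed.

(** Gaussian elimination exhibits [a] as a nonzero multiple of the first column of the invertible
    matrix [col_ebase a]. *)
Lemma line_frame (a : 'cV[C]_3) : a != 0 ->
  exists2 M, M \in unitmx & forall p, line a p <-> hcoord M (coords (repr p)) ord0 = 0.
Proof.
move=> a0; exists (col_ebase a); first exact: col_ebase_unit.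
have ra : \rank a = 1%N.
  by apply/eqP; rewrite eqn_leq rank_leq_col lt0n mxrank_eq0.
move=> p; rewrite /line /=; set v := coords _.
have -> : v *m a = (v *m col_ebase a) *m pid_mx 1 *m row_ebase a.
  by rewrite -[X in v *m X = _]mulmx_ebase ra !mulmxA.
rewrite /hcoord; set w := v *m _.
have -> : w *m (pid_mx 1 : 'M[C]_(3, 1)) = (w ord0 ord0)%:M.
  apply/matrixP => i j; rewrite !ord1 !mxE sum3 !mxE /=.
  by rewrite mulr1 !mulr0 !addr0.
rewrite mul_scalar_mx; split=> [/eqP|->]; last by rewrite scale0r.
rewrite scaler_eq0 => /orP[/eqP//|/eqP r0].
by have := row_ebase_unit a; rewrite r0 unitmxE det0 unitr0.
Qed.

Lemma whole_space_pi1 (V : normedModType R) (x : [set: V]) (g : pi1 R x) : g = 1%g.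
Proof.
have [p pl <-] := loop_class_surj g.
rewrite -(loop_class_cst x); apply/loop_class_eqP => //.
  exact: cst_path_in.
have [cp _ p0 p1] := pl.
apply: (@convex_homotopic R V setT V setT id) => //.
  by move=> z; exact: cvg_id.
exact: cst_continuous.
Qed.

(* The complement of a line is a copy of [C^2], which is convex. *)
Lemma affine_plane_pi1 (h : set CP2) (A : set CP2) (x : A) : is_line h ->
  (forall p, A p <-> ~ h p) -> forall g g' : pi1 R x, g = g'.
Proof.
move=> [a a0 ->] AE g g'; have [M Mu ME] := line_frame a0.
pose y : [set: plane * plane] := in_set (Logic.I : [set: @plane R * @plane R] (chart M (set_val x))).
have AM p : A p <-> hcoord M (coords (repr p)) ord0 != 0 /\ [set: @plane R * @plane R] (chart M p).
  rewrite AE ME; split=> [p0|[p0 _]]; last by apply/eqP.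
  by split=> //; apply/eqP.
have [f [f' fK _]] := chart_pi1 (y := y) Mu AM erefl.
by apply: (can_inj fK); rewrite (whole_space_pi1 (f g)) (whole_space_pi1 (f g')).
Qed.

End Lines.

Lemma subsingleton_isomorphic (G H : groupType) :
  (forall u v : G, u = v) -> (forall u v : H, u = v) -> group_isomorphic G H.
Proof.
move=> G1 H1; apply: (@group_isomorphic_morph _ _ (fun=> 1%g)) => [u v|u v _|v].
- exact: H1.
- exact: G1.
- by exists 1%g.
Qed.

(** * Induction over the pencils of the arrangement *)

Section ArrangementStages.
Context {R : realType} (t : nat) (L : {fset (set (CP2 R))}) (P : 'I_t -> CP2 R)
  (S : 'I_t -> {fset (set (CP2 R))}) (k : nat -> nat) (h : set (CP2 R)).
Local Open Scope fset_scope.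
Hypothesis L_S : forall l, l \in L <-> exists i, l \in S i.
Hypothesis L_line : forall l, l \in L -> is_line l.
Hypothesis S_P : forall i l, l \in S i -> l (P i).
Hypothesis P_S : forall i j l, l \in S i -> l (P j) -> i = j.
Hypothesis card_S : forall i : 'I_t, #|` S i| = (k i).+1.
Hypothesis k_gt0 : forall i : 'I_t, (0 < k i)%N.
Hypothesis h_line : is_line h.
Hypothesis h_L : h \notin L.
Hypothesis h_generic : forall l l' p, l \in L -> l' \in L -> l != l' -> l p -> l' p -> ~ h p.
Hypothesis P_multiple : forall l l' l'' p, l \in L -> l' \in L -> l'' \in L ->
  l != l' -> l != l'' -> l' != l'' -> l p -> l' p -> l'' p -> exists i, p = P i.

Definition earlier_lines (j : nat) : {fset (set (CP2 R))} :=
  [fset l in L | [exists i : 'I_t, (i < j)%N && (l \in S i)]].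

Definition stage (j : nat) : set (CP2 R) :=
  [set p | ~ h p /\ forall l, l \in earlier_lines j -> ~ l p]%classic.

Lemma earlier_linesP j l :
  l \in earlier_lines j <-> exists2 i : 'I_t, (i < j)%N & l \in S i.
Proof.
rewrite !inE; split=> [/andP[_ /existsP[i /andP[]]]|[i ij lS]]; first by exists i.
apply/andP; split; first by apply/L_S; exists i.
by apply/existsP; exists i; rewrite ij.
Qed.

Lemma earlier_linesL j l : l \in earlier_lines j -> l \in L.
Proof. by rewrite !inE => /andP[]. Qed.

Lemma earlier_linesS (i : 'I_t) l :
  l \in earlier_lines i.+1 <-> l \in S i \/ l \in earlier_lines i.
Proof.
split=> [/earlier_linesP[m]|[lS|/earlier_linesP[m mi lS]]].
- rewrite ltnS leq_eqVlt => /orP[/eqP/val_inj -> ?|mi lS]; first by left.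
  by right; apply/earlier_linesP; exists m.
- by apply/earlier_linesP; exists i.
- by apply/earlier_linesP; exists m => //; exact: leqW.
Qed.

Lemma SL i l : l \in S i -> l \in L.
Proof. by move=> lS; apply/L_S; exists i. Qed.

Lemma earlier_lines_P (i : 'I_t) r : r \in earlier_lines i -> ~ r (P i).
Proof. by move=> /earlier_linesP[m mi rS] /(P_S rS) e; rewrite e ltnn in mi. Qed.

Lemma earlier_lines_neq (i : 'I_t) l r : l \in S i -> r \in earlier_lines i -> l != r.
Proof.
move=> lS rE; apply/eqP => e; apply: (earlier_lines_P rE); rewrite -e; exact: S_P.
Qed.

(** Such a [p] would be a multiple point, hence the one on [l], namely [P i]; but the earlier lines
    miss [P i]. *)
Lemma earlier_lines_simple (i : 'I_t) l r r' p : l \in S i ->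
  r \in earlier_lines i -> r' \in earlier_lines i -> r != r' -> l p -> r p -> ~ r' p.
Proof.
move=> lS rE r'E rr' lp rp r'p.
have [m pm] := P_multiple (SL lS) (earlier_linesL rE) (earlier_linesL r'E)
  (earlier_lines_neq lS rE) (earlier_lines_neq lS r'E) rr' lp rp r'p.
by subst p; rewrite -(P_S lS lp) in rp; exact: earlier_lines_P rE rp.
Qed.

Lemma stage0 (x : stage 0) : forall g g' : pi1 R x, g = g'.
Proof.
apply: (affine_plane_pi1 h_line) => p; split=> [[]//|hp]; split=> // l.
by move=> /earlier_linesP[].
Qed.

Lemma stageS (i : 'I_t) (x : stage i.+1) : exists y : stage i,
  group_isomorphic (pi1 R x) ((pi1 R y * free_group 1) * free_group (k i))%type.
Proof.
have [l0 [s sE]] : exists l0 s, enum_fset (S i) = l0 :: s.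
  by have := card_S i; case: (enum_fset (S i)) => // l0 s _; exists l0, s.
have us : uniq (l0 :: s) by rewrite -sE fset_uniq.
have inS l : (l \in S i) = (l \in l0 :: s) by rewrite -sE.
have size_s : size s = k i by have := card_S i; rewrite sE => -[].
have l0S : l0 \in S i by rewrite inS mem_head.
have sS l : l \in s -> l \in S i by rewrite inS inE orbC => ->.
have [l1 l1s] : exists l1, l1 \in s.
  by case: (s) size_s (k_gt0 i) => [<-//|l1 s' _ _]; exists l1; rewrite mem_head.
have l01 : l0 != l1 by apply: contraTneq us => ->; rewrite /= l1s.
(* [P i] is a crossing of [l0] and [l1], and [h] contains no crossing; hence [h] is transversal to
   the pencil at [P i]. *)
have hP : ~ h (P i) by apply: (h_generic (SL l0S) (SL (sS _ l1s))) => //; apply: S_P; [|exact: sS].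
have hl l : l \in L -> h != l by move=> lL; apply: contraNneq h_L => ->.
(* The set between the two removals: [l0] is gone and the other lines through [P i] are not. Here
   [l0] serves as infinity and [h] is one of the transversal lines. *)
pose W : set (CP2 R) := [set p | ~ l0 p /\ forall l, l \in (h |` earlier_lines i)%fset -> ~ l p]%classic.
have xx := set_valP x.
have xl l : l \in S i -> ~ l (set_val x).
  by move=> lS; apply: xx.2; apply/earlier_linesS; left.
have Wx : W (set_val x).
  split=> [|l]; first exact: xl.
  by rewrite !in_fset1U => /orP[/eqP ->|lE]; [exact: xx.1|apply: xx.2; apply/earlier_linesS; right].
have Zx : stage i (set_val x).
  by split=> [|l lE]; [exact: xx.1|apply: xx.2; apply/earlier_linesS; right].
exists (in_set Zx).
(* The vertex of the pencil spanned by [h] and [l0]. An earlier line through [q] would cross [l0] on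
   [h]. *)
have [q [hq l0q]] := lines_intersect h_line (L_line (SL l0S)).
have step1 : group_isomorphic (pi1 R x) (pi1 R (in_set Wx) * free_group (size s))%type.
  apply: (@pencil_lines_pi1 R l0 s (h |` earlier_lines i) (P i) (stage i.+1) W) => //.
  - by apply: contraTneq l1s => ->.
  - by move=> l; rewrite -inS => lS; split; [exact: L_line (SL lS)|exact: S_P].
  - move=> l; rewrite !in_fset1U => /orP[/eqP ->|lE] //.
    by split; [exact: L_line (earlier_linesL lE)|exact: earlier_lines_P].
  (* With [h] among the transversal lines there is a new kind of triple point, a crossing of [l]
     with an earlier line on [h]; [h_generic] excludes it. *)
  - move=> l r r' p /sS lS rE r'E rr' lp rp r'p.
    have nh r1 : r1 \in earlier_lines i -> r1 p -> ~ h p.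
      by move=> r1E r1p; exact: (h_generic (SL lS) (earlier_linesL r1E)
        (earlier_lines_neq lS r1E) lp r1p).
    move: rE r'E rr' rp r'p; rewrite !in_fset1U => /orP[/eqP ->|rE] /orP[/eqP ->|r'E].
    + by rewrite eqxx.
    + by move=> _ hp /(nh _ r'E).
    + by move=> _ /(nh _ rE).
    + by move=> rr' rp r'p; exact: (earlier_lines_simple lS rE r'E rr' lp rp r'p).
  - move=> p; split=> [[hp ep]|[p0 ps pr]].
      split=> [|l ls|l].
      + by apply: ep; apply/earlier_linesS; left.
      + by apply: ep; apply/earlier_linesS; left; exact: sS.
      + by rewrite !in_fset1U => /orP[/eqP ->//|lE]; apply: ep; apply/earlier_linesS; right.
    split=> [|l]; first by apply: pr; rewrite in_fset1U eqxx.
    move=> /earlier_linesS[|lE]; last by apply: pr; rewrite in_fset1U lE orbT.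
    by rewrite inS inE => /orP[/eqP ->//|]; exact: ps.
have step2 : group_isomorphic (pi1 R (in_set Wx)) (pi1 R (in_set Zx) * free_group 1)%type.
  apply: (@pencil_lines_pi1 R h [:: l0] (earlier_lines i) q W (stage i)) => //.
  - by rewrite /= inE hl // (SL l0S).
  - move=> l; rewrite !inE => /orP[] /eqP -> //.
    by split=> //; exact: L_line (SL l0S).
  - move=> l lE; split; first exact: L_line (earlier_linesL lE).
    move=> lq; exact: (h_generic (SL l0S) (earlier_linesL lE)
      (earlier_lines_neq l0S lE) l0q lq hq).
  - move=> l r r' p; rewrite inE => /eqP ->; exact: earlier_lines_simple.
  - move=> p; split=> [[p0 pr]|[hp p0 pr]].
      split=> [|l|l lE]; first by apply: pr; rewrite in_fset1U eqxx.
        by rewrite inE => /eqP ->.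
      by apply: pr; rewrite in_fset1U lE orbT.
    split=> [|l]; first by apply: p0; rewrite inE.
    by rewrite !in_fset1U => /orP[/eqP ->//|]; exact: pr.
rewrite -size_s; apply: group_isomorphic_trans step1 _.
by apply: group_isomorphic_prod => //; exact: group_isomorphic_refl.
Qed.

Lemma stage_pi1 j (x : stage j) : (j <= t)%N ->
  group_isomorphic (pi1 R x) (direct_prod (fun i : 'I_j => free_group (k i)) *
    Algebra.to_multiplicative 'rV[int]_j)%type.
Proof.
elim: j x => [|j IH] x jt.
  apply: subsingleton_isomorphic; first exact: stage0.
  move=> [f m] [f' m']; congr pair; last by apply/rowP => -[].
  by apply: functional_extensionality_dep => -[].
have [y xy] := @stageS (Ordinal jt) x.
apply: group_isomorphic_trans xy _.
pose D := direct_prod (fun i : 'I_j => free_group (k i)).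
apply: (@group_isomorphic_trans _ ((D * Algebra.to_multiplicative 'rV[int]_j) *
    Algebra.to_multiplicative int * free_group (k j))%type).
  apply: group_isomorphic_prod; last exact: group_isomorphic_refl.
  by apply: group_isomorphic_prod; [exact: IH (ltnW jt)|exact: free_group1].
apply: group_isomorphic_trans (group_isomorphic_regroup _ _ _ _) _.
apply: group_isomorphic_prod; apply: group_isomorphic_sym.
  exact: (direct_prodS (fun i => free_group (k i)) j).
exact: row_multiplicativeS.
Qed.

End ArrangementStages.

Unset Implicit Arguments.

Theorem theorem3p1p1 (R : realType) (L : {fset (set (CP2 R))})
    (t : nat) (P : 'I_t -> CP2 R) (k : 'I_t -> nat) (h : set (CP2 R)) :
  real_line_arrangement L ->
  noncollinear_multiple_points L P ->
  (forall i, multiplicity L (P i) = (k i).+1) ->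
  is_line h ->
  h \notin L ->
  (forall l l', l \in L -> l' \in L -> l != l' ->
     l `&` l' `<=` affine_plane h) ->
  forall x : affine_plane h `\` lines_union L,
    group_isomorphic (pi1 R x)
      (direct_prod (fun i : 'I_t => free_group (k i)) *
       Algebra.to_multiplicative 'rV[int]_t)%type.
Proof.
move=> Lreal [P_inj P_mult P_coll [S [L_S S_disj S_P]]] Pk h_line h_L h_generic x.
(* With the ranks defined on all of [nat], the products over ['I_j] in the induction on [j] use the
   same function without casts; the value 0 beyond [t] is a mere default. *)
have [k' kE] : exists k' : nat -> nat, k = fun i : 'I_t => k' i.
  exists (fun m => if insub m is Some i then k i else 0%N).
  by apply/funext => i; rewrite valK.
subst k.
have L_line l : l \in L -> is_line l by move=> /Lreal/is_real_line_line.
have multP i : multiple_point L (P i) by apply/P_mult; exists i.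
have P_S i j l : l \in S i -> l (P j) -> i = j.
  move=> lS lP; apply: P_inj; apply: (P_coll l) => //; last exact: S_P.
  by apply/L_S; exists i.
have card_S i : #|` S i|%fset = (k' i).+1.
  rewrite -Pk /multiplicity; congr (#|` _|)%fset; apply/fsetP => l; rewrite !inE.
  apply/idP/andP => [lS|[/L_S[j lS] /asboolP lP]]; last by rewrite -(P_S _ _ _ lS lP).
  by split; [apply/L_S; exists i|apply/asboolP; exact: S_P].
have k_gt0 (i : 'I_t) : (0 < k' i)%N.
  by have := multP i; rewrite /multiple_point Pk ltnS; exact: ltnW.
have P_multiple l l' l'' p : l \in L -> l' \in L -> l'' \in L ->
    l != l' -> l != l'' -> l' != l'' -> l p -> l' p -> l'' p -> exists i, p = P i.
  move=> lL l'L l''L n1 n2 n3 lp l'p l''p.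
  suff /P_mult[i <-] : multiple_point L p by exists i.
  have u : uniq [:: l; l'; l''] by rewrite /= !inE negb_or n1 n2 n3.
  apply: (uniq_leq_size u) => r; rewrite !inE.
  by case/or3P => /eqP ->; apply/andP; split=> //; apply/asboolP.
have h_gen l l' p : l \in L -> l' \in L -> l != l' -> l p -> l' p -> ~ h p.
  by move=> lL l'L ll' lp l'p; exact: (h_generic l l' lL l'L ll' p (conj lp l'p)).
have E : affine_plane h `\` lines_union L = stage L S h t.
  apply/seteqP; split=> p [hp lp]; split=> //.
    by move=> l lE lp'; apply: lp; exists l => //; exact: earlier_linesL lE.
  case=> l lL lp'; have /L_S[i lS] := lL.
  by apply: (lp l) => //; apply/(earlier_linesP L_S); exists i.
move: x; rewrite E => x.
exact: (stage_pi1 L_S L_line S_P P_S card_S k_gt0 h_line h_L h_gen P_multiple x (leqnn t)).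
Qed.
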